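(* Let $f\in M_o$. If $O_f$ is not contained in a single Fatou component of $f$, then $\mathcal{J}(f)$ is not totally disconnected.
   Context: $\widehat{\mathbb{C}}=\mathbb{C}\cup\{\infty\}$. For a transcendental meromorphic $f:\mathbb{C}\to\widehat{\mathbb{C}}$, the Fatou set $\mathcal{F}(f)$ is the set of $z\in\widehat{\mathbb{C}}$ having a neighborhood on which all iterates $f^n$ are defined and form a normal family; the Julia set is $\mathcal{J}(f)=\widehat{\mathbb{C}}\setminus\mathcal{F}(f)$. A Fatou component is a connected component of $\mathcal{F}(f)$. $M$ is the class of transcendental meromorphic functions $f:\mathbb{C}\to\widehat{\mathbb{C}}$ having either at least two poles, or exactly one pole which is not an omitted value. $O_f$ is the set of omitted values of $f$ (values in $\widehat{\mathbb{C}}$ not taken by $f$ on $\mathbb{C}$; for $f\in M$ these are finite and there are at most two). $M_o=\{f\in M: O_f\neq\emptyset\}$. *)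

(* Defs.v *)
From mathcomp Require Import all_boot all_order all_algebra.
From mathcomp Require Import all_classical all_reals all_analysis.
From mathcomp Require Import complex.
Import Order.TTheory GRing.Theory Num.Theory.
Import numFieldNormedType.Exports.

Set Implicit Arguments.
Unset Strict Implicit.
Unset Printing Implicit Defensive.

Local Open Scope classical_set_scope.
Local Open Scope ring_scope.

(* Declared at [numClosedFieldType] so that the topology, norm and normed-module
   structures of a generic [numClosedFieldType] apply to it. *)
Definition Cplx (R : realType) : numClosedFieldType := R[i].

Definition sphere (R : realType) : topologicalType :=
  one_point_compactification (Cplx R).

Section Meromorphic.
Variable R : realType.
Notation C := (Cplx R).
Notation Chat := (sphere R).

Definition fin (z : C) : Chat := Some z.
Definition infty : Chat := None.

(* The value [0] at infinity is junk; [finpart] is only used near points where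
   the function at hand is finite. *)
Definition finpart (w : Chat) : C := if w is Some z then z else 0.

(* [derivable _ z 1] over the field [C] is complex differentiability. *)
Definition diff_at (f : C -> Chat) (z : C) : Prop :=
  f z <> infty /\ derivable (finpart \o f : C -> C) z 1.

Definition holomorphic_at (f : C -> Chat) (z : C) : Prop :=
  \forall w \near z, diff_at f w.

Definition pole_at (f : C -> Chat) (z : C) : Prop :=
  [/\ f z = infty,
      \forall w \near z^', diff_at f w &
      f w @[w --> z^'] --> infty].

Definition meromorphic (f : C -> Chat) : Prop :=
  forall z, holomorphic_at f z \/ pole_at f z.

Definition rational (f : C -> Chat) : Prop :=
  exists p q : {poly C}, coprimep p q /\
    forall z, f z = if q.[z] == 0 then infty else fin (p.[z] / q.[z]).

Definition transcendental_meromorphic (f : C -> Chat) : Prop :=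
  meromorphic f /\ ~ rational f.

Definition omitted_values (f : C -> Chat) : set Chat := ~` range f.

Definition class_M (f : C -> Chat) : Prop :=
  transcendental_meromorphic f /\
  ((exists a b : C, [/\ a <> b, pole_at f a & pole_at f b]) \/
   (exists a : C, pole_at f = [set a] /\ ~ omitted_values f (fin a))).

Definition class_Mo (f : C -> Chat) : Prop :=
  class_M f /\ omitted_values f !=set0.

(* [f] is undefined at infinity; the value chosen here is junk, and is screened
   off by [iterate_defined] below. *)
Definition extend (f : C -> Chat) (w : Chat) : Chat :=
  if w is Some z then f z else infty.

Definition iterate (f : C -> Chat) (n : nat) (w : Chat) : Chat :=
  iter n (extend f) w.

(* f^n(w) makes sense iff w, f(w), ..., f^(n-1)(w) all lie in C. *)
Definition iterate_defined (f : C -> Chat) (n : nat) (w : Chat) : Prop :=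
  forall k, (k < n)%N -> iterate f k w <> infty.

(* The chordal metric; like all norms over [C], it takes its (real) values in
   [C], on whose real elements the order is the usual one. *)
Definition chordal (u v : Chat) : C :=
  match u, v with
  | Some z, Some w =>
      2 * `|z - w| / (sqrtC (1 + `|z| ^+ 2) * sqrtC (1 + `|w| ^+ 2))
  | Some z, None | None, Some z => 2 / sqrtC (1 + `|z| ^+ 2)
  | None, None => 0
  end.

Definition locally_uniform_cvg (U : set Chat) (g : nat -> Chat -> Chat)
    (h : Chat -> Chat) : Prop :=
  forall K : set Chat, compact K -> K `<=` U ->
  forall e : C, 0 < e ->
    \forall n \near \oo, forall w, K w -> chordal (g n w) (h w) < e.

Definition normal_family (U : set Chat) (G : set (Chat -> Chat)) : Prop :=
  forall g : nat -> Chat -> Chat, (forall n, G (g n)) ->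
  exists (s : nat -> nat) (h : Chat -> Chat),
    {homo s : m n / (m < n)%N} /\ locally_uniform_cvg U (g \o s) h.

Definition Fatou (f : C -> Chat) : set Chat :=
  [set z | exists U : set Chat,
     [/\ open_nbhs z U,
         forall n w, U w -> iterate_defined f n w &
         normal_family U (range (iterate f))]].

Definition Julia (f : C -> Chat) : set Chat := ~` Fatou f.

Definition Fatou_component (f : C -> Chat) (U : set Chat) : Prop :=
  exists2 z, Fatou f z & U = connected_component (Fatou f) z.

End Meromorphic.

(* Main.v *)
(* Suppose that the Julia set J is totally disconnected. Then the Fatou set F is
   connected, by planar separation, so some omitted value a lies in J. As f has a pole,
   a is finite and g = 1 / (f - a) is entire.

   Ultrafilters replace subsequences: the iterates have a limit on F along every
   ultrafilter on the indices. Every limit along a nonprincipal ultrafilter is constant: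
   a nonconstant one would force f to be injective on F, and then f would be
   rational by Liouville.

   Surround a by a small bounded open set B0 with boundary K0 in F. If B is a bounded
   neighbourhood of a with boundary in f^n(K0), some iterate f^m has a pole in B (else
   B would lie in F by the maximum principle), and because f^m omits a on B there is a
   new bounded neighbourhood of a with boundary in f^(n+m)(K0). So arbitrarily high
   iterates of K0 surround a; but along an ultrafilter these sets shrink to a point c.
   A finite c is fixed by f, so differs from a, and cannot be surrounded in this way; if
   c is infinite then g is arbitrarily small on boundaries surrounding a at distance at
   least 1, so g vanishes identically. *)

Require Import Defs.
From mathcomp Require Import all_boot all_order all_algebra.
From mathcomp Require Import all_classical all_reals all_analysis.
From mathcomp Require Import complex zify ring lra.
Import Order.TTheory GRing.Theory Num.Theory.
Import numFieldNormedType.Exports.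

Set Implicit Arguments.
Unset Strict Implicit.
Unset Printing Implicit Defensive.

Local Open Scope classical_set_scope.
Local Open Scope ring_scope.
Local Open Scope complex_scope.

(** * Complex numbers with a real-valued modulus *)

(** Complex analysis rests here on the maximum principle, not on Cauchy's formula. A second
    difference test gives it to functions with two derivatives, and estimates for difference
    quotients then yield removable singularities, uniform limits and smooth derivatives. The
    obstacle is that meromorphic functions come with one derivative only; Goursat's theorem serves
    to close this gap. Limit functions on the Fatou set are constant for two reasons. One with all
    values in the Julia set maps a connected set into a totally disconnected one. One with a value
    in the Fatou set, if not locally constant there, makes points return: the differences of two
    large indices give iterates which in the limit fix an accumulating set of points. No winding
    number occurs. A bounded open set around the omitted value is carried forward as the complement
    of the image of its closure, and of the old boundary only its image is remembered. *)

Section Modulus.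
Variable R : realType.
Notation C := (Cplx R).
Implicit Types (z w : C) (r e d : R).

(* The norm of [C] takes its values in [C]; [cabs] takes them in [R]. *)
Definition cabs (z : C) : R := ComplexField.Normc.normc z.
Definition ofR (r : R) : C := (r%:C)%C.
Definition ofRI (x y : R) : C := (x +i* y)%C.
Definition re (z : C) : R := complex.Re z.
Definition im (z : C) : R := complex.Im z.

Lemma normE z : `|z| = ofR (cabs z). Proof. by case: z. Qed.
Lemma cabs_sqr z : cabs z ^+ 2 = re z ^+ 2 + im z ^+ 2.
Proof. by case: z => a b; rewrite /cabs /= sqr_sqrtr // addr_ge0 // sqr_ge0. Qed.
Lemma cabs_ge0 z : 0 <= cabs z. Proof. by case: z => a b; exact: sqrtr_ge0. Qed.
Lemma cabs0 : cabs 0 = 0. Proof. exact: ComplexField.Normc.normc0. Qed.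
Lemma cabs1 : cabs 1 = 1. Proof. exact: ComplexField.Normc.normc1. Qed.
Lemma cabs0_eq0 z : cabs z = 0 -> z = 0.
Proof. exact: ComplexField.Normc.eq0_normc. Qed.
Lemma cabs_eq0 z : (cabs z == 0) = (z == 0).
Proof. by apply/eqP/eqP => [/cabs0_eq0//|->]; rewrite cabs0. Qed.
Lemma cabs_gt0 z : (0 < cabs z) = (z != 0).
Proof. by rewrite lt_neqAle cabs_ge0 andbT eq_sym cabs_eq0. Qed.
Lemma cabsM z w : cabs (z * w) = cabs z * cabs w.
Proof. exact: ComplexField.Normc.normcM. Qed.
Lemma cabsV z : cabs z^-1 = (cabs z)^-1.
Proof. exact: ComplexField.Normc.normcV. Qed.
Lemma cabsX z n : cabs (z ^+ n) = cabs z ^+ n.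
Proof. by elim: n => [|n IH]; rewrite ?expr0 ?cabs1// !exprS cabsM IH. Qed.
Lemma cabsN z : cabs (- z) = cabs z. Proof. exact: normcN. Qed.
Lemma cabsD z w : cabs (z + w) <= cabs z + cabs w.
Proof. exact: le_normcD. Qed.
Lemma cdistC z w : cabs (z - w) = cabs (w - z).
Proof. by rewrite -cabsN opprB. Qed.
Lemma cdist_tri w z v : cabs (z - v) <= cabs (z - w) + cabs (w - v).
Proof. by apply: le_trans (cabsD _ _); rewrite addrA subrK. Qed.
Lemma cabsB z w : cabs (z - w) <= cabs z + cabs w.
Proof. by rewrite (le_trans (cabsD _ _))// cabsN. Qed.
Lemma cabs_lB z w : cabs z - cabs w <= cabs (z - w).
Proof. by rewrite lerBlDr (le_trans _ (cabsD _ _))// subrK. Qed.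
Lemma cabs_ofR r : cabs (ofR r) = `|r|.
Proof. by rewrite /cabs /= expr0n /= addr0 sqrtr_sqr. Qed.
Lemma re_le z : `|re z| <= cabs z.
Proof.
rewrite -(ler_pXn2r (n:=2)) ?nnegrE ?cabs_ge0// real_normK ?num_real// cabs_sqr.
by rewrite lerDl sqr_ge0.
Qed.
Lemma im_le z : `|im z| <= cabs z.
Proof.
rewrite -(ler_pXn2r (n:=2)) ?nnegrE ?cabs_ge0// real_normK ?num_real// cabs_sqr.
by rewrite lerDr sqr_ge0.
Qed.
Lemma ofRIE z : z = ofRI (re z) (im z). Proof. by case: z. Qed.
Lemma reB z w : re (z - w) = re z - re w. Proof. by case: z; case: w. Qed.
Lemma imB z w : im (z - w) = im z - im w. Proof. by case: z; case: w. Qed.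
Lemma reD z w : re (z + w) = re z + re w. Proof. by case: z; case: w. Qed.
Lemma imD z w : im (z + w) = im z + im w. Proof. by case: z; case: w. Qed.
Lemma cabs_le z : cabs z <= `|re z| + `|im z|.
Proof.
rewrite -(ler_pXn2r (n:=2)) ?nnegrE ?cabs_ge0 ?addr_ge0// cabs_sqr sqrrD.
rewrite !real_normK ?num_real// lerD2r lerDl mulrn_wge0//.
Qed.

Lemma ofRD x y : ofR (x + y) = ofR x + ofR y. Proof. exact: rmorphD. Qed.
Lemma ofRB x y : ofR (x - y) = ofR x - ofR y. Proof. exact: rmorphB. Qed.

Lemma ofRM x y : ofR (x * y) = ofR x * ofR y. Proof. exact: rmorphM. Qed.
Lemma ofRV x : ofR (x^-1) = (ofR x)^-1.
Proof. exact: (fmorphV (real_complex R)). Qed.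
Lemma ltCR x y : (ofR x < ofR y) = (x < y). Proof. exact: ltcR. Qed.
Lemma leCR x y : (ofR x <= ofR y) = (x <= y). Proof. exact: lecR. Qed.
Lemma ltC0P (e : C) : 0 < e -> exists2 r : R, 0 < r & e = ofR r.
Proof.
by case: e => a b; rewrite ltcE /= => /andP[/eqP/= -> a0]; exists a.
Qed.

Lemma nbhsCP (z : C) (A : set C) : nbhs z A <->
  exists2 r : R, 0 < r & forall w, cabs (w - z) < r -> A w.
Proof.
rewrite nbhs_ballP; split=> [[e /= /ltC0P[r r0 ->] H]|[r r0 H]].
  exists r => // w h; apply: H; rewrite -ball_normE /= normE ltCR.
  by rewrite cdistC.
exists (ofR r); first by rewrite /= -[0]/(ofR 0) ltCR.
by move=> w; rewrite -ball_normE /= normE ltCR cdistC; exact: H.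
Qed.

Lemma openCP (A : set C) : open A <->
  forall z, A z -> exists2 r : R, 0 < r & forall w, cabs (w - z) < r -> A w.
Proof.
rewrite openE; split=> [H z /H|H z /H]; by move=> /nbhsCP.
Qed.

Lemma closure_CP (A : set C) (z : C) : closure A z <->
  forall r : R, 0 < r -> exists2 w, A w & cabs (w - z) < r.
Proof.
split=> [H r r0|H B /nbhsCP[r r0 h]].
  have [w [Aw h]] : A `&` [set w | cabs (w - z) < r] !=set0.
    by apply: H; apply/nbhsCP; exists r.
  by exists w.
by have [w Aw wz] := H r r0; exists w; split=> //; exact: h.
Qed.

(* [disc z r] and [cdisc z r] avoid the library balls, whose radii live in [C] *)
Definition disc (z : C) (r : R) : set C := [set w | cabs (w - z) < r].
Definition cdisc (z : C) (r : R) : set C := [set w | cabs (w - z) <= r].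

Lemma disc_open z r : open (disc z r).
Proof.
apply/openCP => w wz; exists (r - cabs (w - z)); first by rewrite subr_gt0.
move=> v; rewrite ltrBrDr => h; apply: le_lt_trans h.
exact: cdist_tri.
Qed.

Lemma nbhs_disc z r : 0 < r -> nbhs z (disc z r).
Proof. by move=> r0; apply/nbhsCP; exists r. Qed.

Lemma cdisc_closed z r : closed (cdisc z r).
Proof.
move=> w /closure_CP H; rewrite /cdisc /= leNgt; apply/negP => h.
have [|v] := H (cabs (w - z) - r); first by rewrite subr_gt0.
rewrite /cdisc /= cdistC => vz; rewrite ltrBrDr => h2.
have := le_lt_trans (lerD (lexx _) vz) h2.
by rewrite ltNge cdist_tri.
Qed.

Definition Cbounded (A : set C) := exists M : R, forall z, A z -> cabs z <= M.

(** Heine-Borel comes from the real square of half side [M], whose image under [(x, y) |-> x + iy]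
    is compact and contains [K]. *)
Lemma compactC (K : set C) : Cbounded K -> closed K -> compact K.
Proof.
move=> [M KM] cK.
pose g (p : R * R) : C := ofRI p.1 p.2.
have gc : continuous g.
  move=> p A /nbhsCP[r r0 h].
  exists (ball p.1 (r / 2), ball p.2 (r / 2)).
    by split; apply: nbhsx_ballx; rewrite divr_gt0.
  move=> [x y] /= []; rewrite -!ball_normE /= => h1 h2; apply: h.
  apply: le_lt_trans (cabs_le _) _; rewrite reB imB /= [r]splitr.
  by rewrite ltrD // distrC.
have cM : compact (g @` (`[- M, M]%classic `*` `[- M, M]%classic)).
  apply: continuous_compact; first exact: continuous_subspaceT.
  by apply: compact_setX; exact: segment_compact.
apply: subclosed_compact cK cM _ => z /KM zM.
exists (re z, im z); last by rewrite /g /= -ofRIE.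
by split; rewrite /= in_itv /= -ler_norml (le_trans _ zM)// (re_le, im_le).
Qed.

Lemma compactCb (K : set C) : compact K -> Cbounded K.
Proof.
move=> /compact_near_coveringP/(_ R +oo (fun M z => cabs z <= M)) H.
have [z _|M [_ hM]] := H _.
  exists ([set w | cabs (w - z) < 1], [set M | cabs z + 1 < M]).
    split => /=; first by apply/nbhsCP; exists 1.
    by exists (cabs z + 1); split => //; exact: num_real.
  move=> [w M] /= [h1 h2]; apply: le_trans (ltW h2).
  by have := cabs_lB w z; move: h1; lra.
by exists (M + 1) => z Kz; apply: hM Kz; rewrite ltrDl.
Qed.

Lemma hausdorffC : hausdorff_space C.
Proof. exact: norm_hausdorff. Qed.

Lemma compactCc (K : set C) : compact K -> closed K.
Proof. exact: compact_closed hausdorffC. Qed.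

Definition contR (K : set C) (phi : C -> R) := forall z, K z -> forall e : R, 0 < e ->
  exists2 d : R, 0 < d & forall w, K w -> cabs (w - z) < d -> `|phi w - phi z| < e.

Lemma contR_max (K : set C) (phi : C -> R) : K !=set0 -> compact K -> contR K phi ->
  exists2 z, K z & forall w, K w -> phi w <= phi z.
Proof.
move=> K0 cK ck.
have [|c Kc h] := @compact_EVT_max _ _ phi K K0 cK.
  apply/subspace_continuousP => z Kz; apply/cvgrPdist_lt => e e0.
  have [d d0 hd] := ck z Kz e e0.
  apply/nbhsCP; exists d => // w wz Kw; rewrite distrC; exact: hd.
exists c; first by rewrite inE in Kc.
by move=> w Kw; apply: h; rewrite inE.
Qed.

End Modulus.

(** * Differentiability through difference quotients *)

Section Dif.
Variable R : realType.
Notation C := (Cplx R).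
Implicit Types (z w : C) (r e : R) (u v phi : C -> C).

Definition ccont u z := forall e : R, 0 < e ->
  exists2 d : R, 0 < d & forall w, cabs (w - z) < d -> cabs (u w - u z) < e.

Lemma ccontP u z : ccont u z <-> {for z, continuous u}.
Proof.
split=> [H A /nbhsCP[r r0 h]|H e e0].
  by have [d d0 hd] := H r r0; apply/nbhsCP; exists d => // w /hd /h.
have : nbhs (u z) (disc (u z) e) by exact: nbhs_disc.
by move=> /H /nbhsCP[d d0 hd]; exists d.
Qed.

Definition eqnear u v z := exists2 r : R, 0 < r & forall w, cabs (w - z) < r -> u w = v w.

Lemma eqnear_sym u v z : eqnear u v z -> eqnear v u z.
Proof. by move=> [r r0 h]; exists r => // w /h. Qed.

(* Caratheodory's form of [k]-fold differentiability, convenient because the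
   difference quotients are again functions of the same kind: [dif 0] is continuity,
   [dif 1] complex differentiability. *)
Fixpoint dif (k : nat) u z : Prop :=
  if k is k'.+1 then exists phi, dif k' phi z /\
    eqnear u (fun w => u z + (w - z) * phi w) z
  else ccont u z.

Lemma min_gt0 (a b : R) : 0 < a -> 0 < b -> 0 < Num.min a b.
Proof. by move=> ? ?; rewrite lt_min; apply/andP. Qed.

Lemma eqnear_trans v u t z : eqnear u v z -> eqnear v t z -> eqnear u t z.
Proof.
move=> [r r0 h] [s s0 k]; exists (Num.min r s); first exact: min_gt0.
by move=> x; rewrite lt_min => /andP[xr xs]; rewrite h// k.
Qed.

Lemma eqnear_at u v z : eqnear u v z -> u z = v z.
Proof. by move=> [r r0 h]; apply: h; rewrite subrr cabs0. Qed.

Lemma eqnear_eq u v z : u =1 v -> eqnear u v z.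
Proof. by move=> h; exists 1. Qed.

Lemma ccont_near u v z : eqnear u v z -> ccont u z -> ccont v z.
Proof.
move=> uv H e /H[d d0 hd]; have uvz := eqnear_at uv; case: uv => r r0 h.
exists (Num.min r d); first exact: min_gt0.
by move=> w; rewrite lt_min => /andP[wr wd]; rewrite -h// -uvz; exact: hd.
Qed.

Lemma dif_near k u v z : eqnear u v z -> dif k u z -> dif k v z.
Proof.
case: k => [|k] uv /=; first exact: ccont_near.
move=> [phi [dphi uphi]]; exists phi; split => //.
apply: eqnear_trans (eqnear_sym uv) _; apply: eqnear_trans uphi _.
by apply: eqnear_eq => w; rewrite (eqnear_at uv).
Qed.

Lemma ccont_cst c z : ccont (fun=> c) z.
Proof. by move=> e e0; exists 1 => // w _; rewrite subrr cabs0. Qed.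

Lemma ccont_id z : ccont id z.
Proof. by move=> e e0; exists e. Qed.

Lemma ccontD u v z : ccont u z -> ccont v z -> ccont (fun w => u w + v w) z.
Proof. by move=> /ccontP cu /ccontP cv; apply/ccontP; exact: (cvgD cu cv). Qed.

Lemma ccontM u v z : ccont u z -> ccont v z -> ccont (fun w => u w * v w) z.
Proof. by move=> /ccontP cu /ccontP cv; apply/ccontP; exact: (cvgM cu cv). Qed.

Lemma ccontV u z : u z != 0 -> ccont u z -> ccont (fun w => (u w)^-1) z.
Proof. by move=> uz /ccontP cu; apply/ccontP; exact: (cvgV uz cu). Qed.

Lemma ccont_comp u v z : ccont u z -> ccont v (u z) -> ccont (fun w => v (u w)) z.
Proof.
move=> cu cv e /cv[d /cu[d' d'0 h'] h]; exists d' => // w /h'; exact: h.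
Qed.

(** One induction carries all four properties, since the product rule at order [k.+1] uses
    constants, the identity, sums and products at order [k]. *)
Lemma dif_basic k :
  [/\ forall c z, dif k (fun=> c) z, forall z, dif k id z,
   forall u v z, dif k u z -> dif k v z -> dif k (fun w => u w + v w) z &
   forall u v z, dif k u z -> dif k v z -> dif k (fun w => u w * v w) z].
Proof.
elim: k => [|k [Hc Hi HD HM]].
  by split => [||u v z|u v z];
    [exact: ccont_cst|exact: ccont_id|exact: ccontD|exact: ccontM].
split.
- move=> c z; exists (fun=> 0); split; first exact: Hc.
  by apply: eqnear_eq => w; rewrite mulr0 addr0.
- move=> z; exists (fun=> 1); split; first exact: Hc.
  by apply: eqnear_eq => w; rewrite mulr1 addrCA subrr addr0.
- move=> u v z [phi [dp up]] [psi [dq vq]].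
  exists (fun w => phi w + psi w); split; first exact: HD.
  case: up => r r0 h; case: vq => s s0 h'.
  exists (Num.min r s); first exact: min_gt0.
  by move=> w; rewrite lt_min => /andP[/h-> /h'->]; ring.
- move=> u v z [phi [dp up]] [psi [dq vq]].
  have dv : dif k v z.
    apply: dif_near (eqnear_sym vq) _; apply: (HD); first exact: Hc.
    by apply: (HM) dq; apply: (HD); [exact: Hi|exact: Hc].
  exists (fun w => phi w * v w + u z * psi w); split.
    by apply: (HD); apply: (HM) => //; exact: Hc.
  case: up => r r0 h; case: vq => s s0 h'.
  exists (Num.min r s); first exact: min_gt0.
  by move=> w; rewrite lt_min => /andP[/h-> /h'->]; ring.
Qed.

Lemma dif_cst k c z : dif k (fun=> c) z. Proof. by case: (dif_basic k). Qed.
Lemma dif_id k z : dif k id z. Proof. by case: (dif_basic k). Qed.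
Lemma difD k u v z : dif k u z -> dif k v z -> dif k (fun w => u w + v w) z.
Proof. by case: (dif_basic k) => _ _ + _; exact. Qed.
Lemma difM k u v z : dif k u z -> dif k v z -> dif k (fun w => u w * v w) z.
Proof. by case: (dif_basic k) => _ _ _; exact. Qed.
Lemma difN k u z : dif k u z -> dif k (fun w => - u w) z.
Proof.
move=> du; apply: (@dif_near _ (fun w => -1 * u w)).
  by apply: eqnear_eq => w; rewrite mulN1r.
by apply: difM du; exact: dif_cst.
Qed.
Lemma difB k u v z : dif k u z -> dif k v z -> dif k (fun w => u w - v w) z.
Proof. by move=> du dv; apply: difD du (difN dv). Qed.
Lemma dif_subc k c z : dif k (fun w => w - c) z.
Proof. by apply: difB; [exact: dif_id|exact: dif_cst]. Qed.
Lemma difX k u z n : dif k u z -> dif k (fun w => u w ^+ n) z.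
Proof.
move=> du; elim: n => [|n IH].
  by apply: (@dif_near _ (fun=> 1)); [exact: eqnear_eq|exact: dif_cst].
apply: (@dif_near _ (fun w => u w * u w ^+ n)); last exact: difM.
by apply: eqnear_eq => w; rewrite exprS.
Qed.

Lemma difW k u z : dif k.+1 u z -> dif k u z.
Proof.
move=> [phi [dp up]]; apply: dif_near (eqnear_sym up) _.
apply: difD; first exact: dif_cst.
by apply: difM dp; exact: dif_subc.
Qed.

Lemma dif_cont k u z : dif k u z -> ccont u z.
Proof. by elim: k => // k IH /difW. Qed.

Lemma ccont_neq0 u z : ccont u z -> u z != 0 ->
  exists2 r : R, 0 < r & forall w, cabs (w - z) < r -> u w != 0.
Proof.
move=> cu uz; have [d d0 hd] := cu (cabs (u z)) ltac:(by rewrite cabs_gt0).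
exists d => // w /hd; apply: contraTneq => ->.
by rewrite sub0r cabsN ltxx.
Qed.

Lemma difV k u z : u z != 0 -> dif k u z -> dif k (fun w => (u w)^-1) z.
Proof.
move=> uz; elim: k => [|k IH]; first exact: ccontV.
move=> duk; have du := difW duk; case: duk => phi [dp [r r0 h]].
exists (fun w => - phi w * ((u w)^-1 * (u z)^-1)); split.
  by apply: difM; [exact: difN|apply: difM; [exact: IH|exact: dif_cst]].
have [s s0 hs] := ccont_neq0 (dif_cont du) uz.
exists (Num.min r s); first exact: min_gt0.
move=> w; rewrite lt_min => /andP[/h e /hs n].
have {}e : (w - z) * phi w = u w - u z by rewrite e; ring.
by rewrite mulrA mulrN e; field; rewrite ?n ?uz.
Qed.

Lemma dif_comp k u v z : dif k u z -> dif k v (u z) -> dif k (fun w => v (u w)) z.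
Proof.
elim: k v => [|k IH] v; first exact: ccont_comp.
move=> duk; have du := difW duk; case: duk => phi [dp [r r0 h]].
move=> [psi [dpsi [s s0 hs]]]; exists (fun w => phi w * psi (u w)); split.
  by apply: difM => //; exact: IH.
have [t t0 ht] := dif_cont du s0.
exists (Num.min r t); first exact: min_gt0.
by move=> w; rewrite lt_min => /andP[/h e /ht/hs->]; rewrite {1}e; ring.
Qed.

Definition cder u z (d : C) := forall e : R, 0 < e -> exists2 r : R, 0 < r &
  forall w, cabs (w - z) < r -> cabs (u w - u z - d * (w - z)) <= e * cabs (w - z).

(** The identity [dquoE] holds for every filler [d]; only the derivative of [u] at [p] makes the
    quotient continuous there. *)
Definition dquo u p (d : C) w := if w == p then d else (u w - u p) / (w - p).

Lemma dquoE u p d w : u w = u p + (w - p) * dquo u p d w.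
Proof.
rewrite /dquo; case: eqVneq => [->|wp]; first by rewrite subrr mul0r addr0.
have : w - p != 0 by rewrite subr_eq0.
by move=> ?; field.
Qed.

Lemma cder_dquo u p d : cder u p d <-> ccont (dquo u p d) p.
Proof.
split=> H e e0.
  have [r r0 h] := H (e / 2) ltac:(by rewrite divr_gt0).
  exists r => // w wr; rewrite /dquo eqxx; case: eqVneq => [_|wp].
    by rewrite subrr cabs0.
  have wp0 : w - p != 0 by rewrite subr_eq0.
  have -> : (u w - u p) / (w - p) - d = (u w - u p - d * (w - p)) / (w - p).
    by field.
  rewrite cabsM cabsV ltr_pdivrMr ?cabs_gt0//.
  apply: le_lt_trans (h _ wr) _.
  by rewrite ltr_pM2r ?cabs_gt0// ltr_pdivrMr// ltr_pMr// ltr1n.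
have [r r0 h] := H e e0; exists r => // w wr.
have -> : u w - u p - d * (w - p) = (dquo u p d w - d) * (w - p).
  by rewrite {1}(dquoE u p d w); ring.
rewrite cabsM; apply: ler_wpM2r; first exact: cabs_ge0.
by apply: ltW; have := h _ wr; rewrite {2}/dquo eqxx.
Qed.

Lemma dif_dquo k u p : dif k.+1 u p <-> exists d, dif k (dquo u p d) p.
Proof.
split=> [[phi [dphi [r r0 h]]]|[d h]]; last first.
  by exists (dquo u p d); split=> //; apply: eqnear_eq => w; rewrite -dquoE.
exists (phi p); apply: dif_near dphi; exists r => // w wr.
rewrite /dquo; case: eqVneq => [->//|wp].
have wp0 : w - p != 0 by rewrite subr_eq0.
have -> : u w - u p = (w - p) * phi w by rewrite (h w wr); ring.
by field.
Qed.

Lemma dif1P u z : dif 1 u z <-> exists d, cder u z d.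
Proof.
rewrite dif_dquo; split=> -[d h]; exists d; exact/cder_dquo.
Qed.

Lemma ccont_uniq u v z : ccont u z -> ccont v z ->
  (exists2 r : R, 0 < r & forall w, w != z -> cabs (w - z) < r -> u w = v w) ->
  u z = v z.
Proof.
move=> cu cv [r r0 h]; apply/eqP; rewrite -subr_eq0 -cabs_eq0.
rewrite eq_le cabs_ge0 andbT leNgt; apply/negP => e0.
have [d1 d10 h1] := cu _ (divr_gt0 e0 (ltr0n R 2)).
have [d2 d20 h2] := cv _ (divr_gt0 e0 (ltr0n R 2)).
pose s := Num.min r (Num.min d1 d2) / 2.
have m0 : 0 < Num.min r (Num.min d1 d2) by rewrite !min_gt0.
have s0 : 0 < s by rewrite divr_gt0.
pose w := z + ofR s.
have wz : cabs (w - z) = s by rewrite /w addrAC subrr add0r cabs_ofR gtr0_norm.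
have : s < Num.min r (Num.min d1 d2) by rewrite ltr_pdivrMr// ltr_pMr// ltr1n.
rewrite -wz !lt_min => /and3P[/h + /h1 + /h2].
have -> : w != z by rewrite -subr_eq0 -cabs_eq0 wz gt_eqF.
move=> /(_ isT) -> k1 k2; have := cdist_tri (v w) (u z) (v z).
rewrite leNgt => /negP; apply; rewrite [ltRHS]splitr ltrD//.
by rewrite cdistC.
Qed.

Lemma cder_uniq u z d d' : cder u z d -> cder u z d' -> d = d'.
Proof.
move=> /cder_dquo h /cder_dquo h'; have := ccont_uniq h h'.
rewrite /dquo eqxx; apply; exists 1 => // w wz _.
by rewrite (negbTE wz).
Qed.

Lemma derivable_dif (u : C -> C) z : derivable u z 1 -> dif 1 u z.
Proof.
move=> /cvg_ex[d hd]; apply/dif1P; exists d => e e0.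
have H := (cvgrPdist_lt _ _).1 hd.
have H1 := H (dnbhs_filter _) (ofR e) ltac:(by rewrite -[0]/(ofR 0) ltCR).
have [r r0 h] := (nbhsCP (0 : C) (fun t : C => t != 0 ->
   `|d - t^-1 *: ((u \o shift z) t%:A - u z)| < ofR e)).1 H1.
exists r => // w wr; have [->|wz] := eqVneq w z.
  by rewrite !subrr mulr0 subr0 cabs0 mulr0.
have wz0 : w - z != 0 by rewrite subr_eq0.
have := h (w - z); rewrite subr0 => /(_ wr wz0).
rewrite normE ltCR /= => /ltW; set q := cabs (_ - _) => qe.
have -> : u w - u z - d * (w - z)
   = - (d - (w - z)^-1 * (u ((w - z) * 1 + z) - u z)) * (w - z).
  by rewrite mulr1 subrK; field.
by rewrite cabsM cabsN; apply: ler_wpM2r; first exact: cabs_ge0.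
Qed.

End Dif.
Arguments dif {R} k u z : simpl never.

(** * The maximum principle *)

Section MaxPrinciple.
Variable R : realType.
Notation C := (Cplx R).
Implicit Types (z w : C) (r e : R) (u v phi : C -> C).

Lemma reM z w : re (z * w) = re z * re w - im z * im w.
Proof. by case: z; case: w. Qed.
Lemma imM z w : im (z * w) = re z * im w + im z * re w.
Proof. by case: z; case: w. Qed.
Lemma reN z : re (- z) = - re z. Proof. by case: z. Qed.
Lemma imN z : im (- z) = - im z. Proof. by case: z. Qed.

(** A property of the class [hol], so that the same consequences can be drawn for [dif 2] on the way
    to [dif 1], and once more for [dif 1]. *)
Definition maxp (hol : (C -> C) -> C -> Prop) := forall (B : set C) u (M : R),
  open B -> Cbounded B -> 0 <= M ->
  (forall z, closure B z -> ccont u z) -> (forall z, B z -> hol u z) ->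
  (forall z, closure B z -> ~ B z -> cabs (u z) <= M) ->
  forall z, B z -> cabs (u z) <= M.

Lemma Cbounded_closure (B : set C) : Cbounded B -> Cbounded (closure B).
Proof.
move=> [M BM]; exists (M + 1) => z /closure_CP/(_ 1 ltr01)[w /BM wM wz].
by have := cabs_lB z w; rewrite cdistC; move: wM wz; lra.
Qed.

Lemma compact_closureC (B : set C) : Cbounded B -> compact (closure B).
Proof.
by move=> /Cbounded_closure bB; apply: compactC bB _; exact: closed_closure.
Qed.

(** Parseval's identity at [t] times the fourth roots of unity: the mixed terms cancel because the
    roots, and also their squares, sum to zero. *)
Lemma quad_mean (a b c : C) (t : R) : let P h := a + b * h + c * h ^+ 2 in
  cabs (P (ofRI t 0)) ^+ 2 + cabs (P (ofRI (- t) 0)) ^+ 2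
  + cabs (P (ofRI 0 t)) ^+ 2 + cabs (P (ofRI 0 (- t))) ^+ 2
  = 4 * (cabs a ^+ 2 + cabs b ^+ 2 * t ^+ 2 + cabs c ^+ 2 * t ^+ 4).
Proof.
rewrite /= !cabs_sqr !expr2 !(reD, imD, reM, imM) /=; ring.
Qed.

Lemma cabs_quad (P E : C) : cabs P ^+ 2 - 2 * cabs P * cabs E <= cabs (P + E) ^+ 2.
Proof.
have h1 := cabs_lB P (- E); have h2 := cabs_lB E (- P).
move: h1 h2; rewrite !cabsN !opprK [E + P]addrC.
have := cabs_ge0 P; have := cabs_ge0 E; have := cabs_ge0 (P + E); nra.
Qed.

(* Second difference test: at an interior maximum of |u|^2 + s |z|^2 the four
   points z + h, with h = t, -t, it, -it, kill all first and second order terms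
   of |u|^2 except the nonnegative ones. *)
Lemma maxp_dif2 : maxp (dif 2).
Proof.
move=> B u M oB bB M0 cu du uM z0 Bz0; rewrite leNgt; apply/negP => Mu.
have [L hL] := Cbounded_closure bB.
pose L' := 1 + `|L|.
have L0 : 0 < L' by rewrite ltr_pwDl.
have LL z : closure B z -> cabs z <= L'.
  by move=> /hL h; apply: le_trans h _; apply: le_trans (ler_norm _) _; rewrite lerDr.
(* With this [s] the term [s * |z|^2] cannot lift a boundary value above [|u z0|^2], so the maximum
   of [phi] is attained inside [B]. *)
pose s := (cabs (u z0) ^+ 2 - M ^+ 2) / (2 * L' ^+ 2).
have num0 : 0 < cabs (u z0) ^+ 2 - M ^+ 2.
  by rewrite subr_gt0 ltr_pXn2r ?nnegrE ?cabs_ge0.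
have s0 : 0 < s by rewrite divr_gt0// mulr_gt0// exprn_gt0.
have sL : s * L' ^+ 2 < cabs (u z0) ^+ 2 - M ^+ 2.
  rewrite /s mulrAC -mulrA.
  have -> : L' ^+ 2 / (2 * L' ^+ 2) = 1 / 2 by field; rewrite gt_eqF.
  by move: num0; lra.
clearbody s.
pose phi z := cabs (u z) ^+ 2 + s * cabs z ^+ 2.
have cphi : contR (closure B) phi.
  have cn : forall v : C -> C, forall z, ccont v z ->
     forall e : R, 0 < e -> exists2 d : R, 0 < d & forall w, cabs (w - z) < d ->
     `|cabs (v w) ^+ 2 - cabs (v z) ^+ 2| < e.
    move=> v z cv e e0.
    have [d d0 hd] := cv (Num.min 1 (e / (2 * (cabs (v z) + 1)))) ltac:(by
      rewrite min_gt0// divr_gt0// mulr_gt0// ltr_wpDl// cabs_ge0).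
    exists d => // w /hd; rewrite lt_min => /andP[h1].
    rewrite ltr_pdivlMr ?mulr_gt0 ?ltr_wpDl ?cabs_ge0// => h2.
    have k1 := cabs_lB (v w) (v z); have k2 := cabs_lB (v z) (v w).
    rewrite cdistC in k2; move: (cabs_ge0 (v w)) (cabs_ge0 (v z)) h1 h2 k1 k2.
    move: (cabs (v w - v z)) (cabs_ge0 (v w - v z)) (cabs (v w)) (cabs (v z)).
    move=> x x0 y t y0 t0 x1 xe yt ty.
    rewrite ltr_norml; apply/andP; split; nra.
  move=> z clz e e0.
  have [d1 d10 h1] := cn u z (cu z clz) (e / 2) ltac:(by rewrite divr_gt0).
  have [d2 d20 h2] := cn id z (@ccont_id _ z) (e / (2 * s)) ltac:(by
     rewrite divr_gt0// mulr_gt0).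
  exists (Num.min d1 d2); first exact: min_gt0.
  move=> w _; rewrite lt_min => /andP[/h1 {}h1 /h2].
  rewrite ltr_pdivlMr ?mulr_gt0// => {}h2.
  have -> : phi w - phi z = (cabs (u w) ^+ 2 - cabs (u z) ^+ 2)
     + (cabs w ^+ 2 - cabs z ^+ 2) * s by rewrite /phi; ring.
  apply: le_lt_trans (ler_normD _ _) _; rewrite normrM (gtr0_norm s0).
  by move: h1 h2; rewrite ltr_pdivlMr//; lra.
have [||z1 cz1 mz1] := @contR_max _ (closure B) phi _ _ cphi.
- by exists z0; exact: subset_closure.
- exact: compact_closureC.
have Bz1 : B z1.
  apply: contrapT => nB; have := mz1 z0 (subset_closure Bz0).
  have h1 := uM _ cz1 nB; have h2 := LL _ cz1.
  rewrite /phi leNgt => /negP; apply.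
  have k1 : cabs (u z1) ^+ 2 <= M ^+ 2 by rewrite ler_pXn2r ?nnegrE ?cabs_ge0.
  have k2 : cabs z1 ^+ 2 <= L' ^+ 2 by rewrite ler_pXn2r ?nnegrE ?cabs_ge0 ?(ltW L0).
  have k3 := ler_wpM2l (ltW s0) k2.
  have k4 : 0 <= s * cabs z0 ^+ 2 by rewrite mulr_ge0 ?(ltW s0)// exprn_ge0 ?cabs_ge0.
  by move: sL k1 k3 k4; lra.
have [psi [[chi [cchi [r2 r20 hchi]]] [r1 r10 hpsi]]] := du _ Bz1.
have [r0 r00 hB] := (openCP B).1 oB z1 Bz1.
pose a := u z1; pose b := psi z1; pose c := chi z1.
(* [N] bounds the quadratic part of [u] for [|h| <= 1]. With the remainder factor below
   [s / (4 * N)], the error costs at most half of the gain [s * t^2]. *)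
pose N := cabs a + cabs b + cabs c + 1.
have N0 : 0 < N by rewrite ltr_wpDl// !addr_ge0// cabs_ge0.
have [r3 r30 hr3] := cchi (s / (4 * N)) ltac:(by rewrite divr_gt0// mulr_gt0).
pose rr := Num.min (Num.min r0 r1) (Num.min r2 r3).
have rr0 : 0 < rr by rewrite !min_gt0.
pose t := Num.min 1 (rr / 2).
have t0 : 0 < t by rewrite min_gt0// divr_gt0.
have t1 : t <= 1 by rewrite ge_min lexx.
have trr : t < rr.
  by apply: (@le_lt_trans _ _ (rr / 2)); [rewrite ge_min lexx orbT|lra].
clearbody t.
have key h : cabs h = t -> cabs (a + b * h + c * h ^+ 2) ^+ 2 + s * cabs (z1 + h) ^+ 2
    <= phi z1 + s * t ^+ 2 / 2.
  move=> ht; pose w := z1 + h.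
  have wz : w - z1 = h by rewrite /w addrAC subrr add0r.
  have wrr : cabs (w - z1) < rr by rewrite wz ht.
  move: wrr; rewrite !lt_min => /andP[/andP[w0 w1] /andP[w2 w3]].
  have Bw := hB _ w0; have := mz1 _ (subset_closure Bw).
  have uw : u w = (a + b * h + c * h ^+ 2) + h ^+ 2 * (chi w - c).
    by rewrite (hpsi _ w1) (hchi _ w2) wz /a /b /c; ring.
  rewrite {1}/phi uw => mx.
  have h1 := cabs_quad (a + b * h + c * h ^+ 2) (h ^+ 2 * (chi w - c)).
  have h2 : cabs (a + b * h + c * h ^+ 2) <= N.
    apply: le_trans (cabsD _ _) _; apply: le_trans (lerD (cabsD _ _) (lexx _)) _.
    rewrite [cabs (c * _)]cabsM cabsX [cabs (b * _)]cabsM ht /N.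
    have bt : cabs b * t <= cabs b by rewrite ler_piMr// cabs_ge0.
    have ct : cabs c * t ^+ 2 <= cabs c.
      by rewrite ler_piMr ?cabs_ge0// exprn_ile1 ?(ltW t0).
    by move: bt ct; lra.
  have h3 : cabs (h ^+ 2 * (chi w - c)) <= t ^+ 2 * (s / (4 * N)).
    by rewrite cabsM cabsX ht; apply: ler_wpM2l; [exact: exprn_ge0 (ltW t0)|exact: ltW (hr3 _ w3)].
  have h4 : cabs (a + b * h + c * h ^+ 2) * cabs (h ^+ 2 * (chi w - c)) <= s * t ^+ 2 / 4.
    have -> : s * t ^+ 2 / 4 = N * (t ^+ 2 * (s / (4 * N))) by field; rewrite gt_eqF.
    by apply: ler_pM => //; exact: cabs_ge0.
  by rewrite -/w; move: mx h1 h4; lra.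
have q1 := quad_mean a b c t.
have q2 := quad_mean z1 1 0 t; move: q1 q2; cbv zeta beta.
rewrite !mul1r !mul0r !addr0 cabs1 cabs0 expr1n mul1r expr0n mul0r addr0.
move=> Q1 Q2.
have ht x y : x ^+ 2 + y ^+ 2 = t ^+ 2 -> cabs (ofRI x y) = t.
  move=> e; apply/eqP; rewrite -(eqrXn2 (n := 2)) ?cabs_ge0 ?(ltW t0)//.
  by rewrite cabs_sqr /re /im /= e.
have k1 := key (ofRI t 0) (ht t 0 ltac:(by rewrite expr0n addr0)).
have k2 := key (ofRI (- t) 0) (ht (- t) 0 ltac:(by rewrite expr0n addr0 sqrrN)).
have k3 := key (ofRI 0 t) (ht 0 t ltac:(by rewrite expr0n add0r)).
have k4 := key (ofRI 0 (- t)) (ht 0 (- t) ltac:(by rewrite expr0n add0r sqrrN)).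
have p1 : 0 <= cabs b ^+ 2 * t ^+ 2 by rewrite mulr_ge0// exprn_ge0 ?cabs_ge0 ?(ltW t0).
have p2 : 0 <= cabs c ^+ 2 * t ^+ 4 by rewrite mulr_ge0// exprn_ge0 ?cabs_ge0 ?(ltW t0).
have p3 : 0 < s * t ^+ 2 by rewrite mulr_gt0// exprn_gt0.
have {k1 k2 k3 k4} := lerD (lerD (lerD k1 k2) k3) k4.
rewrite /phi -/a leNgt => /negP; apply.
have q1 : 4 * cabs a ^+ 2 <= 4 * (cabs a ^+ 2 + cabs b ^+ 2 * t ^+ 2 + cabs c ^+ 2 * t ^+ 4) by lra.
rewrite -Q1 in q1.
have : 4 * (s * cabs z1 ^+ 2) + 4 * (s * t ^+ 2) = s * (4 * (cabs z1 ^+ 2 + t ^+ 2)) by ring.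
rewrite -Q2; move: q1 p3; clear.
move: (s * t ^+ 2) (cabs (a + b * ofRI t 0 + _) ^+ 2) (cabs (a + b * ofRI (- t) 0 + _) ^+ 2)
  (cabs (a + b * ofRI 0 t + _) ^+ 2) (cabs (a + b * ofRI 0 (- t) + _) ^+ 2).
move: (cabs (z1 + _ t 0) ^+ 2) (cabs (z1 + _ (- t) 0) ^+ 2)
  (cabs (z1 + _ 0 t) ^+ 2) (cabs (z1 + _ 0 (- t)) ^+ 2).
move: (cabs a ^+ 2) (cabs z1 ^+ 2) => A Z X1 X2 X3 X4 T Y1 Y2 Y3 Y4 q1 p3 q2.
rewrite !mulrDr in q2; lra.
Qed.

End MaxPrinciple.

(** * Exceptional points and estimates for difference quotients *)

Section Removable.
Variable R : realType.
Notation C := (Cplx R).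
Implicit Types (z w p : C) (r : R) (u v : C -> C).

Lemma avoid_seq (E : seq C) z r : 0 < r ->
  exists2 w, w \notin E & cabs (w - z) < r.
Proof.
move=> r0.
have [d d0 hd] : exists2 d : R, 0 < d & forall e, e \in E -> e != z -> d <= cabs (e - z).
  elim: E => [|e E [d d0 IH]]; first by exists 1.
  have [ez|ez] := eqVneq e z.
    exists d => // f; rewrite inE => /orP[/eqP->|fE]; last exact: IH.
    by rewrite ez eqxx.
  exists (Num.min d (cabs (e - z))); first by rewrite min_gt0// cabs_gt0 subr_eq0.
  move=> f; rewrite inE ge_min => /orP[/eqP-> _|fE fz]; first by rewrite lexx orbT.
  by rewrite IH.
pose s := Num.min r d / 2.
have m0 : 0 < Num.min r d by rewrite min_gt0.
have s0 : 0 < s by rewrite divr_gt0.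
have sm : s < Num.min r d by rewrite /s; lra.
have ws : cabs (z + ofR s - z) = s by rewrite addrAC subrr add0r cabs_ofR gtr0_norm.
exists (z + ofR s); rewrite ?ws; last by apply: lt_le_trans sm _; rewrite ge_min lexx.
apply/negP => /hd; rewrite ws.
have -> : z + ofR s != z by rewrite -subr_eq0 -cabs_eq0 ws gt_eqF.
by move=> /(_ isT); rewrite leNgt (lt_le_trans sm)// ge_min lexx orbT.
Qed.

Lemma pow_unbounded (y K : R) : 1 < y -> exists n : nat, K < y ^+ n.
Proof.
move=> y1; have d0 : 0 < y - 1 by rewrite subr_gt0.
have bern n : n%:R * (y - 1) <= y ^+ n.
  elim: n => [|n IH]; first by rewrite mul0r expr0.
  have h : 1 <= y ^+ n by rewrite exprn_ege1// ltW.
  rewrite exprS -natr1.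
  have : y * y ^+ n = y ^+ n + (y - 1) * y ^+ n by ring.
  by have := ler_wpM2l (ltW d0) h; move: IH; lra.
exists (Num.bound (`|K| / (y - 1))).
apply: lt_le_trans (bern _); rewrite -ltr_pdivrMr//.
apply: le_lt_trans (archi_boundP _); last by rewrite divr_ge0// ltW.
by rewrite ler_pM2r ?invr_gt0// ler_norm.
Qed.

(** The factors [q] and [L] do not survive an n-th root as [n] grows; this removes the trace of an
    auxiliary factor from an estimate. *)
Lemma pow_dominated (x M q L : R) : 0 < q -> 0 <= M ->
  (forall n : nat, (0 < n)%N -> x ^+ n * q <= M ^+ n * L) -> x <= M.
Proof.
move=> q0 M0 H; rewrite leNgt; apply/negP => Mx.
have [M00|Mp] := eqVneq M 0.
  have := H 1%N isT; rewrite !expr1 M00 mul0r leNgt pmulr_lgt0//.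
  by rewrite -M00 Mx.
have {Mp M0} M0 : 0 < M by rewrite lt_neqAle eq_sym Mp.
have [n hn] := @pow_unbounded (x / M) (`|L| / q) ltac:(by rewrite ltr_pdivlMr ?mul1r).
have := H n.+1 isT; rewrite leNgt => /negP; apply.
have x0 : 0 < x by apply: lt_trans Mx.
have k1 : M ^+ n.+1 * L <= M ^+ n.+1 * `|L|.
  by rewrite ler_pM2l ?exprn_gt0// ler_norm.
apply: le_lt_trans k1 _; rewrite mulrC -ltr_pdivrMr// mulrAC.
have -> : x ^+ n.+1 = (x / M) ^+ n.+1 * M ^+ n.+1.
  by rewrite -exprMn divfK// gt_eqF.
rewrite ltr_pM2r ?exprn_gt0//; apply: lt_le_trans hn _.
by rewrite exprS ler_peMl ?exprn_ge0 ?divr_ge0 ?(ltW x0) ?(ltW M0)// ler_pdivlMr// mul1r ltW.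
Qed.

Section Class.
Variable k : nat.
Hypothesis MP : @maxp R (dif k.+1).

(* Finitely many points where [u] is merely continuous are harmless: apply the
   principle to [u ^+ n * \prod_(e <- E) ('X - e)], which vanishes on [E]. *)
Lemma maxp_except (E : seq C) (B : set C) u (M : R) :
  open B -> Cbounded B -> 0 <= M ->
  (forall z, closure B z -> ccont u z) ->
  (forall z, B z -> z \notin E -> dif k.+1 u z) ->
  (forall z, closure B z -> ~ B z -> cabs (u z) <= M) ->
  forall z, B z -> cabs (u z) <= M.
Proof.
move=> oB bB M0 cu du uM.
suff H z : B z -> z \notin E -> cabs (u z) <= M.
  move=> z Bz; have [zE|zE] := boolP (z \in E); last exact: H.
  rewrite leNgt; apply/negP => Mz.
  have [d d0 hd] := cu z (subset_closure Bz) (cabs (u z) - M) ltac:(by rewrite subr_gt0).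
  have [r r0 hr] := (openCP B).1 oB z Bz.
  have [w wE] := avoid_seq E z (min_gt0 d0 r0).
  rewrite lt_min => /andP[/hd + /hr/H/(_ wE)].
  have := cabs_lB (u z) (u w); rewrite cdistC; lra.
move=> Bz zE.
pose q w : C := \prod_(e <- E) (w - e).
have qE w : w \in E -> q w = 0.
  move=> wE; rewrite /q; apply/eqP; rewrite prodf_seq_eq0.
  by apply/hasP; exists w => //=; rewrite subrr.
have dq w : dif k.+1 q w.
  rewrite /q; elim: (E) => [|e E' IH].
    apply: (@dif_near _ _ (fun=> 1)); last exact: dif_cst.
    by apply: eqnear_eq => x; rewrite big_nil.
  apply: (@dif_near _ _ (fun x => (x - e) * \prod_(f <- E') (x - f))).
    by apply: eqnear_eq => x; rewrite big_cons.
  by apply: difM => //; exact: dif_subc.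
have q0 : 0 < cabs (q z).
  rewrite cabs_gt0 /q prodf_seq_neq0; apply/allP => e eE /=.
  by rewrite subr_eq0; apply: contraNneq zE => ->.
have [L L0 hL] : exists2 L : R, 0 <= L & forall w, closure B w -> cabs (q w) <= L.
  have [N hN] := Cbounded_closure bB.
  rewrite /q; elim: (E) => [|e E' [L L0 IH]].
    by exists 1 => // w _; rewrite big_nil cabs1.
  exists ((`|N| + cabs e) * L); first by rewrite mulr_ge0// addr_ge0// cabs_ge0.
  move=> w cw; rewrite big_cons cabsM; apply: ler_pM; rewrite ?cabs_ge0 ?IH//.
  apply: le_trans (cabsB _ _) _; rewrite lerD2r.
  by apply: le_trans (hN _ cw) (ler_norm _).
apply: (@pow_dominated _ _ (cabs (q z)) L) => // n n0.
rewrite -cabsX -cabsM.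
(* Removing [E] turns its points into points outside the open set, where the auxiliary factor [q]
   vanishes. *)
pose B' := B `\` [set` E].
have cB' : closure B' `<=` closure B by apply: closureS => w [].
apply: (@MP B' (fun w => u w ^+ n * q w)).
- rewrite /B' setDE; apply: openI => //; apply: closed_openC.
  by apply: compactCc; apply: finite_compact; exact: finite_seq.
- by have [N hN] := bB; exists N => w [] /hN.
- by rewrite mulr_ge0// exprn_ge0.
- move=> w /cB' cw; apply: ccontM; last exact: dif_cont (dq w).
  elim: n {n0} => [|n IH].
    by apply: (@ccont_near _ (fun=> 1)); [exact: eqnear_eq|exact: ccont_cst].
  apply: (@ccont_near _ (fun w => u w * u w ^+ n)).
    by apply: eqnear_eq => x; rewrite exprS.
  by apply: ccontM => //; exact: cu.
- move=> w [Bw /= /negP wE]; apply: difM => //; apply: difX.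
  exact: du.
- move=> w cw nB'; have cw' := cB' _ cw.
  have [wE|wE] := boolP (w \in E).
    by rewrite (qE _ wE) mulr0 cabs0 mulr_ge0// exprn_ge0.
  rewrite cabsM cabsX; apply: ler_pM; rewrite ?exprn_ge0 ?cabs_ge0 ?hL//.
  apply: lerXn2r; rewrite ?nnegrE ?cabs_ge0//; apply: uM => //.
  by move=> Bw; apply: nB'; split => //=; apply/negP.
- by split => //=; apply/negP.
Qed.

Lemma closure_disc z r : closure (disc z r) `<=` cdisc z r.
Proof.
by move=> w h; apply: cdisc_closed; move: h; apply: closureS => v /ltW.
Qed.

Lemma disc_bounded z r : Cbounded (disc z r).
Proof.
exists (r + cabs z) => w; rewrite /disc /= => wz.
by have := cabs_lB w z; lra.
Qed.

Lemma maxp_disc (E : seq C) p r u (M : R) : 0 <= M ->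
  (forall z, cabs (z - p) <= r -> ccont u z) ->
  (forall z, cabs (z - p) < r -> z \notin E -> dif k.+1 u z) ->
  (forall z, cabs (z - p) = r -> cabs (u z) <= M) ->
  forall z, cabs (z - p) < r -> cabs (u z) <= M.
Proof.
move=> M0 cu du uM; apply: (@maxp_except E) => //.
- exact: disc_open.
- exact: disc_bounded.
- by move=> z /closure_disc /cu.
- move=> z /closure_disc cz nz; apply: uM; apply/eqP.
  by rewrite eq_le [_ <= _]cz leNgt; apply/negP.
Qed.

Lemma dquo_dif j u p (d : C) w : w != p -> dif j u w -> dif j (dquo u p d) w.
Proof.
move=> wp du; apply: (@dif_near _ _ (fun x => (u x - u p) * (x - p)^-1)).
  exists (cabs (w - p)); first by rewrite cabs_gt0 subr_eq0.
  move=> x xw; rewrite /dquo; case: eqVneq => // xp.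
  by move: xw; rewrite xp cdistC ltxx.
apply: difM; first by apply: difB => //; exact: dif_cst.
by apply: difV; [rewrite subr_eq0|exact: dif_subc].
Qed.

Lemma dquo_sym u z w (d d' : C) : z != w -> dquo u z d w = dquo u w d' z.
Proof.
move=> zw; rewrite /dquo eq_sym (negbTE zw).
have ? : w - z != 0 by rewrite subr_eq0 eq_sym.
have ? : z - w != 0 by rewrite subr_eq0.
by field; apply/andP.
Qed.

(** The iterated quotient [K] of [u] at [z] and [w0] is bounded by the maximum principle: on the
    circle of radius [r / 2] each division is by at least [r / 4] and costs a factor [8 / r]. By the
    symmetry of quotients, [K p * (p - w0)] is the difference to be estimated. The point [p] enters
    the principle as an exceptional point. *)
Lemma dquo_lipschitz u p r (M : R) (d d' : C) z w0 :
  (forall z, cabs (z - p) < r -> ccont u z) ->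
  (forall z, cabs (z - p) < r -> z != p -> dif k.+1 u z) ->
  (forall z, cabs (z - p) < r -> cabs (u z) <= M) ->
  z != p -> w0 != p -> z != w0 -> cabs (z - p) < r / 4 -> cabs (w0 - p) < r / 4 ->
  cabs (dquo u p d z - dquo u w0 d' z) <= 64 * M / r ^+ 2 * cabs (w0 - p).
Proof.
move=> cu du uM zp wp zw zr wr.
have r0 : 0 < r by have := cabs_ge0 (z - p); lra.
have M0 : 0 <= M by apply: le_trans (uM p _); rewrite ?cabs_ge0// subrr cabs0.
have /dif1P[dz hz] : dif 1 u z.
  by elim: (k) (du z ltac:(lra) zp) => // j IH /difW.
pose kz := dquo u z dz.
have dkz w : cabs (w - p) < r -> w != p -> w != z -> dif k.+1 kz w.
  by move=> wr' wp' wz; apply: dquo_dif => //; exact: du.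
have ckz w : cabs (w - p) < r -> ccont kz w.
  move=> wr'; have [->|wz] := eqVneq w z; first exact/cder_dquo.
  by apply: (@dquo_dif 0) => //; exact: cu.
have /dif1P[dw hw] : dif 1 kz w0.
  by elim: (k) (dkz w0 ltac:(lra) wp ltac:(by rewrite eq_sym)) => // j IH /difW.
pose K := dquo kz w0 dw.
have dK w : cabs (w - p) < r -> w \notin [:: p; z; w0] -> dif k.+1 K w.
  move=> wr'; rewrite !inE !negb_or => /and3P[h1 h2 h3].
  by apply: dquo_dif => //; exact: dkz.
have cK w : cabs (w - p) < r -> ccont K w.
  move=> wr'; have [->|wz] := eqVneq w w0; first exact/cder_dquo.
  by apply: (@dquo_dif 0) => //; exact: ckz.
have far x w : cabs (x - p) < r / 4 -> cabs (w - p) = r / 2 ->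
    w != x /\ r / 4 <= cabs (w - x).
  move=> h1 h2; have := cdist_tri x w p => h3.
  have h4 : r / 4 <= cabs (w - x) by lra.
  by split=> //; rewrite -subr_eq0 -cabs_gt0; lra.
have quo v x w (N : R) (c : C) : cabs (x - p) < r / 4 -> cabs (w - p) = r / 2 ->
   cabs (v w) <= N -> cabs (v x) <= N -> cabs (dquo v x c w) <= 8 * N / r.
  move=> h1 h2 h3 h4; have [wx h5] := far x w h1 h2.
  rewrite /dquo (negbTE wx) cabsM cabsV ler_pdivrMr ?cabs_gt0 ?subr_eq0//.
  have N0 : 0 <= N by apply: le_trans h3; exact: cabs_ge0.
  have -> : 8 * N / r * cabs (w - x) = (8 * N / r) * (r / 4) + (8 * N / r) * (cabs (w - x) - r / 4).
    by ring.
  have h6 : 0 <= (8 * N / r) * (cabs (w - x) - r / 4).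
    by rewrite mulr_ge0 ?divr_ge0 ?mulr_ge0 ?(ltW r0)// subr_ge0.
  have -> : (8 * N / r) * (r / 4) = 2 * N by field; rewrite gt_eqF.
  by have := cabsB (v w) (v x); lra.
have kb w : cabs (w - p) < r / 2 -> cabs (kz w) <= 8 * M / r.
  apply: (@maxp_disc [:: p; z]).
  - by rewrite divr_ge0 ?mulr_ge0 ?(ltW r0).
  - by move=> x hx; apply: ckz; lra.
  - move=> x hx; rewrite !inE negb_or => /andP[? ?]; apply: dkz => //; lra.
  - by move=> x hx; apply: (quo) => //; apply: uM; lra.
have Kb w : cabs (w - p) < r / 2 -> cabs (K w) <= 64 * M / r ^+ 2.
  have -> : 64 * M / r ^+ 2 = 8 * (8 * M / r) / r by field; rewrite gt_eqF.
  apply: (@maxp_disc [:: p; z; w0]).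
  - by rewrite divr_ge0 ?mulr_ge0 ?invr_ge0 ?(ltW r0).
  - by move=> x hx; apply: cK; lra.
  - by move=> x hx; apply: dK; lra.
  - move=> x hx; apply: (quo) => //; last by apply: kb; lra.
    by apply: (quo) => //; apply: uM; lra.
have := Kb p ltac:(rewrite subrr cabs0; lra).
rewrite {1}/K {1}/dquo eq_sym (negbTE wp) cabsM cabsV ler_pdivrMr ?cabs_gt0 ?subr_eq0 1?eq_sym//.
rewrite [cabs (p - w0)]cdistC /kz (@dquo_sym u z p dz d)// (@dquo_sym u z w0 dz d')//.
Qed.

(** The symmetric quotient between [z] and [w] is the intermediate term; [dquo_lipschitz] is applied
    once from each side. *)
Lemma dquo_cauchy u p r (M : R) (d : C) z w :
  (forall z, cabs (z - p) < r -> ccont u z) ->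
  (forall z, cabs (z - p) < r -> z != p -> dif k.+1 u z) ->
  (forall z, cabs (z - p) < r -> cabs (u z) <= M) ->
  z != p -> w != p -> cabs (z - p) < r / 4 -> cabs (w - p) < r / 4 ->
  cabs (dquo u p d z - dquo u p d w)
    <= 64 * M / r ^+ 2 * (cabs (z - p) + cabs (w - p)).
Proof.
move=> cu du uM zp wp zr wr.
have r0 : 0 < r by have := cabs_ge0 (z - p); lra.
have M0 : 0 <= M by apply: le_trans (uM p _); rewrite ?cabs_ge0// subrr cabs0.
have [->|zw] := eqVneq z w.
  by rewrite subrr cabs0 mulr_ge0 ?divr_ge0 ?mulr_ge0 ?exprn_ge0 ?addr_ge0 ?cabs_ge0 ?(ltW r0).
have h1 := @dquo_lipschitz u p r M d d z w cu du uM zp wp zw zr wr.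
have h2 := @dquo_lipschitz u p r M d d w z cu du uM wp zp ltac:(by rewrite eq_sym) wr zr.
apply: le_trans (cdist_tri (dquo u w d z) _ _) _.
rewrite [dquo u w d z](@dquo_sym u w z d d) 1?eq_sym// {1}(@dquo_sym u z w d d)//.
by rewrite [cabs (dquo u z d w - _)]cdistC mulrDr; lra.
Qed.

End Class.
End Removable.

(** * Removable singularities, uniform limits and derivatives *)

Section CDer.
Variable R : realType.
Notation C := (Cplx R).
Implicit Types (z w p : C) (r : R) (u v : C -> C).

Lemma cderP u z (d : C) : cder u z d <-> exists phi, [/\ ccont phi z, phi z = d &
  eqnear u (fun w => u z + (w - z) * phi w) z].
Proof.
split=> [/cder_dquo h|[phi [cphi phid [r r0 h]]]].
  exists (dquo u z d); split => //; first by rewrite /dquo eqxx.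
  by apply: eqnear_eq => w; rewrite -dquoE.
apply/cder_dquo; apply: ccont_near cphi; exists r => // w wr.
rewrite /dquo; case: eqVneq => [->//|wp].
have wp0 : w - z != 0 by rewrite subr_eq0.
have -> : u w - u z = (w - z) * phi w by rewrite (h w wr); ring.
by field.
Qed.

Lemma cder_near u v z (d : C) : eqnear u v z -> cder u z d -> cder v z d.
Proof.
move=> uv /cder_dquo h; apply/cder_dquo; apply: ccont_near h.
have e := eqnear_at uv; case: uv => r r0 h; exists r => // w wr.
by rewrite /dquo e (h _ wr).
Qed.

Lemma cder_cst c z : cder (fun=> c) z 0.
Proof.
apply/cderP; exists (fun=> 0); split => //; first exact: ccont_cst.
by apply: eqnear_eq => w; rewrite mulr0 addr0.
Qed.

Lemma cder_subc c z : cder (fun w => w - c) z 1.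
Proof.
apply/cderP; exists (fun=> 1); split => //; first exact: ccont_cst.
by apply: eqnear_eq => w; ring.
Qed.

Lemma cderD u v z (d b : C) : cder u z d -> cder v z b ->
  cder (fun w => u w + v w) z (d + b).
Proof.
move=> /cderP[phi [c1 <- [r r0 h1]]] /cderP[psi [c2 <- [s s0 h2]]]; apply/cderP.
exists (fun w => phi w + psi w); split => //; first exact: ccontD.
exists (Num.min r s); first exact: min_gt0.
by move=> w; rewrite lt_min => /andP[/h1-> /h2->]; ring.
Qed.

Lemma cderM u v z (d b : C) : cder u z d -> cder v z b ->
  cder (fun w => u w * v w) z (d * v z + u z * b).
Proof.
move=> du /[dup] dv; have cv : ccont v z by apply: (@dif_cont _ 1); apply/dif1P; exists b.
move: du => /cderP[phi [c1 <- [r r0 h1]]] /cderP[psi [c2 <- [s s0 h2]]]; apply/cderP.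
exists (fun w => phi w * v w + u z * psi w); split => //.
  by apply: ccontD; apply: ccontM => //; exact: ccont_cst.
exists (Num.min r s); first exact: min_gt0.
by move=> w; rewrite lt_min => /andP[/h1 e1 /h2 e2]; rewrite e1 e2; ring.
Qed.

(** Near [p] the values stay in a compact disc; a cluster point there is the limit, and the Cauchy
    condition gives the rate. *)
Lemma lim_exists (q : C -> C) p r (K : R) : 0 < r -> 0 <= K ->
  (forall z w, z != p -> w != p -> cabs (z - p) < r -> cabs (w - p) < r ->
    cabs (q z - q w) <= K * (cabs (z - p) + cabs (w - p))) ->
  exists d : C, forall z, z != p -> cabs (z - p) < r -> cabs (q z - d) <= K * cabs (z - p).
Proof.
move=> r0 K0 hq.
have [w0 w0p w0r] : exists2 w0, w0 != p & cabs (w0 - p) < r.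
  have [w] := avoid_seq [:: p] p r0; rewrite inE => ? ?; by exists w.
have PF : ProperFilter (q @ p^') by apply: fmap_proper_filter.
have [|||d [_ hd]] := @compactC R (cdisc (q w0) (K * (r + r))) _ _ (q @ p^') PF.
- exists (K * (r + r) + cabs (q w0)) => w; rewrite /cdisc /= => h.
  by have := cabs_lB w (q w0); lra.
- exact: cdisc_closed.
- apply/(nbhsCP p); exists r => // z zr zp; rewrite /cdisc /=.
  apply: le_trans (hq _ _ zp w0p zr w0r) _; apply: ler_wpM2l => //; lra.
exists d => z zp zr; apply/ler_addgt0Pr => e e0.
pose s := Num.min r (e / (2 * (K + 1))).
have K1 : 0 < 2 * (K + 1) by rewrite mulr_gt0// ltr_wpDl.
have s0 : 0 < s by rewrite min_gt0// divr_gt0.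
have F1 : (q @ p^') (q @` [set w | w != p /\ cabs (w - p) < s]).
  by apply/(nbhsCP p); exists s => // w ws wp; exists w.
have e20 : 0 < e / 2 by rewrite divr_gt0.
have [y [[w [wp]]]] := hd _ (disc d (e / 2)) F1 (nbhs_disc d e20).
rewrite lt_min => /andP[wr ws] <-; rewrite /disc /= => wd.
apply: le_trans (cdist_tri (q w) _ _) _.
have := hq _ _ zp wp zr wr; move: ws wd; rewrite ltr_pdivlMr//.
rewrite mulrDr; have := mulr_ge0 K0 (cabs_ge0 (w - p)); have := cabs_ge0 (w - p).
lra.
Qed.

Lemma ccont_bound u p : ccont u p -> exists2 r : R, 0 < r &
  forall z, cabs (z - p) < r -> cabs (u z) <= cabs (u p) + 1.
Proof.
move=> cu; have [r r0 h] := cu 1 ltr01; exists r => // z /h.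
by have := cabs_lB (u z) (u p); lra.
Qed.

Lemma lim_cder u p r (K : R) (d : C) : 0 < r -> 0 <= K ->
  (forall z, z != p -> cabs (z - p) < r -> cabs (dquo u p 0 z - d) <= K * cabs (z - p)) ->
  cder u p d.
Proof.
move=> r0 K0 h; apply/cder_dquo => e e0.
have K1 : 0 < K + 1 by rewrite ltr_wpDl.
exists (Num.min r (e / (K + 1))); first by rewrite min_gt0// divr_gt0.
move=> z; rewrite lt_min ltr_pdivlMr// => /andP[zr ze].
have [->|zp] := eqVneq z p; first by rewrite subrr cabs0.
have := h z zp zr; rewrite /dquo eqxx (negbTE zp).
have := cabs_ge0 (z - p); move: ze; rewrite mulrDr mulrC; lra.
Qed.

Section Class.
Variable k : nat.
Hypothesis MP : @maxp R (dif k.+1).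

(** The estimate [dquo_cauchy] asks for differentiability only away from [p], and it forces the
    difference quotient at [p] to converge. *)
Lemma removable u p r : 0 < r -> ccont u p ->
  (forall z, cabs (z - p) < r -> z != p -> dif k.+1 u z) -> dif 1 u p.
Proof.
move=> r0 cu du; have [s s0 hs] := ccont_bound cu.
pose t := Num.min r s.
have t0 : 0 < t by rewrite min_gt0.
have K0 : 0 <= 64 * (cabs (u p) + 1) / t ^+ 2.
  by rewrite divr_ge0 ?mulr_ge0 ?addr_ge0 ?cabs_ge0 ?exprn_ge0 ?(ltW t0).
have t40 : 0 < t / 4 by rewrite divr_gt0.
have [|d hd] := @lim_exists (dquo u p 0) p _ _ t40 K0.
  move=> z w zp wp zt wt; apply: (dquo_cauchy MP) => // x; rewrite lt_min => /andP[xr xs].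
  - by have [->//|xp] := eqVneq x p; apply: dif_cont (du _ xr xp).
  - exact: du.
  - exact: hs.
by apply/dif1P; exists d; exact: lim_cder hd.
Qed.

(** The constant in [dquo_cauchy] is the same for all approximants [v] close to [u], so the estimate
    passes to the quotient of [u]. *)
Lemma weierstrass u p r : 0 < r ->
  (forall e : R, 0 < e -> exists v, (forall z, cabs (z - p) < r -> dif k.+1 v z) /\
     forall z, cabs (z - p) < r -> cabs (v z - u z) <= e) -> dif 1 u p.
Proof.
move=> r0 H; have [v0 [dv0 v0u]] := H 1 ltr01.
have [s s0 hs] := ccont_bound (dif_cont (dv0 p ltac:(by rewrite subrr cabs0))).
pose t := Num.min r s.
have t0 : 0 < t by rewrite min_gt0.
have tr z : cabs (z - p) < t / 4 -> cabs (z - p) < r.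
  move=> h; have : t <= r by rewrite ge_min lexx.
  by lra.
(* One unit each for [v0] against [v0 p], for [u] against [v0], and for a later approximant [v]
   against [u]. *)
pose M := cabs (v0 p) + 3.
have K0 : 0 <= 64 * M / t ^+ 2.
  by rewrite divr_ge0 ?mulr_ge0 ?addr_ge0 ?cabs_ge0 ?exprn_ge0 ?(ltW t0).
have t40 : 0 < t / 4 by rewrite divr_gt0.
have [|d hd] := @lim_exists (dquo u p 0) p _ _ t40 K0; last first.
  by apply/dif1P; exists d; exact: lim_cder hd.
move=> z w zp wp zt wt; apply/ler_addgt0Pr => e e0.
pose m := Num.min (cabs (z - p)) (cabs (w - p)).
have m0 : 0 < m by rewrite min_gt0// cabs_gt0 subr_eq0.
have [v [dv vu]] := H (Num.min 1 (e * m / 4)) ltac:(by rewrite min_gt0// divr_gt0// mulr_gt0).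
have vu1 x : cabs (x - p) < r -> cabs (v x - u x) <= 1.
  by move=> /vu; rewrite le_min => /andP[].
have cl x : x != p -> cabs (x - p) < t / 4 -> m <= cabs (x - p) ->
   cabs (dquo v p 0 x - dquo u p 0 x) <= e / 2.
  move=> xp xt mx; rewrite /dquo (negbTE xp).
  have -> : (v x - v p) / (x - p) - (u x - u p) / (x - p)
     = ((v x - u x) - (v p - u p)) / (x - p) by field; rewrite subr_eq0.
  rewrite cabsM cabsV ler_pdivrMr ?cabs_gt0 ?subr_eq0//.
  apply: le_trans (cabsB _ _) _.
  have := vu x (tr _ xt); have := vu p ltac:(by rewrite subrr cabs0).
  rewrite !le_min => /andP[_ h1] /andP[_ h2].
  by have := ler_wpM2l (ltW e0) mx; lra.
have h1 := cl z zp zt ltac:(by rewrite ge_min lexx).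
have h2 := cl w wp wt ltac:(by rewrite ge_min lexx orbT).
have h3 : cabs (dquo v p 0 z - dquo v p 0 w)
    <= 64 * M / t ^+ 2 * (cabs (z - p) + cabs (w - p)).
  apply: (dquo_cauchy MP) => // x; rewrite lt_min => /andP[xr xs].
  - exact: dif_cont (dv _ xr).
  - by move=> _; exact: dv.
  - have := hs _ xs; have := vu1 _ xr; have := v0u _ xr.
    have := cabs_lB (v x) (u x); have := cabs_lB (u x) (v0 x).
    rewrite [cabs (u x - v0 x)]cdistC /M; lra.
have h4 := cdist_tri (dquo v p 0 z) (dquo u p 0 z) (dquo u p 0 w).
have h5 := cdist_tri (dquo v p 0 w) (dquo v p 0 z) (dquo u p 0 w).
rewrite [cabs (dquo u p 0 z - dquo v p 0 z)]cdistC in h4.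
by lra.
Qed.

(** The derivative is the value at [p] of the filled quotient, which is at most [2 * N / (r / 2)] on
    the circle of radius [r / 2]. *)
Lemma cauchy_est v p r (N : R) (d : C) : 0 < r ->
  (forall z, cabs (z - p) < r -> dif k.+1 v z) ->
  (forall z, cabs (z - p) < r -> cabs (v z) <= N) ->
  cder v p d -> cabs d <= 4 * N / r.
Proof.
move=> r0 dv vN hd.
have N0 : 0 <= N by apply: le_trans (vN p _); rewrite ?cabs_ge0// subrr cabs0.
have -> : d = dquo v p d p by rewrite /dquo eqxx.
apply: (@maxp_disc _ _ MP [:: p] p (r / 2)).
- by rewrite divr_ge0 ?mulr_ge0 ?(ltW r0).
- move=> z zr; have [->|zp] := eqVneq z p; first exact/cder_dquo.
  by apply: (@dquo_dif _ 0) => //; apply: dif_cont (dv _ _); lra.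
- move=> z zr; rewrite inE => zp; apply: dquo_dif => //; apply: dv; lra.
- move=> z zr; have z0 : 0 < cabs (z - p) by rewrite zr; lra.
  have zp : z != p by rewrite -subr_eq0 -cabs_gt0.
  rewrite /dquo (negbTE zp) cabsM cabsV ler_pdivrMr//.
  apply: le_trans (cabsB _ _) _.
  have -> : 4 * N / r * cabs (z - p) = 2 * N by rewrite zr; field; rewrite gt_eqF.
  have := vN z ltac:(lra); have := vN p ltac:(rewrite subrr cabs0; lra); lra.
- rewrite subrr cabs0; lra.
Qed.

Definition punct u p r := ccont u p /\
  (forall z, cabs (z - p) < r -> z != p -> dif k.+1 u z).

Lemma punct_dquo u p r : 0 < r -> punct u p r ->
  exists2 d, cder u p d & punct (dquo u p d) p r.
Proof.
move=> r0 [cu du]; have /dif1P[d hd] := removable r0 cu du.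
exists d => //; split; first exact/cder_dquo.
by move=> z zr zp; apply: dquo_dif => //; exact: du.
Qed.

(** Four divisions at [p] give [u] a Taylor expansion with remainder [(z - p)^4 * A z], where [A] is
    continuous. Cauchy's estimate on the disc of radius [|z - p|] about [z] bounds the derivative of
    [A] by a multiple of [1 / |z - p|]. The remainder therefore contributes [O(|z - p|^3)] to [v],
    which is an expansion of order two. *)
Lemma deriv_dif2 u v p r : 0 < r ->
  (forall z, cabs (z - p) < r -> dif k.+1 u z) ->
  (forall z, cabs (z - p) < r -> cder u z (v z)) -> dif 2 v p.
Proof.
move=> r0 du duv.
have p0 : punct u p r.
  split; last by move=> z /du.
  by apply: dif_cont (du p _); rewrite subrr cabs0.
have [c1 h1 p1] := punct_dquo r0 p0.
have [c2 h2 p2] := punct_dquo r0 p1.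
have [c3 h3 p3] := punct_dquo r0 p2.
have [c4 h4 p4] := punct_dquo r0 p3.
set U1 := dquo u p c1 in p1 h2 p2 h3 p3 h4 p4.
set U2 := dquo U1 p c2 in p2 h3 p3 h4 p4.
set U3 := dquo U2 p c3 in p3 h4 p4.
set A := dquo U3 p c4 in p4.
have uE z : u z = u p + (z - p) * (c1 + (z - p) * (c2 + (z - p) * (c3 + (z - p) * A z))).
  rewrite (dquoE u p c1 z) -/U1 (dquoE U1 p c2 z) -/U2 (dquoE U2 p c3 z) -/U3.
  by rewrite (dquoE U3 p c4 z) -/A /U1 /U2 /U3 {1 2 3}/dquo eqxx.
case: p4 => cA dA; have [s s0 hs] := ccont_bound cA.
set N := cabs (A p) + 1 in hs.
have N0 : 0 < N by rewrite ltr_wpDl ?cabs_ge0.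
pose t := Num.min r s / 2.
have t0 : 0 < t by rewrite divr_gt0// min_gt0.
have vp : v p = c1 by apply: cder_uniq (duv p _) h1; rewrite subrr cabs0.
have key z : z != p -> cabs (z - p) < t ->
    cabs ((v z - c1 - 2 * c2 * (z - p)) / (z - p) ^+ 2 - 3 * c3) <= 8 * N * cabs (z - p).
  move=> zp; rewrite ltr_pdivlMr// lt_min => /andP[zr zs].
  have zr' : cabs (z - p) < r by have := cabs_ge0 (z - p); lra.
  have zpos : 0 < cabs (z - p) by rewrite cabs_gt0 subr_eq0.
  have zp0 : z - p != 0 by rewrite subr_eq0.
  have /dif1P[a ha] : dif 1 A z by elim: (k) (dA z zr' zp) => // j IH /difW.
  have ab : cabs a <= 4 * N / cabs (z - p).
    have near w : cabs (w - z) < cabs (z - p) ->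
       [/\ w != p, cabs (w - p) < r & cabs (w - p) < s].
      move=> h; have := cdist_tri z w p; split; try lra.
      by apply: contraTneq h => ->; rewrite cdistC ltxx.
    apply: (@cauchy_est A z) => // w /near[? ? ?]; [exact: dA|exact: hs].
  have := cderD (cder_cst (u p) z) (cderM (cder_subc p z) (cderD (cder_cst c1 z)
    (cderM (cder_subc p z) (cderD (cder_cst c2 z) (cderM (cder_subc p z)
      (cderD (cder_cst c3 z) (cderM (cder_subc p z) ha))))))).
  move=> /(cder_near (eqnear_eq _ (fun w => esym (uE w)))) hv.
  rewrite (cder_uniq (duv z zr') hv).
  set e := cabs _; have -> : e = cabs ((z - p) * (4 * A z) + (z - p) * ((z - p) * a)).
    by rewrite /e; congr cabs; field.
  apply: le_trans (cabsD _ _) _; rewrite !cabsM.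
  have -> : cabs (4 : C) = 4.
    by rewrite (_ : 4 = ofR 4) ?cabs_ofR ?ger0_norm// /ofR rmorph_nat.
  rewrite -mulrDr mulrC; apply: ler_wpM2r; first exact: cabs_ge0.
  have : cabs (z - p) * cabs a <= 4 * N by rewrite mulrC -ler_pdivlMr.
  have := hs z ltac:(lra); rewrite -/N; lra.
clearbody t.
exists (dquo v p (2 * c2)); split; last first.
  by apply: eqnear_eq => w; rewrite -dquoE.
exists (fun z => if z == p then 3 * c3 else (v z - c1 - 2 * c2 * (z - p)) / (z - p) ^+ 2).
split.
  move=> e e0; exists (Num.min t (e / (8 * N + 1))).
    by rewrite min_gt0// divr_gt0// ltr_wpDl// mulr_ge0// ltW.
  move=> z; rewrite lt_min ltr_pdivlMr ?ltr_wpDl ?mulr_ge0 ?(ltW N0)// eqxx => /andP[zt ze].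
  case: eqVneq => [_|zp]; first by rewrite subrr cabs0.
  have := key z zp zt; have := cabs_ge0 (z - p); move: ze; rewrite mulrDr mulr1; lra.
apply: eqnear_eq => z; rewrite {1 2}/dquo eqxx.
case: eqVneq => [->|zp]; first by rewrite subrr mul0r addr0.
have zp0 : z - p != 0 by rewrite subr_eq0.
by rewrite vp; field.
Qed.

End Class.
End CDer.

(** * Goursat's theorem *)

Section Goursat.
Variable R : realType.
Notation C := (Cplx R).
Implicit Types (z w p : C) (u v : C -> C).

Lemma antiderivative (phi : R -> R) (M : R) : continuous phi ->
  exists Phi : R -> R, forall x : R, `|x| < M -> is_derive x 1 Phi (phi x).
Proof.
move=> cphi.
exists (fun x => \int[lebesgue_measure]_(t in [set` `[- M, x]]) phi t).
move=> x; rewrite ltr_norml => /andP[x1 x2].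
have xM : x < M + 1 by lra.
have [|d1 d2] := @continuous_FTC1_closed R phi (- M) x (M + 1) xM _ x1 (cphi x).
  apply: continuous_compact_integrable; first exact: segment_compact.
  exact: continuous_subspaceT.
by apply: (DeriveDef d1); rewrite -[RHS]d2 derive1E.
Qed.

(** The mean value theorem for [Phi] minus a primitive of the affine function replaces an integral
    inequality. *)
Lemma antiderivative_lin (Phi psi : R -> R) (M a b al be e : R) :
  (forall x : R, `|x| < M -> is_derive x 1 Phi (psi x)) -> `|a| < M -> `|b| < M ->
  (forall t, Num.min a b <= t <= Num.max a b -> `|psi t - (al + be * t)| <= e) ->
  `|Phi b - Phi a - (al * (b - a) + be * (b ^+ 2 - a ^+ 2) / 2)| <= e * `|b - a|.
Proof.
move=> dPhi aM bM; wlog ab : a b aM bM / a <= b => [H|].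
  have /orP[ab|ba] := le_total a b; first exact: H.
  rewrite minC maxC => h; have := H b a bM aM ba h.
  rewrite [`|b - a|]distrC; apply: le_trans; rewrite -[leLHS]normrN.
  by rewrite le_eqVlt; apply/orP; left; apply/eqP; congr (`|_|); field.
rewrite (min_idPl ab) (max_idPr ab) => h.
have [->|ab'] := eqVneq a b.
  by rewrite !subrr mulr0 mulr0 mul0r !addr0 subrr normr0 mulr0.
have {ab ab'} ab : a < b by rewrite lt_neqAle ab'.
have inM t : a <= t <= b -> `|t| < M.
  by move: aM bM; rewrite !ltr_norml; lra.
pose G t := Phi t - (al * t + be * t ^+ 2 / 2).
have dG t : a <= t <= b -> is_derive t 1 G (psi t - (al + be * t)).
  move=> /inM /dPhi ?; rewrite /G.
  by apply: is_derive_eq; rewrite /GRing.scale /=; field.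
have [||c cab hc] := @MVT R G (fun t => psi t - (al + be * t)) a b ab.
- by move=> t; rewrite in_itv /= => /andP[h1 h2]; apply: dG; rewrite !ltW.
- apply: derivable_within_continuous => t; rewrite in_itv /= => tab.
  by apply: ex_derive; exact: dG.
have -> : Phi b - Phi a - (al * (b - a) + be * (b ^+ 2 - a ^+ 2) / 2) = G b - G a.
  by rewrite /G; field.
rewrite hc normrM; apply: ler_wpM2r => //; apply: h.
by rewrite !ltW ?(itvP cab).
Qed.

(** Choosing one antiderivative on []-M, M[] makes oriented integrals differences of its values:
    additivity and antisymmetry need no case on the order of the endpoints. *)
Definition prim (M : R) (phi : R -> R) : R -> R :=
  xget (fun=> 0) [set Phi : R -> R | forall x : R, `|x| < M -> is_derive x 1 Phi (phi x)].

Lemma primP M phi : continuous phi ->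
  forall x : R, `|x| < M -> is_derive x 1 (prim M phi) (phi x).
Proof.
move=> /(antiderivative M)[Phi hPhi]; rewrite /prim; case: xgetP => [? _ //|].
by move=> /(_ Phi).
Qed.

(* [intC M phi a b] is the oriented integral of [phi] from [a] to [b], for [a]
   and [b] in the interval ]-M, M[. *)
Definition intC M (phi : R -> C) (a b : R) : C :=
  ofRI (prim M (@re R \o phi) b - prim M (@re R \o phi) a)
       (prim M (@im R \o phi) b - prim M (@im R \o phi) a).

Lemma intC_add M phi a b c : intC M phi a b + intC M phi b c = intC M phi a c.
Proof.
rewrite [LHS]ofRIE reD imD /intC /=; congr ofRI; ring.
Qed.

Lemma intC_sym M phi a b : intC M phi a b = - intC M phi b a.
Proof. by rewrite [RHS]ofRIE reN imN /intC /=; congr ofRI; ring. Qed.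

Lemma re_ofRM r z : re (ofR r * z) = r * re z.
Proof. by rewrite reM /= mul0r subr0. Qed.
Lemma im_ofRM r z : im (ofR r * z) = r * im z.
Proof. by rewrite imM /= mul0r addr0. Qed.

Lemma intC_lin M (phi : R -> C) a b (al be : C) e :
  continuous (@re R \o phi) -> continuous (@im R \o phi) -> `|a| < M -> `|b| < M ->
  (forall t, Num.min a b <= t <= Num.max a b -> cabs (phi t - (al + be * ofR t)) <= e) ->
  cabs (intC M phi a b - (al * ofR (b - a) + be * ofR ((b ^+ 2 - a ^+ 2) / 2)))
    <= 2 * e * `|b - a|.
Proof.
move=> cr ci aM bM h; apply: le_trans (cabs_le _) _.
have mulC2 z r : z * ofR r = ofR r * z by rewrite mulrC.
have h1 := @antiderivative_lin _ _ M a b (re al) (re be) e (primP cr) aM bM.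
have h2 := @antiderivative_lin _ _ M a b (im al) (im be) e (primP ci) aM bM.
have -> : 2 * e * `|b - a| = e * `|b - a| + e * `|b - a| by ring.
apply: lerD.
  rewrite reB reD !mulC2 !re_ofRM /=.
  have -> : (b ^+ 2 - a ^+ 2) / 2 * re be = re be * (b ^+ 2 - a ^+ 2) / 2 by ring.
  rewrite mulrC; apply: h1 => t /h; apply: le_trans; apply: le_trans (re_le _).
  by rewrite reB reD mulC2 re_ofRM /= [t * _]mulrC.
rewrite imB imD !mulC2 !im_ofRM /=.
have -> : (b ^+ 2 - a ^+ 2) / 2 * im be = im be * (b ^+ 2 - a ^+ 2) / 2 by ring.
rewrite mulrC; apply: h2 => t /h; apply: le_trans; apply: le_trans (im_le _).
by rewrite imB imD mulC2 im_ofRM /= [t * _]mulrC.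
Qed.

Definition iC : C := ofRI 0 1.

Lemma ofRI_i x y : ofRI x y = ofR x + iC * ofR y.
Proof. by rewrite [RHS]ofRIE reD imD reM imM /=; congr ofRI; ring. Qed.
Lemma cabs_iC : cabs iC = 1.
Proof.
by apply/eqP; rewrite -(eqrXn2 (n := 2)) ?cabs_ge0// cabs_sqr /=; apply/eqP; ring.
Qed.

Section Rectangles.
Variables (M : R) (u : C -> C).
Hypothesis cu : forall z, ccont u z.

Lemma cont_hor y : continuous (@re R \o (fun x => u (ofRI x y))) /\
  continuous (@im R \o (fun x => u (ofRI x y))).
Proof.
have ch x e : 0 < e -> exists2 d : R, 0 < d & forall t, `|t - x| < d ->
    cabs (u (ofRI t y) - u (ofRI x y)) < e.
  move=> /(cu (ofRI x y))[d d0 hd]; exists d => // t td; apply: hd.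
  by apply: le_lt_trans (cabs_le _) _; rewrite reB imB /= subrr normr0 addr0.
split=> x; apply/cvgrPdist_lt => e /(ch x)[d d0 hd];
  exists d => //= t; rewrite /ball /= distrC => /hd; apply: le_lt_trans;
  by rewrite cdistC -(reB, imB) (re_le, im_le).
Qed.

Lemma cont_ver x : continuous (@re R \o (fun y => u (ofRI x y))) /\
  continuous (@im R \o (fun y => u (ofRI x y))).
Proof.
have ch y e : 0 < e -> exists2 d : R, 0 < d & forall t, `|t - y| < d ->
    cabs (u (ofRI x t) - u (ofRI x y)) < e.
  move=> /(cu (ofRI x y))[d d0 hd]; exists d => // t td; apply: hd.
  by apply: le_lt_trans (cabs_le _) _; rewrite reB imB /= subrr normr0 add0r.
split=> y; apply/cvgrPdist_lt => e /(ch y)[d d0 hd];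
  exists d => //= t; rewrite /ball /= distrC => /hd; apply: le_lt_trans;
  by rewrite cdistC -(reB, imB) (re_le, im_le).
Qed.

Definition hor y := intC M (fun x => u (ofRI x y)).
Definition ver x := intC M (fun y => u (ofRI x y)).
Definition rectint x1 x2 y1 y2 : C :=
  hor y1 x1 x2 + iC * ver x2 y1 y2 - hor y2 x1 x2 - iC * ver x1 y1 y2.

Lemma hor_lin y a b (c d : C) e : `|a| < M -> `|b| < M ->
  (forall t, Num.min a b <= t <= Num.max a b ->
     cabs (u (ofRI t y) - (c + d * ofRI t y)) <= e) ->
  cabs (hor y a b - ((c + d * iC * ofR y) * ofR (b - a)
    + d * ofR ((b ^+ 2 - a ^+ 2) / 2))) <= 2 * e * `|b - a|.
Proof.
move=> aM bM h; have [c1 c2] := cont_hor y; apply: intC_lin => // t /h.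
by apply: le_trans; rewrite ofRI_i le_eqVlt; apply/orP; left; apply/eqP; congr cabs; ring.
Qed.

Lemma ver_lin x a b (c d : C) e : `|a| < M -> `|b| < M ->
  (forall t, Num.min a b <= t <= Num.max a b ->
     cabs (u (ofRI x t) - (c + d * ofRI x t)) <= e) ->
  cabs (ver x a b - ((c + d * ofR x) * ofR (b - a)
    + d * iC * ofR ((b ^+ 2 - a ^+ 2) / 2))) <= 2 * e * `|b - a|.
Proof.
move=> aM bM h; have [c1 c2] := cont_ver x; apply: intC_lin => // t /h.
by apply: le_trans; rewrite ofRI_i le_eqVlt; apply/orP; left; apply/eqP; congr cabs; ring.
Qed.

Lemma rectint_split x1 x x2 y1 y y2 : rectint x1 x2 y1 y2 =
  rectint x1 x y1 y + rectint x x2 y1 y + rectint x1 x y y2 + rectint x x2 y y2.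
Proof.
rewrite /rectint /hor /ver -!(intC_add M _ x1 x x2) -!(intC_add M _ y1 y y2); ring.
Qed.

Lemma rectint_symx x1 x2 y1 y2 : rectint x1 x2 y1 y2 = - rectint x2 x1 y1 y2.
Proof.
by rewrite /rectint /hor !(intC_sym M _ x1 x2); ring.
Qed.

Lemma rectint_symy x1 x2 y1 y2 : rectint x1 x2 y1 y2 = - rectint x1 x2 y2 y1.
Proof.
by rewrite /rectint /ver !(intC_sym M _ y1 y2); ring.
Qed.

(** An affine function has integral zero around a rectangle, so only the errors on the four sides
    remain. *)
Lemma rectint_bound x y s t (c d : C) e : 0 <= s -> 0 <= t ->
  `|x| < M -> `|x + s| < M -> `|y| < M -> `|y + t| < M ->
  (forall a b, x <= a <= x + s -> y <= b <= y + t ->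
     cabs (u (ofRI a b) - (c + d * ofRI a b)) <= e) ->
  cabs (rectint x (x + s) y (y + t)) <= 4 * e * (s + t).
Proof.
move=> s0 t0 xM xsM yM ytM h.
have xs : x <= x + s by lra.
have yt : y <= y + t by lra.
have bx : `|x + s - x| = s by rewrite addrAC subrr add0r ger0_norm.
have by' : `|y + t - y| = t by rewrite addrAC subrr add0r ger0_norm.
have h1 := @hor_lin y x (x + s) c d e xM xsM.
have h2 := @hor_lin (y + t) x (x + s) c d e xM xsM.
have h3 := @ver_lin x y (y + t) c d e yM ytM.
have h4 := @ver_lin (x + s) y (y + t) c d e yM ytM.
move: h1 h2 h3 h4; rewrite (min_idPl xs) (max_idPr xs) (min_idPl yt) (max_idPr yt) bx by'.
move=> /(_ ltac:(by move=> a ?; apply: h; rewrite ?lexx ?yt)) h1.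
move=> /(_ ltac:(by move=> a ?; apply: h; rewrite ?lexx ?yt)) h2.
move=> /(_ ltac:(by move=> a ?; apply: h; rewrite ?lexx ?xs)) h3.
move=> /(_ ltac:(by move=> a ?; apply: h; rewrite ?lexx ?xs)) h4.
move: h1 h2 h3 h4; set E1 := _ - (_ + _); set E2 := _ - (_ + _).
set E3 := _ - (_ + _); set E4 := _ - (_ + _) => h1 h2 h3 h4.
have -> : rectint x (x + s) y (y + t) = E1 + iC * E4 - E2 - iC * E3.
  rewrite /rectint /E1 /E2 /E3 /E4 !ofRB !ofRD !ofRM; ring.
have n (a b : C) : cabs (a - iC * b) <= cabs a + cabs b.
  by apply: le_trans (cabsB _ _) _; rewrite cabsM cabs_iC mul1r.
have n' (a b : C) : cabs (a + iC * b) <= cabs a + cabs b.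
  by apply: le_trans (cabsD _ _) _; rewrite cabsM cabs_iC mul1r.
apply: le_trans (n _ _) _.
have := cabsB (E1 + iC * E4) E2; have := n' E1 E4; rewrite mulrDr; lra.
Qed.

End Rectangles.
End Goursat.

(** * Bisection, primitives, and the maximum principle for [dif 1] *)

Section Primitive.
Variable R : realType.
Notation C := (Cplx R).
Implicit Types (z w p : C) (u v : C -> C).

Lemma nested_intervals (x l : nat -> R) : (forall n, 0 <= l n) ->
  (forall n, x n <= x n.+1) -> (forall n, x n.+1 + l n.+1 <= x n + l n) ->
  exists c, forall n, x n <= c <= x n + l n.
Proof.
move=> l0 xS lS.
have mono n m : x n <= x (n + m)%N.
  by elim: m => [|m IH]; rewrite ?addn0// addnS (le_trans IH).
have anti n m : x (n + m)%N + l (n + m)%N <= x n + l n.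
  by elim: m => [|m IH]; rewrite ?addn0// addnS (le_trans (lS _)).
have up n m : x m <= x n + l n.
  have [nm|/ltnW mn] := leqP n m.
    by rewrite -(subnKC nm) (le_trans _ (anti n (m - n)%N))// lerDl.
  by rewrite -(subnKC mn) (le_trans (mono m (n - m)%N))// lerDl.
have hs : has_sup (range x).
  by split; [exists (x 0%N); exists 0%N|exists (x 0%N + l 0%N) => _ [m _ <-]].
exists (sup (range x)) => n; apply/andP; split.
  by apply: (ub_le_sup hs.2); exists n.
by apply: ge_sup; [exact: hs.1|move=> _ [m _ <-]].
Qed.

Section Square.
Variables (M : R) (u : C -> C).
Hypothesis cu : forall z, ccont u z.
Hypothesis du : forall z, `|re z| < M -> `|im z| < M -> dif 1 u z.
Local Notation rectint := (rectint M u).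

(** Goursat's bisection: some quarter always keeps a quarter of the modulus of the integral, while
    at the common point [c] of the nested quarters the affine approximation of [u] makes the
    integral [o(h n ^ 2)]. *)
Lemma goursat_pos x y s t : 0 <= s -> 0 <= t -> `|x| < M -> `|x + s| < M ->
  `|y| < M -> `|y + t| < M -> rectint x (x + s) y (y + t) = 0.
Proof.
move=> s0 t0 xM xsM yM ytM; apply: cabs0_eq0; apply/eqP.
rewrite eq_le cabs_ge0 andbT leNgt; apply/negP => k0.
set ka := cabs _ in k0.
pose h n : R := 2^-1 ^+ n.
have h0 n : 0 < h n by rewrite exprn_gt0// invr_gt0.
have hS n : h n.+1 = h n / 2 by rewrite /h exprSr.
pose big (q : R * R) n := ka * (h n * h n)
  <= cabs (rectint q.1 (q.1 + s * h n) q.2 (q.2 + t * h n)).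
pose cand (q : R * R) n : seq (R * R) := [:: q; (q.1 + s * h n.+1, q.2);
   (q.1, q.2 + t * h n.+1); (q.1 + s * h n.+1, q.2 + t * h n.+1)].
have step q n : big q n -> exists q', q' \in cand q n /\ big q' n.+1.
  rewrite /big => bq; apply: contrapT => no.
  have sm a b : (a, b) \in cand q n -> cabs (rectint a (a + s * h n.+1) b (b + t * h n.+1))
      < ka * (h n.+1 * h n.+1).
    by move=> abc; rewrite ltNge; apply/negP => ?; apply: no; exists (a, b).
  move: bq; rewrite (rectint_split M u _ (q.1 + s * h n.+1) _ _ (q.2 + t * h n.+1)).
  have e1 : q.1 + s * h n = q.1 + s * h n.+1 + s * h n.+1 by rewrite hS; field.
  have e2 : q.2 + t * h n = q.2 + t * h n.+1 + t * h n.+1 by rewrite hS; field.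
  rewrite e1 e2 leNgt => /negP; apply.
  have := sm q.1 q.2 ltac:(by rewrite !inE -surjective_pairing eqxx).
  have := sm (q.1 + s * h n.+1) q.2 ltac:(by rewrite !inE eqxx orbT).
  have := sm q.1 (q.2 + t * h n.+1) ltac:(by rewrite !inE eqxx !orbT).
  have := sm (q.1 + s * h n.+1) (q.2 + t * h n.+1) ltac:(by rewrite !inE eqxx !orbT).
  set A1 := rectint _ _ _ _; set A2 := rectint _ _ _ _.
  set A3 := rectint _ _ _ _; set A4 := rectint _ _ _ _.
  have -> : ka * (h n * h n) = 4 * (ka * (h n.+1 * h n.+1)) by rewrite hS; field.
  have := cabsD (A4 + A3 + A2) A1; have := cabsD (A4 + A3) A2; have := cabsD A4 A3.
  lra.
(* The default [q] is never taken along [pos], where [big] holds at every stage. *)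
pose nxt q n := if pselect (big q n) is left b then projT1 (cid (step q n b)) else q.
pose pos := fix pos n := if n is n'.+1 then nxt (pos n') n' else (x, y).
have bigpos n : big (pos n) n.
  elim: n => [|n IH]; first by rewrite /big /h /= expr0 !mulr1.
  rewrite /= /nxt; case: pselect => // b.
  by case: (cid _) => q' /= [].
have posS n : pos n.+1 \in cand (pos n) n.
  rewrite /= /nxt; case: pselect => [b|]; last by move: (bigpos n).
  by case: (cid _) => q' /= [].
have sh n : 0 <= s * h n by rewrite mulr_ge0// ltW.
have th n : 0 <= t * h n by rewrite mulr_ge0// ltW.
have [cx hcx] : exists c, forall n, (pos n).1 <= c <= (pos n).1 + s * h n.
  apply: nested_intervals => // n; have := posS n; have := sh n.+1;
    rewrite !inE => hh /or4P[] /eqP -> /=; move: hh; rewrite !hS; lra.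
have [cy hcy] : exists c, forall n, (pos n).2 <= c <= (pos n).2 + t * h n.
  apply: nested_intervals => // n; have := posS n; have := th n.+1;
    rewrite !inE => hh /or4P[] /eqP -> /=; move: hh; rewrite !hS; lra.
have posin n : [/\ x <= (pos n).1, (pos n).1 + s * h n <= x + s,
    y <= (pos n).2 & (pos n).2 + t * h n <= y + t].
  elim: n => [|n [i1 i2 i3 i4]]; first by rewrite /h expr0 !mulr1.
  have := posS n; have := sh n.+1; have := th n.+1; move: i1 i2 i3 i4.
  rewrite !inE => a1 a2 a3 a4 a5 a6 /or4P[] /eqP -> /=;
    by move: a1 a2 a3 a4 a5 a6; rewrite !hS; clear; split; lra.
pose c : C := ofRI cx cy.
have /dif1P[d hd] : dif 1 u c.
  have [i1 i2 i3 i4] := posin 0%N; have := hcx 0%N; have := hcy 0%N.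
  move=> /andP[? ?] /andP[? ?].
  move: xM xsM yM ytM; rewrite !ltr_norml => /andP[? ?] /andP[? ?] /andP[? ?] /andP[? ?].
  apply: du => /=; rewrite ltr_norml; apply/andP; split; lra.
have [e e0 he] : exists2 e, 0 < e & 4 * e * (s + t) ^+ 2 < ka.
  have D0 : 0 <= 4 * (s + t) ^+ 2 by rewrite mulr_ge0// sqr_ge0.
  exists (ka / (4 * (s + t) ^+ 2 + 1)); first by rewrite divr_gt0// ltr_wpDl.
  have -> : 4 * (ka / (4 * (s + t) ^+ 2 + 1)) * (s + t) ^+ 2
      = ka * (4 * (s + t) ^+ 2) / (4 * (s + t) ^+ 2 + 1) by ring.
  by rewrite ltr_pdivrMr ?ltr_wpDl// mulrDr mulr1 ltrDl.
have [dl dl0 hdl] := hd e e0.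
have [n hn] : exists n, (s + t) * h n < dl.
  have [n hn] := @pow_unbounded R 2 ((s + t) / dl) ltac:(by rewrite ltr1n).
  exists n; rewrite /h exprVn ltr_pdivrMr ?exprn_gt0// mulrC -ltr_pdivrMr//.
have := bigpos n; rewrite /big leNgt => /negP; apply.
have [i1 i2 i3 i4] := posin n.
have B := @rectint_bound R M u cu (pos n).1 (pos n).2 (s * h n) (t * h n)
  (u c - d * c) d (e * ((s + t) * h n)) (sh n) (th n).
have sub (c1 a b : R) : `|a| < M -> `|b| < M -> a <= c1 -> c1 <= b -> `|c1| < M.
  by rewrite !ltr_norml => /andP[? ?] /andP[? ?] ? ?; apply/andP; split; lra.
have shn := sh n; have thn := th n.
apply: le_lt_trans (B _ _ _ _ _) _.
- by apply: sub xM xsM _ _; clear -i1 i2 i3 i4 shn thn; lra.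
- by apply: sub xM xsM _ _; clear -i1 i2 i3 i4 shn thn; lra.
- by apply: sub yM ytM _ _; clear -i1 i2 i3 i4 shn thn; lra.
- by apply: sub yM ytM _ _; clear -i1 i2 i3 i4 shn thn; lra.
- move=> a b /andP[a1 a2] /andP[b1 b2].
  have near : cabs (ofRI a b - c) <= (s + t) * h n.
    apply: le_trans (cabs_le _) _; rewrite reB imB /c /= mulrDl.
    have /andP[h1 h2] := hcx n; have /andP[h3 h4] := hcy n.
    apply: lerD; rewrite ler_norml; apply/andP; split;
      by move: a1 a2 b1 b2 h1 h2 h3 h4; clear; lra.
  have := hdl (ofRI a b) (le_lt_trans near hn).
  have -> : u (ofRI a b) - u c - d * (ofRI a b - c)
     = u (ofRI a b) - (u c - d * c + d * ofRI a b) by ring.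
  by move=> /le_trans; apply; apply: ler_wpM2l => //; exact: ltW.
rewrite [ltLHS](_ : _ = 4 * e * (s + t) ^+ 2 * (h n * h n)); last by ring.
by rewrite ltr_pM2r// mulr_gt0.
Qed.

Lemma goursat x1 x2 y1 y2 : `|x1| < M -> `|x2| < M ->
  `|y1| < M -> `|y2| < M -> rectint x1 x2 y1 y2 = 0.
Proof.
move=> hx1 hx2 hy1 hy2.
wlog xx : x1 x2 hx1 hx2 / x1 <= x2 => [H|].
  have /orP[x12|x21] := le_total x1 x2; first exact: H.
  by rewrite rectint_symx H ?oppr0.
wlog yy : y1 y2 hy1 hy2 / y1 <= y2 => [H|].
  have /orP[y12|y21] := le_total y1 y2; first exact: H.
  by rewrite rectint_symy H ?oppr0.
have := @goursat_pos x1 y1 (x2 - x1) (y2 - y1).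
by rewrite !subr_ge0 ![_ + (_ - _)]addrC !subrK; exact.
Qed.

Definition prim2 z := hor M u 0 0 (re z) + iC R * ver M u (re z) 0 (im z).

(** The two paths differ by the boundary of a rectangle between the real axis and the horizontal
    line through [z], where [goursat] applies. *)
Lemma prim2B z w : `|re z| < M -> `|im z| < M -> `|re w| < M -> `|im w| < M ->
  prim2 w - prim2 z = hor M u (im z) (re z) (re w) + iC R * ver M u (re w) (im z) (im w).
Proof.
move=> rz iz rw iw.
have M0 : `|0 : R| < M by rewrite normr0; apply: le_lt_trans rz.
have := @goursat (re z) (re w) 0 (im z) rz rw M0 iz; rewrite /rectint /prim2.
have h1 := intC_add M (fun x => u (ofRI x 0)) 0 (re z) (re w).
have h2 := intC_add M (fun y => u (ofRI (re w) y)) 0 (im z) (im w).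
rewrite /hor /ver -h1 -h2 => h.
apply/eqP; rewrite -subr_eq0; apply/eqP; rewrite -[RHS]h; ring.
Qed.

Lemma peano2 (U : C -> C) z (a b : C) :
  (forall e, 0 < e -> exists2 r : R, 0 < r & forall w, cabs (w - z) < r ->
     cabs (U w - U z - a * (w - z) - b * (w - z) ^+ 2) <= e * cabs (w - z) ^+ 2) ->
  cder U z a /\ dif 2 U z.
Proof.
move=> H.
pose phi := dquo U z a.
have cchi : ccont (dquo phi z b) z.
  move=> e e0; have [r r0 hr] := H (e / 2) ltac:(by rewrite divr_gt0).
  exists r => // w wr; rewrite /dquo eqxx; case: eqVneq => [_|wz].
    by rewrite subrr cabs0.
  have wz0 : w - z != 0 by rewrite subr_eq0.
  rewrite /phi /dquo eqxx (negbTE wz).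
  have -> : ((U w - U z) / (w - z) - a) / (w - z) - b =
     (U w - U z - a * (w - z) - b * (w - z) ^+ 2) / (w - z) ^+ 2 by field.
  rewrite cabsM cabsV cabsX ltr_pdivrMr ?exprn_gt0 ?cabs_gt0//.
  apply: le_lt_trans (hr _ wr) _; rewrite ltr_pM2r ?exprn_gt0 ?cabs_gt0//; lra.
have dphi : dif 1 phi z by apply/dif_dquo; exists b.
split; first by apply/cder_dquo; exact: dif_cont dphi.
by apply/dif_dquo; exists a.
Qed.

(** The affine approximation of [u] at [z] integrates to a quadratic expansion of [prim2]; this is
    where one derivative of [u] becomes two of a primitive. *)
Lemma prim2_peano z : `|re z| < M -> `|im z| < M ->
  cder prim2 z (u z) /\ dif 2 prim2 z.
Proof.
move=> rz iz; have /dif1P[d hd] := du rz iz.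
apply: (@peano2 _ _ _ (d / 2)) => e e0.
(* With [l = |w - z|], each of the two segments contributes [2 * (e / 8 * (2 * l)) * l]: the 2 in
   front is for real and imaginary parts, and [2 * l] bounds the distance from [z] on the path. *)
have [r r0 hr] := hd (e / 8) ltac:(by rewrite divr_gt0).
pose m := Num.min (r / 2) (Num.min (M - `|re z|) (M - `|im z|)).
exists m; first by rewrite !min_gt0 ?divr_gt0 ?subr_gt0.
move=> w; rewrite !lt_min => /and3P[wr w1 w2].
have rw : `|re w| < M.
  have := re_le (w - z); rewrite reB; have := ler_normD (re w - re z) (re z).
  by rewrite subrK; lra.
have iw : `|im w| < M.
  have := im_le (w - z); rewrite imB; have := ler_normD (im w - im z) (im z).
  by rewrite subrK; lra.
rewrite prim2B//.
set l := cabs (w - z) in wr w1 w2 *.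
have l0 : 0 <= l := cabs_ge0 _.
have near a b : `|a - re z| <= l -> `|b - im z| <= l ->
   cabs (u (ofRI a b) - (u z - d * z + d * ofRI a b)) <= e / 8 * (2 * l).
  move=> ha hb.
  have hab : cabs (ofRI a b - z) <= 2 * l.
    apply: le_trans (cabs_le _) _; rewrite reB imB /=; lra.
  have := hr (ofRI a b) ltac:(lra).
  have -> : u (ofRI a b) - u z - d * (ofRI a b - z)
     = u (ofRI a b) - (u z - d * z + d * ofRI a b) by ring.
  by move=> /le_trans; apply; apply: ler_wpM2l => //; lra.
have hl := re_le (w - z); have vl := im_le (w - z); rewrite -/l reB imB in hl vl.
have btw (a b t : R) : Num.min a b <= t <= Num.max a b -> `|t - a| <= `|b - a|.
  by case: (lerP a b) => ab /andP[h1 h2]; 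
    [rewrite !ger0_norm ?subr_ge0//|rewrite !ler0_norm ?subr_le0 ?(ltW ab)//]; lra.
have h1 := @hor_lin R M u cu (im z) (re z) (re w) (u z - d * z) d (e / 8 * (2 * l)) rz rw.
have h2 := @ver_lin R M u cu (re w) (im z) (im w) (u z - d * z) d (e / 8 * (2 * l)) iz iw.
have {}h1 := h1 ltac:(by move=> t /btw ht; apply: near; rewrite ?subrr ?normr0//; lra).
have {}h2 := h2 ltac:(by move=> t /btw ht; apply: near => //; lra).
move: h1 h2; set E1 := hor _ _ _ _ _ - _; set E2 := ver _ _ _ _ _ - _ => h1 h2.
set T := cabs _; have -> : T = cabs (E1 + iC R * E2).
  rewrite /T; congr cabs; rewrite /E1 /E2 !ofRM !ofRB !expr2 !ofRM ofRV.
  have -> : ofR 2 = 2 :> C by rewrite /ofR rmorph_nat.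
  have wE : w = ofR (re w) + iC R * ofR (im w) by rewrite -ofRI_i -ofRIE.
  have zE : z = ofR (re z) + iC R * ofR (im z) by rewrite -ofRI_i -ofRIE.
  move: (hor _ _ _ _ _) (ver _ _ _ _ _) (u z) wE zE => H V uz.
  move: (ofR (re z)) (ofR (im z)) (ofR (re w)) (ofR (im w)) => x y X Y wE zE.
  by rewrite wE zE; field.
apply: le_trans (cabsD _ _) _; rewrite cabsM cabs_iC mul1r.
have e80 : 0 <= e / 8 * (2 * l) by rewrite mulr_ge0 ?divr_ge0 ?mulr_ge0 ?(ltW e0).
have k1 : 2 * (e / 8 * (2 * l)) * `|re w - re z| <= 2 * (e / 8 * (2 * l)) * l.
  by apply: ler_wpM2l => //; rewrite mulr_ge0.
have k2 : 2 * (e / 8 * (2 * l)) * `|im w - im z| <= 2 * (e / 8 * (2 * l)) * l.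
  by apply: ler_wpM2l => //; rewrite mulr_ge0.
have -> : e * l ^+ 2 = 2 * (e / 8 * (2 * l)) * l + 2 * (e / 8 * (2 * l)) * l by field.
by apply: lerD; [exact: le_trans h1 k1|exact: le_trans h2 k2].
Qed.

End Square.

Lemma cabs_re_im_lt z (r : R) : `|re z| < r / 2 -> `|im z| < r / 2 -> cabs z < r.
Proof. by have := cabs_le z; lra. Qed.

Definition clampR (r x : R) := Num.max (- r) (Num.min r x).

Lemma clampR_le r x : 0 < r -> `|clampR r x| <= r.
Proof.
move=> r0; rewrite /clampR ler_norml le_max lexx /=.
by rewrite ge_max ge_min lexx andbT; lra.
Qed.

Lemma clampR_id r x : `|x| < r -> clampR r x = x.
Proof.
rewrite ltr_norml => /andP[h1 h2]; rewrite /clampR.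
by rewrite (min_idPr (ltW h2)) (max_idPr (ltW h1)).
Qed.

Lemma clampR_lip r x y : `|clampR r x - clampR r y| <= `|x - y|.
Proof.
wlog xy : x y / x <= y => [H|].
  have /orP[|yx] := le_total x y; first exact: H.
  by rewrite distrC [leRHS]distrC; exact: H.
rewrite distrC [leRHS]distrC [leRHS]ger0_norm ?subr_ge0// /clampR.
have h1 : 0 <= Num.min r y - Num.min r x <= y - x.
  by rewrite /Order.min; case: (ltP r y) => ?; case: (ltP r x) => ?; apply/andP; split; lra.
move: (Num.min r y) (Num.min r x) h1 => a b /andP[h1 h2].
by rewrite /Order.max ler_norml; case: (ltP (- r) a) => ?; case: (ltP (- r) b) => ?;
  apply/andP; split; lra.
Qed.

(* By [goursat], [u] is locally the derivative of the twice differentiable function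
   [prim2]; [clampR] extends [u] continuously beyond a square, so that the segment
   integrals defining [prim2] make sense. *)
Lemma dif1_dif2 u p (r : R) : 0 < r ->
  (forall z, cabs (z - p) < r -> dif 1 u z) -> dif 2 u p.
Proof.
move=> r0 du; pose m := r / 4.
have m0 : 0 < m by rewrite divr_gt0.
pose cl z : C := ofRI (clampR m (re z)) (clampR m (im z)).
have cln z : cabs (cl z) < r.
  have h1 := @clampR_le m (re z) m0; have h2 := @clampR_le m (im z) m0.
  by apply: cabs_re_im_lt => /=; move: h1 h2; rewrite /m; lra.
pose u' z := u (cl z + p).
have cu z : ccont u' z.
  apply: (@ccont_comp _ (fun z => cl z + p) u); last first.
    by apply: (@dif_cont _ 1); apply: du; rewrite addrK.
  move=> e e0; exists (e / 2); first by rewrite divr_gt0.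
  move=> w wz; have -> : cl w + p - (cl z + p) = cl w - cl z by ring.
  apply: le_lt_trans (cabs_le _) _; rewrite reB imB /=.
  have h1 := clampR_lip m (re w) (re z); have h2 := clampR_lip m (im w) (im z).
  have := re_le (w - z); have := im_le (w - z); rewrite reB imB; lra.
have u'E z : `|re z| < m -> `|im z| < m -> u' z = u (z + p).
  by move=> h1 h2; rewrite /u' /cl !clampR_id// -ofRIE.
have mnear z : `|re z| < m -> `|im z| < m -> exists2 s : R, 0 < s &
    forall w, cabs (w - z) < s -> `|re w| < m /\ `|im w| < m.
  move=> h1 h2; exists (Num.min (m - `|re z|) (m - `|im z|)).
    by rewrite min_gt0// subr_gt0.
  move=> w; rewrite lt_min => /andP[k1 k2].
  have := re_le (w - z); have := im_le (w - z); rewrite reB imB.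
  have := ler_normD (re w - re z) (re z); have := ler_normD (im w - im z) (im z).
  by rewrite !subrK; split; lra.
have du' z : `|re z| < m -> `|im z| < m -> dif 1 u' z.
  move=> h1 h2; have [s s0 hs] := mnear z h1 h2.
  apply: (@dif_near _ _ (fun w => u (w + p))).
    by exists s => // w /hs[? ?]; rewrite u'E.
  apply: (@dif_comp _ 1 (fun w => w + p) u).
    by apply: difD; [exact: dif_id|exact: dif_cst].
  apply: du; rewrite addrK; apply: cabs_re_im_lt; rewrite /m in h1 h2; lra.
pose V w := prim2 m u' (w - p).
have hV w : cabs (w - p) < m -> cder V w (u w) /\ dif 2 V w.
  move=> wm; have h1 := le_lt_trans (re_le _) wm; have h2 := le_lt_trans (im_le _) wm.
  have [k1 k2] := prim2_peano cu du' h1 h2.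
  split; last by apply: (@dif_comp _ 2 (fun w => w - p)) => //; exact: dif_subc.
  move=> e /k1[s s0 hs]; exists s => // x xw.
  have e1 : x - p - (w - p) = x - w by ring.
  by have := hs (x - p); rewrite e1 u'E// subrK => /(_ xw).
by apply: (@deriv_dif2 R 1 (@maxp_dif2 R) V u p m) => // z /hV[].
Qed.

Theorem maximum_modulus : maxp (@dif R 1).
Proof.
move=> B u M oB bB M0 cu du; apply: maxp_dif2 => // z Bz.
have [r r0 hr] := (openCP B).1 oB z Bz.
by apply: (dif1_dif2 r0) => w /hr/du.
Qed.

End Primitive.

(** * Zeros, Liouville's theorem and open mappings *)

Section Holomorphic.
Variable R : realType.
Notation C := (Cplx R).
Implicit Types (z w p : C) (u v G H : C -> C).

Let MM := @maximum_modulus R.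

Lemma hol_dquo u p r : 0 < r -> (forall z, cabs (z - p) < r -> dif 1 u z) ->
  exists d, cder u p d /\ forall z, dif 1 u z -> dif 1 (dquo u p d) z.
Proof.
move=> r0 du.
have [|d hd [cd dd]] := @punct_dquo R 0 MM u p r r0.
  by split=> [|z /du//]; apply: (@dif_cont _ 1); apply: du; rewrite subrr cabs0.
exists d; split => // z duz; have [->|zp] := eqVneq z p; last exact: dquo_dif.
exact: (removable MM r0 cd dd).
Qed.

Lemma cont_bounded (K : set C) u : compact K -> (forall z, K z -> ccont u z) ->
  exists2 M : R, 0 <= M & forall z, K z -> cabs (u z) <= M.
Proof.
move=> cK cu; have [K0|K0] := pselect (K !=set0); last first.
  by exists 0 => // z Kz; exfalso; apply: K0; exists z.
have [|z Kz h] := @contR_max R K (fun z => cabs (u z)) K0 cK.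
  move=> z /cu cz e /cz[d d0 hd]; exists d => // w _ /hd.
  apply: le_lt_trans; rewrite ler_norml; apply/andP; split; last exact: cabs_lB.
  by rewrite lerNl opprB cdistC; exact: cabs_lB.
by exists (cabs (u z)); first exact: cabs_ge0.
Qed.

Lemma cont_min (K : set C) u : compact K -> (forall z, K z -> ccont u z) ->
  (forall z, K z -> u z != 0) -> exists2 m : R, 0 < m & forall z, K z -> m <= cabs (u z).
Proof.
move=> cK cu u0; have [|M M0 hM] := @cont_bounded K (fun z => (u z)^-1) cK.
  by move=> z Kz; apply: ccontV; [exact: u0|exact: cu].
exists (M + 1)^-1; first by rewrite invr_gt0 ltr_wpDl.
move=> z Kz; have u1 : 0 < cabs (u z) by rewrite cabs_gt0 u0.
rewrite -[leRHS]invrK lef_pV2 ?posrE ?invr_gt0 ?ltr_wpDl//.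
by have := hM z Kz; rewrite cabsV; lra.
Qed.

Lemma geom_zero (x y M : R) : 0 <= x < 1 -> 0 <= y -> (forall n : nat, y <= M * x ^+ n) -> y = 0.
Proof.
move=> /andP[x0 x1] y0 h; apply/eqP; rewrite eq_le y0 andbT leNgt; apply/negP => yp.
have M0 : 0 < M by have := h 0%N; rewrite expr0 mulr1; exact: lt_le_trans.
have [xz|xz] := eqVneq x 0; first by have := h 1%N; rewrite xz mulr0 leNgt yp.
have {xz x0}x0 : 0 < x by rewrite lt_neqAle eq_sym xz.
have [n] := @pow_unbounded R x^-1 (M / y) ltac:(by rewrite invf_gt1).
by rewrite exprVn ltr_pdivrMr// mulrC ltr_pdivlMr ?exprn_gt0// ltNge h.
Qed.

(** As long as the quotient vanishes at [p] it can be divided once more. If this never ends, then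
    [u = (z - p)^k * G] with [|G| <= M / (r / 2)^k] by the maximum principle for every [k], and [u]
    is zero on the smaller disc. *)
Lemma zero_order u p r : 0 < r -> (forall z, cabs (z - p) < r -> dif 1 u z) ->
  (exists k G, [/\ forall z, u z = (z - p) ^+ k * G z,
     forall z, dif 1 u z -> dif 1 G z & G p != 0])
  \/ (forall z, cabs (z - p) < r / 2 -> u z = 0).
Proof.
move=> r0 du; have [?|no] := pselect (exists k G, [/\ forall z, u z = (z - p) ^+ k * G z,
     forall z, dif 1 u z -> dif 1 G z & G p != 0]); first by left.
right; have r20 : 0 < r / 2 by rewrite divr_gt0.
have {}no k G : (forall z, u z = (z - p) ^+ k * G z) ->
    (forall z, dif 1 u z -> dif 1 G z) -> G p = 0.
  by move=> h1 h2; apply/eqP; apply: contrapT => /negP h3; apply: no; exists k, G.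
have ex k : exists G, (forall z, u z = (z - p) ^+ k * G z) /\ forall z, dif 1 u z -> dif 1 G z.
  elim: k => [|k [G [h1 h2]]]; first by exists u; split=> // z; rewrite expr0 mul1r.
  have dG z : cabs (z - p) < r -> dif 1 G z by move=> /du/h2.
  have [d [hd dd]] := hol_dquo r0 dG.
  exists (dquo G p d); split; last by move=> z /h2/dd.
  by move=> z; rewrite h1 (dquoE G p d z) (no k G h1 h2) add0r exprSr mulrA.
have [M M0 hM] : exists2 M : R, 0 <= M & forall z, cdisc p (r / 2) z -> cabs (u z) <= M.
  apply: cont_bounded.
    apply: compactC; last exact: cdisc_closed.
    exists (r / 2 + cabs p) => z; rewrite /cdisc /=; have := cabs_lB z p; lra.
  by move=> z; rewrite /cdisc /= => h; apply: (@dif_cont _ 1); apply: du; lra.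
move=> z zr; apply: cabs0_eq0.
apply: (@geom_zero (cabs (z - p) / (r / 2)) _ M); last 2 first.
- exact: cabs_ge0.
- move=> k; have [G [h1 h2]] := ex k.
  have : cabs (G z) <= M / (r / 2) ^+ k.
    apply: (maxp_disc MM (E := [::]) (p := p) (r := r / 2)) => //.
    + by rewrite divr_ge0// exprn_ge0// ltW.
    + by move=> w hw; apply: (@dif_cont _ 1); apply/h2/du; lra.
    + by move=> w hw _; apply/h2/du; lra.
    + move=> w hw; rewrite ler_pdivlMr ?exprn_gt0// mulrC -hw -cabsX -cabsM -h1.
      by apply: hM; rewrite /cdisc /= hw.
  move=> h3; rewrite h1 cabsM cabsX.
  have -> : M * (cabs (z - p) / (r / 2)) ^+ k = cabs (z - p) ^+ k * (M / (r / 2) ^+ k).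
    by rewrite expr_div_n; ring.
  by apply: ler_wpM2l => //; rewrite exprn_ge0 ?cabs_ge0.
by rewrite divr_ge0 ?cabs_ge0 ?(ltW r20)//= ltr_pdivrMr// mul1r.
Qed.

Lemma isolated_zeros u p r : 0 < r -> (forall z, cabs (z - p) < r -> dif 1 u z) ->
  (forall e : R, 0 < e -> exists z, [/\ z != p, cabs (z - p) < e & u z = 0]) ->
  forall z, cabs (z - p) < r / 2 -> u z = 0.
Proof.
move=> r0 du acc; have [[k [G [uG dG Gp]]]|//] := zero_order r0 du.
have cG : ccont G p by apply: (@dif_cont _ 1); apply/dG/du; rewrite subrr cabs0.
have [e e0 he] := ccont_neq0 cG Gp.
have [z [zp ze]] := acc e e0; rewrite uG => /eqP; rewrite mulf_eq0 expf_eq0.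
by rewrite subr_eq0 (negbTE zp) andbF (negbTE (he z ze)).
Qed.

(** Division by [z - p] lowers the growth exponent by one. At exponent 0 the quotient is at most
    [N / s] on all large circles of radius [s], hence zero. *)
Lemma liouville_poly H p (k : nat) (K R0 : R) : (forall z, dif 1 H z) ->
  (forall z, R0 <= cabs (z - p) -> cabs (H z) <= K * cabs (z - p) ^+ k) ->
  exists P : {poly C}, forall z, H z = P.[z].
Proof.
elim: k H K R0 => [|k IH] H K R0 dH hH.
  exists (H p)%:P => z; rewrite hornerC.
  have [d [hd dd]] := hol_dquo ltr01 (fun z (_ : cabs (z - p) < 1) => dH z).
  suff : dquo H p d z = 0 by rewrite (dquoE H p d z) => ->; rewrite mulr0 addr0.
  apply/cabs0_eq0/eqP; rewrite eq_le cabs_ge0 andbT.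
  apply/ler_addgt0Pr => e e0; rewrite add0r.
  pose N := `|K| + cabs (H p).
  have N0 : 0 <= N by rewrite addr_ge0// cabs_ge0.
  pose s := Num.max 1 (Num.max R0 (Num.max (N / e) (cabs (z - p) + 1))).
  have : s <= s by []; rewrite {1}/s !ge_max => /and4P[s1 sR sN sz].
  apply: (maxp_disc MM (E := [::]) (p := p) (r := s)) => //.
  + exact: ltW.
  + by move=> w _; apply: (@dif_cont _ 1); exact: dd.
  + by move=> w _ _; exact: dd.
  + move=> w ws; have w0 : 0 < cabs (w - p) by rewrite ws; lra.
    have wp : w != p by rewrite -subr_eq0 -cabs_gt0.
    rewrite /dquo (negbTE wp) cabsM cabsV ler_pdivrMr// ws.
    apply: le_trans (cabsB _ _) _.
    have := hH w ltac:(by rewrite ws); rewrite expr0 mulr1 => h1.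
    have h2 : N <= e * s by rewrite mulrC -ler_pdivrMr.
    by have := ler_norm K; rewrite /N in h2; lra.
  + by lra.
have [d [hd dd]] := hol_dquo ltr01 (fun z (_ : cabs (z - p) < 1) => dH z).
have [P hP] := IH (dquo H p d) (K + cabs (H p)) (Num.max 1 R0) (fun z => dd z (dH z)) ltac:(
  move=> z; rewrite ge_max => /andP[z1 zR];
  have z0 : 0 < cabs (z - p) by [lra];
  have zp : z != p by [rewrite -subr_eq0 -cabs_gt0];
  rewrite /dquo (negbTE zp) cabsM cabsV ler_pdivrMr// -mulrA -exprSr;
  apply: le_trans (cabsB _ _) _; rewrite mulrDl; apply: lerD; [exact: hH|];
  rewrite ler_peMr ?cabs_ge0// exprn_ege1//).
exists ((H p)%:P + ('X - p%:P) * P) => z.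
by rewrite !hornerE -hP -dquoE.
Qed.

(** If a value [v] within [m / 3] of [u z] were not taken, [1 / (u - v)] would be at most
    [3 / (2 * m)] on the boundary and above [3 / m] at [z], against the maximum principle. *)
Lemma open_mapping (B : set C) u z : open B -> Cbounded B ->
  (forall w, closure B w -> ccont u w) -> (forall w, B w -> dif 1 u w) -> B z ->
  (forall w, closure B w -> ~ B w -> u w <> u z) ->
  exists2 d : R, 0 < d & forall v : C, cabs (v - u z) < d -> exists2 w, B w & u w = v.
Proof.
move=> oB bB cu du Bz uz.
have [m m0 hm] : exists2 m : R, 0 < m & forall w, (closure B `&` ~` B) w -> m <= cabs (u w - u z).
  apply: (@cont_min _ (fun w => u w - u z)).
  - apply: (subclosed_compact _ (compact_closureC bB)); last by move=> ? [].
    by apply: closedI; [exact: closed_closure|exact: open_closedC].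
  - by move=> w [cw _]; apply: ccontD; [exact: cu|exact: ccont_cst].
  - by move=> w [cw nw]; rewrite subr_eq0; apply/eqP; exact: uz.
exists (m / 3); first by rewrite divr_gt0.
move=> v vz; apply: contrapT => no.
have nv w : closure B w -> u w - v != 0.
  move=> cw; rewrite subr_eq0; apply/eqP => uwv.
  have [Bw|nB] := pselect (B w); first by apply: no; exists w.
  by have := hm w (conj cw nB); rewrite uwv; lra.
have := @MM B (fun w => (u w - v)^-1) (2 * m / 3)^-1 oB bB.
move=> /(_ ltac:(by rewrite invr_ge0 divr_ge0// mulr_ge0// ltW)) /(_ _ _ _ z Bz).
have h1 w : closure B w -> ccont (fun w => (u w - v)^-1) w.
  move=> cw; apply: ccontV; first exact: nv.
  by apply: ccontD; [exact: cu|exact: ccont_cst].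
have h2 w : B w -> dif 1 (fun w => (u w - v)^-1) w.
  move=> Bw; apply: difV; first by apply: nv; exact: subset_closure.
  by apply: difB; [exact: du|exact: dif_cst].
have h3 w : closure B w -> ~ B w -> cabs (u w - v)^-1 <= (2 * m / 3)^-1.
  move=> cw nw; rewrite cabsV lef_pV2 ?posrE ?cabs_gt0 ?nv ?divr_gt0 ?mulr_gt0//.
  by have := hm w (conj cw nw); have := cdist_tri v (u w) (u z); lra.
move=> /(_ h1 h2 h3); rewrite cabsV leNgt => /negP; apply.
have zv : 0 < cabs (u z - v) by rewrite cabs_gt0 nv//; exact: subset_closure.
by rewrite ltf_pV2 ?posrE ?divr_gt0 ?mulr_gt0// cdistC; lra.
Qed.

Lemma open_at u p r : 0 < r -> (forall z, cabs (z - p) < r -> dif 1 u z) ->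
  (forall z, cabs (z - p) < r -> z != p -> u z != u p) ->
  exists2 d : R, 0 < d & forall v : C, cabs (v - u p) < d ->
    exists2 w, cabs (w - p) < r & u w = v.
Proof.
move=> r0 du up; have pd : disc p (r / 2) p by rewrite /disc /= subrr cabs0; lra.
have [|||||d d0 hd] := @open_mapping (disc p (r / 2)) u p _ _ _ _ pd.
- exact: disc_open.
- exact: disc_bounded.
- by move=> w /closure_disc; rewrite /cdisc /= => h; apply: (@dif_cont _ 1); apply: du; lra.
- by move=> w; rewrite /disc /= => h; apply: du; lra.
- move=> w /closure_disc; rewrite /cdisc /= => h1 h2; apply/eqP/up; first by lra.
  by apply: contra_notN h2 => /eqP ->.
by exists d => // v /hd[w]; rewrite /disc /= => wr uw; exists w => //; lra.
Qed.

End Holomorphic.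

(** * The chordal metric *)

Section Sphere.
Variable R : realType.
Notation C := (Cplx R).
Notation Ch := (sphere R).
Implicit Types (z w v : C) (a b c : Ch).

Definition hyp z : R := Num.sqrt (1 + cabs z ^+ 2).

Lemma hyp_sqr z : hyp z ^+ 2 = 1 + cabs z ^+ 2.
Proof. by rewrite sqr_sqrtr// addr_ge0// sqr_ge0. Qed.
Lemma hyp_gt0 z : 0 < hyp z.
Proof. by rewrite sqrtr_gt0 ltr_pwDl// sqr_ge0. Qed.
Lemma le_sqr (x y : R) : 0 <= y -> x ^+ 2 <= y ^+ 2 -> x <= y.
Proof.
move=> y0 h; have [x0|/ltW x0] := leP x 0; first exact: le_trans y0.
by rewrite -(ler_pXn2r (n := 2)).
Qed.
Lemma hyp_ge1 z : 1 <= hyp z.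
Proof. by apply: le_sqr (ltW (hyp_gt0 z)) _; rewrite hyp_sqr expr1n lerDl sqr_ge0. Qed.
Lemma cabs_hyp z : cabs z <= hyp z.
Proof. by apply: le_sqr (ltW (hyp_gt0 z)) _; rewrite hyp_sqr lerDr. Qed.
Lemma hyp_le z : hyp z <= 1 + cabs z.
Proof.
have := cabs_ge0 z => h; apply: le_sqr; first by rewrite addr_ge0.
by rewrite hyp_sqr sqrrD; lra.
Qed.
Lemma hyp_lip z w : hyp z <= hyp w + cabs (z - w).
Proof.
have h := cabs_ge0 (z - w); have h0 := hyp_gt0 w.
apply: le_sqr; first by rewrite addr_ge0// ltW.
rewrite sqrrD !hyp_sqr.
have : cabs z ^+ 2 <= (cabs (z - w) + cabs w) ^+ 2.
  by rewrite ler_pXn2r ?nnegrE ?addr_ge0 ?cabs_ge0// (le_trans _ (cabsD _ _))// subrK.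
have := ler_wpM2r h (cabs_hyp w); rewrite sqrrD; lra.
Qed.

Definition chord a b : R :=
  match a, b with
  | Some z, Some w => 2 * cabs (z - w) / (hyp z * hyp w)
  | Some z, None | None, Some z => 2 / hyp z
  | None, None => 0
  end.

Lemma sqrtC_ofR (x : R) : 0 <= x -> sqrtC (ofR x) = ofR (Num.sqrt x).
Proof.
move=> x0; apply/eqP; rewrite -(@eqrXn2 _ 2)//.
- by rewrite sqrtCK -[ofR _ ^+ 2]rmorphXn /= sqr_sqrtr.
- by rewrite sqrtC_ge0 -[0]/(ofR 0) leCR.
- by rewrite -[0]/(ofR 0) leCR sqrtr_ge0.
Qed.

Lemma sqrtC_hyp z : sqrtC (1 + `|z| ^+ 2) = ofR (hyp z).
Proof.
rewrite /hyp -sqrtC_ofR; last by rewrite addr_ge0// sqr_ge0.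
by rewrite normE ofRD expr2 -ofRM.
Qed.

Lemma ofR2 : ofR 2 = 2 :> C. Proof. by rewrite /ofR rmorph_nat. Qed.

Lemma chordalE a b : chordal a b = ofR (chord a b).
Proof.
case: a b => [z|] [w|] //=; rewrite ?sqrtC_hyp ?normE.
- by rewrite !ofRM ofRV ofRM ofR2.
- by rewrite ofRM ofRV ofR2.
- by rewrite ofRM ofRV ofR2.
Qed.

Lemma chord_ge0 a b : 0 <= chord a b.
Proof.
by case: a b => [z|] [w|] //=; rewrite ?divr_ge0 ?mulr_ge0 ?cabs_ge0 ?(ltW (hyp_gt0 _)).
Qed.

Lemma chordC a b : chord a b = chord b a.
Proof.
by case: a b => [z|] [w|] //=; rewrite cdistC [hyp z * _]mulrC.
Qed.

Lemma chordxx a : chord a a = 0.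
Proof. by case: a => [z|] //=; rewrite subrr cabs0 mulr0 mul0r. Qed.

Lemma chord0 a b : chord a b = 0 -> a = b.
Proof.
have nz z : 2 / hyp z = 0 -> False.
  by move/eqP; rewrite gt_eqF// divr_gt0// hyp_gt0.
case: a b => [z|] [w|] //=; [|by move/nz|by move/nz].
have hz := hyp_gt0 z; have hw := hyp_gt0 w => /eqP; rewrite mulf_eq0 invr_eq0.
rewrite [X in _ || X]gt_eqF ?mulr_gt0// orbF mulf_eq0 [X in X || _]gt_eqF// orFb.
by rewrite cabs_eq0 subr_eq0 => /eqP ->.
Qed.

Lemma conj_facts v : exists v', cabs v' = cabs v /\ v' * v = ofR (cabs v ^+ 2).
Proof.
case: v => x y; exists (ofRI x (- y)); split; first by rewrite /cabs /= sqrrN.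
rewrite cabs_sqr; apply/eqP; rewrite eq_complex /=; apply/andP; split; apply/eqP; ring.
Qed.

(* Multiplying [(z - w) * (1 + v^* v) = (z - v) * (1 + v^* w) + (v - w) * (1 + v^* z)]
   out and using Cauchy-Schwarz for the two factors [1 + v^* _]. *)
Lemma chord_tri_fin z v w :
  cabs (z - w) * hyp v <= cabs (z - v) * hyp w + cabs (v - w) * hyp z.
Proof.
have [v' [e1 e2]] := conj_facts v.
have cs x : cabs (1 + v' * x) <= hyp v * hyp x.
  have h0 : 0 <= hyp v * hyp x by rewrite mulr_ge0// ltW// hyp_gt0.
  apply: le_trans (cabsD _ _) _; rewrite cabs1 cabsM e1; apply: le_sqr => //.
  rewrite exprMn !hyp_sqr.
  by have := sqr_ge0 (cabs v - cabs x); rewrite sqrrB sqrrD exprMn; lra.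
have id : (z - w) * ofR (hyp v ^+ 2) = (z - v) * (1 + v' * w) + (v - w) * (1 + v' * z).
  have o1 : ofR (1 : R) = 1 :> C by exact: rmorph1.
  by rewrite hyp_sqr ofRD -e2 o1; ring.
have := cabsD ((z - v) * (1 + v' * w)) ((v - w) * (1 + v' * z)).
rewrite -id !cabsM cabs_ofR ger0_norm ?sqr_ge0// => h.
have h1 := ler_wpM2l (cabs_ge0 (z - v)) (cs w).
have h2 := ler_wpM2l (cabs_ge0 (v - w)) (cs z).
rewrite -(ler_pM2r (hyp_gt0 v)); move: h h1 h2; rewrite expr2; lra.
Qed.

Lemma chord_tri b a c : chord a c <= chord a b + chord b c.
Proof.
have hd x : hyp x != 0 by rewrite gt_eqF ?hyp_gt0.
case: a b c => [z|] [v|] [w|] //=; rewrite ?addr0 ?add0r//.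
- have h0 : 0 < hyp z * hyp v * hyp w by rewrite !mulr_gt0 ?hyp_gt0.
  rewrite -(ler_pM2r h0).
  have -> : 2 * cabs (z - w) / (hyp z * hyp w) * (hyp z * hyp v * hyp w)
    = 2 * (cabs (z - w) * hyp v) by field; rewrite !hd.
  have -> : (2 * cabs (z - v) / (hyp z * hyp v) + 2 * cabs (v - w) / (hyp v * hyp w))
     * (hyp z * hyp v * hyp w)
    = 2 * (cabs (z - v) * hyp w + cabs (v - w) * hyp z) by field; rewrite !hd.
  by rewrite ler_pM2l// chord_tri_fin.
- have h0 : 0 < hyp z * hyp v by rewrite !mulr_gt0 ?hyp_gt0.
  rewrite -(ler_pM2r h0).
  have -> : 2 / hyp z * (hyp z * hyp v) = 2 * hyp v by field; rewrite !hd.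
  have -> : (2 * cabs (z - v) / (hyp z * hyp v) + 2 / hyp v) * (hyp z * hyp v)
     = 2 * (hyp z + cabs (v - z)) by rewrite cdistC; field; rewrite !hd.
  by rewrite ler_pM2l// hyp_lip.
- have h0 : 0 < hyp z * hyp w by rewrite !mulr_gt0 ?hyp_gt0.
  rewrite -(ler_pM2r h0).
  have -> : 2 * cabs (z - w) / (hyp z * hyp w) * (hyp z * hyp w) = 2 * cabs (z - w).
    by field; rewrite !hd.
  have -> : (2 / hyp z + 2 / hyp w) * (hyp z * hyp w) = 2 * (hyp z + hyp w).
    by field; rewrite !hd.
  rewrite ler_pM2l// (le_trans (cabsB _ _))// lerD// cabs_hyp//.
- have h0 : 0 < hyp v * hyp w by rewrite !mulr_gt0 ?hyp_gt0.
  rewrite -(ler_pM2r h0).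
  have -> : 2 / hyp w * (hyp v * hyp w) = 2 * hyp v by field; rewrite !hd.
  have -> : (2 / hyp v + 2 * cabs (v - w) / (hyp v * hyp w)) * (hyp v * hyp w)
     = 2 * (hyp w + cabs (v - w)) by field; rewrite !hd.
  by rewrite ler_pM2l// hyp_lip.
- by rewrite addr_ge0// divr_ge0// ltW// hyp_gt0.
Qed.

Lemma chord_le z w : chord (Some z) (Some w) <= 2 * cabs (z - w).
Proof.
rewrite /= ler_pdivrMr ?mulr_gt0 ?hyp_gt0// ler_peMr ?mulr_ge0 ?cabs_ge0//.
by have := ler_pM ler01 ler01 (hyp_ge1 z) (hyp_ge1 w); rewrite mulr1.
Qed.

Lemma chord_near_unif (h r : R) : 0 < h -> 0 < r -> exists2 e : R, 0 < e &
  forall z b, hyp z <= h -> chord (Some z) b < e -> exists2 w, b = Some w & cabs (w - z) < r.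
Proof.
(* The bound [h^-1] excludes infinity and forces [hyp w < 2 * h]; given that, [r / h ^+ 2] turns
   chordal into Euclidean closeness. *)
move=> h0 r0; exists (Num.min h^-1 (r / h ^+ 2)).
  by rewrite lt_min invr_gt0 h0 divr_gt0// exprn_gt0.
move=> z b zh; have hz0 := hyp_gt0 z.
case: b => [w|]; rewrite lt_min => /andP[h1 h2]; last first.
  have : hyp z < h.
    move: h1; rewrite /= ltr_pdivrMr// mulrC ltr_pdivlMr//; lra.
  move: h1; rewrite /= ltr_pdivrMr// mulrC ltr_pdivlMr//; lra.
exists w => //; move: h1 h2; rewrite /=.
have hw := hyp_lip w z; have hw0 := hyp_gt0 w.
set d := cabs (w - z) in hw *.
have -> : 2 * cabs (z - w) / (hyp z * hyp w) = 2 * d / (hyp z * hyp w) by rewrite cdistC.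
rewrite !ltr_pdivrMr ?mulr_gt0// [h^-1 * _]mulrC ltr_pdivlMr//.
rewrite [r / _ * _]mulrAC ltr_pdivlMr ?exprn_gt0// => k1 k2.
have d0 : 0 <= d := cabs_ge0 _.
have k3 : 2 * d < hyp w.
  rewrite -(ltr_pM2r h0); apply: lt_le_trans k1 _.
  by rewrite mulrC ler_wpM2l// ltW.
have k4 : 2 * d * h ^+ 2 < r * (h * (2 * h)).
  apply: lt_le_trans k2 _; apply: ler_wpM2l; first exact: ltW.
  by apply: ler_pM; rewrite ?(ltW hz0) ?(ltW hw0)//; lra.
have h20 : 0 < h ^+ 2 by rewrite exprn_gt0.
rewrite -(ltr_pM2r h20); move: k4; rewrite expr2; lra.
Qed.

Lemma chord_near z (r : R) : 0 < r -> exists2 e : R, 0 < e &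
  forall b, chord (Some z) b < e -> exists2 w, b = Some w & cabs (w - z) < r.
Proof.
move=> r0; have [e e0 he] := chord_near_unif (hyp_gt0 z) r0.
by exists e => // b; exact: he.
Qed.

(** Links the topology of the compactification, in which the Fatou set and its components are
    defined, to the chordal metric, in which normality is measured. *)
Lemma nbhsSP a (A : set Ch) : nbhs a A <->
  exists2 e : R, 0 < e & forall b, chord a b < e -> A b.
Proof.
case: a => [z|]; split.
- move=> /nbhsCP[r r0 h]; have [e e0 he] := chord_near z r0.
  by exists e => // b /he[w -> wz]; apply: h.
- move=> [e e0 h]; apply/nbhsCP; exists (e / 2); first by rewrite divr_gt0.
  move=> w wz; apply: h; apply: le_lt_trans (chord_le _ _) _; rewrite cdistC; lra.
- move=> [K [cK _] KA]; have [M hM] := compactCb cK.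
  exists (2 / (1 + `|M|)); first by rewrite divr_gt0// ltr_pwDl.
  case=> [w|_] /=; last by apply: KA; right.
  rewrite ltr_pM2l// ltf_pV2 ?posrE ?hyp_gt0 ?ltr_pwDl// => h.
  apply: KA; left; exists w => // Kw; have := hM w Kw; have := hyp_le w.
  by have := ler_norm M; lra.
- move=> [e e0 h]; exists (cdisc 0 (2 / e)).
    split; last exact: cdisc_closed.
    apply: compactC; last exact: cdisc_closed.
    by exists (2 / e) => z; rewrite /cdisc /= subr0.
  move=> b [[w hw <-]|->]; apply: h => //=.
  rewrite ltr_pdivrMr ?hyp_gt0// mulrC -ltr_pdivrMr//.
  apply: lt_le_trans (cabs_hyp _).
  by move: hw; rewrite /cdisc /= subr0 => /negP; rewrite -ltNge.
Qed.

Lemma hausdorffS : hausdorff_space Ch.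
Proof.
move=> a b ab; apply: chord0; apply/eqP; rewrite eq_le chord_ge0 andbT leNgt.
apply/negP => h; have h2 : 0 < chord a b / 2 by rewrite divr_gt0.
have [||c [/= c1 c2]] := ab [set c | chord a c < chord a b / 2] [set c | chord b c < chord a b / 2].
- by apply/nbhsSP; exists (chord a b / 2).
- by apply/nbhsSP; exists (chord a b / 2).
- by have := chord_tri c a b; rewrite [chord c b]chordC; lra.
Qed.

Lemma compactS : compact [set: Ch].
Proof. exact: one_point_compactification_compact. Qed.

Lemma closed_compactS (A : set Ch) : closed A -> compact A.
Proof. by move=> cA; apply: subclosed_compact cA compactS _. Qed.

Lemma compact_closedS (A : set Ch) : compact A -> closed A.
Proof. exact: compact_closed hausdorffS. Qed.

End Sphere.

(** * Clopen splittings of totally disconnected compact sets *)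

Section ZeroDimensional.
Variables (R : realType) (T : topologicalType).
Hypothesis hT : hausdorff_space T.
Hypothesis cT : compact [set: T].
Implicit Types (K P Q D : set T).

Lemma compact_directed (DD : set (set T)) K (O : set T) : compact K -> open O ->
  DD !=set0 -> (forall D, DD D -> closed D) ->
  (forall D E, DD D -> DD E -> exists2 F, DD F & F `<=` D `&` E) ->
  (forall x, K x -> (forall D, DD D -> D x) -> O x) ->
  exists2 D, DD D & D `&` K `<=` O.
Proof.
move=> cK oO [D0 DD0] cD dir KO; apply: contrapT => no.
pose B D := D `&` K `&` ~` O.
have FF : ProperFilter (filter_from DD B).
  apply: filter_from_proper.
    apply: filter_from_filter; first by exists D0.
    move=> D E /dir{}dir /dir[F DF FDE]; exists F => // x [[Fx Kx] Ox].
    by have [Dx Ex] := FDE x Fx.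
  move=> D DDD; apply: contrapT => nB; apply: no; exists D => // x [Dx Kx].
  by apply: contrapT => Ox; apply: nB; exists x.
have [|p [Kp cp]] := cK _ FF; first by exists D0 => // x [[]].
have Op : O p.
  apply: KO => // D DDD; apply: (cD D DDD) => W Wp.
  have [|x [[[Dx _] _] Wx]] := cp (B D) W _ Wp; first by exists D.
  by exists x.
have [|x [[_ nOx] Ox]] := cp (B D0) O _ (open_nbhs_nbhs (conj oO Op)); first by exists D0.
exact: nOx.
Qed.

Definition relclopen K D := [/\ D `<=` K, closed D & closed (K `\` D)].

Lemma relclopenI K D E : relclopen K D -> relclopen K E -> relclopen K (D `&` E).
Proof.
move=> [DK cD cKD] [EK cE cKE]; split; first by move=> x [/DK].
  exact: closedI.
rewrite setDIr; exact: closedU.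
Qed.

Lemma relclopenU K D E : relclopen K D -> relclopen K E -> relclopen K (D `|` E).
Proof.
move=> [DK cD cKD] [EK cE cKE]; split; first by move=> x [/DK|/EK].
  exact: closedU.
by rewrite setDUr; exact: closedI.
Qed.

(* In a compact Hausdorff space the quasi-component [Q] of a point is connected. *)
Lemma quasi_component K x : compact K -> totally_disconnected K -> K x ->
  forall y, (forall D, relclopen K D -> D x -> D y) -> y = x.
Proof.
move=> cK tK Kx y Qy.
have clK : closed K by exact: compact_closed.
pose Q := [set z | K z /\ forall D, relclopen K D -> D x -> D z].
have rK : relclopen K K by split => //; rewrite setDv; exact: closed0.
have Qx : Q x by [].
suff cQ : connected Q.
  have : Q `<=` [set x].
    by rewrite -(tK x Kx); apply: connected_component_max => // z [].
  by apply; split; [exact: Qy Kx|exact: Qy].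
have clQ : closed Q.
  move=> z clz; split.
    by apply: clK => W /clz[w [[Kw _] Ww]]; exists w.
  move=> D rD Dx; have [_ cD _] := rD; apply: cD => W /clz[w [[Kw h] Ww]].
  by exists w; split => //; exact: h.
apply/connectedP => E [E0 QE [s1 s2]].
have clE b : closed (E b).
  move=> z clz; have : Q z.
    apply: clQ => W /clz[w [Ew Ww]]; exists w; split => //; rewrite QE.
    by case: b Ew {clz} => Ew; [right|left].
  rewrite QE => -[Ez|Ez]; case: b clz => // clz.
  - by have : (E false `&` closure (E true)) z by []; rewrite s2.
  - by have : (closure (E false) `&` E true) z by []; rewrite s1.
have disj : E true `&` E false = set0.
  by rewrite -s1 setIC; congr (_ `&` _); rewrite -(closure_id _).1.
wlog Ex : E E0 QE {s1 s2} clE disj / E true x => [H|].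
  have : Q x by []; rewrite {1}QE => -[Ex|Ex]; last exact: (H E).
  by apply: (H (fun b => E (~~ b))) => //=; [rewrite setUC|rewrite setIC].
have cE b : compact (E b).
  apply: (subclosed_compact (clE b) cK) => z Ez; have : Q z; last by case.
  by rewrite QE; case: b Ez => Ez; [right|left].
have [U0 [U1 [oU0 oU1 EU0 EU1 U01]]] : exists U0 U1 : set T, [/\ open U0, open U1,
    E false `<=` U0, E true `<=` U1 & U0 `&` U1 = set0].
  apply: (@normal_openP R T).1; [exact: compact_normal|exact: clE|exact: clE|].
  by rewrite setIC.
pose DX := [set D | relclopen K D /\ D x].
have [|||||D [rD Dx] DU] := @compact_directed DX K (U0 `|` U1) cK.
- exact: openU.
- by exists K.
- by move=> D [[]].
- move=> D F [rD Dx] [rF Fx]; exists (D `&` F) => //; split => //.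
  exact: relclopenI.
- move=> z Kz hz; have : Q z by split => // D rD Dx; apply: hz.
  by rewrite QE => -[/EU0|/EU1]; [left|right].
have [DK cD cKD] := rD.
(* As [D] lies in the union of the disjoint open sets [U0] and [U1], meeting [U1] amounts to
   avoiding [U0]. The piece is therefore relatively clopen; it contains [x] and misses [E false]. *)
have DU1 : D `&` U1 = D `\` U0.
  rewrite eqEsubset; split=> z [Dz].
    by move=> U1z; split => // U0z; have : (U0 `&` U1) z by []; rewrite U01.
  by move=> nU0; split => //; have [] := DU z (conj Dz (DK _ Dz)).
have rD1 : relclopen K (D `&` U1).
  split; first by move=> z [/DK].
    by rewrite DU1 setDE; apply: closedI => //; exact: open_closedC.
  have -> : K `\` (D `&` U1) = (K `\` D) `|` (D `\` U1).
    rewrite eqEsubset; split=> z.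
      move=> [Kz nz]; have [Dz|Dz] := pselect (D z); [right|left] => //.
      by split => // U1z; apply: nz.
    move=> [[Kz nD]|[Dz nU]]; first by split => // -[].
    by split; [exact: DK|case].
  by apply: closedU => //; rewrite setDE; apply: closedI => //; exact: open_closedC.
have [z Ez] := E0 false.
have [_ /(_ _ rD1)[]] : Q z by rewrite QE; left.
  by split => //; exact: EU1.
move=> _ U1z; have : (U0 `&` U1) z by split => //; exact: EU0.
by rewrite U01.
Qed.

(** By [quasi_component] and compactness each point of [K] in [P] has a relatively clopen
    neighbourhood disjoint from [Q]. Such sets are closed under unions, so a second use of
    compactness finds one that contains all these points. *)
Lemma clopen_separation K P Q : compact K -> totally_disconnected K ->
  closed P -> closed Q -> K `&` P `&` Q = set0 ->
  exists A B, [/\ closed A, closed B, A `|` B = K, A `&` B = set0 &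
    K `&` P `<=` A /\ K `&` Q `<=` B].
Proof.
move=> cK tK cP cQ PQ; have clK : closed K by exact: compact_closed.
pose DD := [set E | exists2 D, relclopen K D /\ D `&` Q = set0 & E = K `\` D].
have r0 : relclopen K set0.
  by split; [exact: sub0set|exact: closed0|rewrite setD0].
have [||||||_ [D [rD DQ] ->] h] := @compact_directed DD (K `&` P) set0.
- by apply: compact_closedI.
- exact: open0.
- by exists (K `\` set0); exists set0 => //; split => //; rewrite set0I.
- by move=> _ [D [[_ _ +] _] ->].
- move=> _ _ [D [rD DQ] ->] [E [rE EQ] ->]; exists (K `\` (D `|` E)).
    by exists (D `|` E) => //; split; [exact: relclopenU|rewrite setIUl DQ EQ setU0].
  by rewrite setDUr.
- move=> x [Kx Px] h.
  pose DX := [set D | relclopen K D /\ D x].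
  have [|||||D [rD Dx] DQ] := @compact_directed DX K (~` Q) cK.
  + exact: closed_openC.
  + exists K; split => //; split => //; rewrite setDv; exact: closed0.
  + by move=> D [[]].
  + move=> D E [rD Dx] [rE Ex]; exists (D `&` E) => //; split => //.
    exact: relclopenI.
  + move=> y Ky hy Qy; have yx : y = x.
      by apply: (quasi_component cK tK Kx) => D rD Dx; apply: hy.
    have : (K `&` P `&` Q) x by split; [split|rewrite -yx].
    by rewrite PQ.
  have [|_] := h (K `\` D); last by [].
  exists D => //; split => //; rewrite -subset0 => y [Dy Qy].
  by have [DK _ _] := rD; apply: (DQ y) => //; split => //; exact: DK.
exists D, (K `\` D); have [DK cD cKD] := rD; split => //.
- by rewrite setDE setUIr setUv setIT; apply/setUidPr.
- by rewrite setDE setICA setICr setI0.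
- split=> x [Kx hx]; first by apply: contrapT => nD; exact: (h x).
  by split=> // Dx; have : (D `&` Q) x by []; rewrite DQ.
Qed.

End ZeroDimensional.

(** * Planar separation *)

Section Sperner.

(* Counts edges coloured 0-1, with the sign given by their orientation. *)
Definition flip (a b : nat) : int :=
  ((a == 0%N) && (b == 1%N))%:Z - ((a == 1%N) && (b == 0%N))%:Z.

Lemma flip_sym a b : flip a b = - flip b a.
Proof. by rewrite /flip opprB andbC [(b == 0%N) && _]andbC. Qed.

(** The colour [x] is missing on the triangle; with only two colours left, a closed walk crosses
    from 0 to 1 as often as back. *)
Lemma flip_tri a b d x : (a <= 2)%N -> (b <= 2)%N -> (d <= 2)%N -> (x <= 2)%N ->
  x != a -> x != b -> x != d -> flip a b + flip b d + flip d a = 0.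
Proof.
by move: a b d x => [|[|[|//]]] [|[|[|//]]] [|[|[|//]]] [|[|[|//]]].
Qed.

(* The signed number of 0-1 edges in a row of the grid does not depend on the row;
   it is [0] in the bottom row and [1] in the top row. *)
Lemma grid_coloring (n : nat) (c : nat -> nat -> nat) :
  (forall i j, (i < n)%N -> (j < n)%N ->
     flip (c i j) (c i.+1 j) + flip (c i.+1 j) (c i.+1 j.+1) + flip (c i.+1 j.+1) (c i j) = 0) ->
  (forall i j, (i < n)%N -> (j < n)%N ->
     flip (c i j) (c i.+1 j.+1) + flip (c i.+1 j.+1) (c i j.+1) + flip (c i j.+1) (c i j) = 0) ->
  (forall j, c 0%N j != 0%N) -> (forall j, c n j != 1%N) ->
  (forall i, c i 0%N = 2%N) -> (forall i, (i <= n)%N -> (c i n <= 1)%N) -> False.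
Proof.
move=> T1 T2 left right bot top.
pose S j : int := \sum_(i < n) flip (c i j) (c i.+1 j).
have SS j : (j < n)%N -> S j.+1 = S j.
  move=> jn; apply/eqP; rewrite -subr_eq0 -sumrB.
  have -> : \sum_(i < n) (flip (c i j.+1) (c i.+1 j.+1) - flip (c i j) (c i.+1 j))
      = \sum_(i < n) (flip (c i.+1 j) (c i.+1 j.+1) - flip (c i j) (c i j.+1)).
    apply: eq_bigr => i _; have := T1 i j (ltn_ord i) jn; have := T2 i j (ltn_ord i) jn.
    rewrite (flip_sym (c i.+1 j.+1) (c i j)) (flip_sym (c i.+1 j.+1) (c i j.+1)).
    rewrite (flip_sym (c i j.+1) (c i j)); lia.
  rewrite -(big_mkord xpredT (fun i => flip (c i.+1 j) (c i.+1 j.+1) - flip (c i j) (c i j.+1))).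
  rewrite telescope_sumr//.
  have -> : flip (c n j) (c n j.+1) = 0 by rewrite /flip !(negbTE (right _)) andbF.
  by rewrite /flip !(negbTE (left _)) andbF subrr.
have Sn : S n = 0.
  have -> : S n = S 0%N.
    have : (n <= n)%N by []; elim: {1 3}n => // m IH mn.
    by rewrite SS// IH// ltnW.
  by rewrite /S big1// => i _; rewrite /flip !bot.
have := Sn; rewrite /S.
have -> : \sum_(i < n) flip (c i n) (c i.+1 n)
     = \sum_(i < n) ((c i.+1 n)%:Z - (c i n)%:Z).
  apply: eq_bigr => i _; have := top i (ltnW (ltn_ord i)); have := top i.+1 (ltn_ord i).
  by case: (c i n) => [|[|]]//; case: (c i.+1 n) => [|[|]].
rewrite -(big_mkord xpredT (fun i => (c i.+1 n)%:Z - (c i n)%:Z)) telescope_sumr//.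
have := top n (leqnn n); have := right n; have := left n; have := top 0%N (leq0n n).
by case: (c n n) => [|[|]]//; case: (c 0%N n) => [|[|]].
Qed.

End Sperner.

Section Separation.
Variable R : realType.
Notation C := (Cplx R).
Notation Ch := (sphere R).
Implicit Types (z w v : C) (a b c : Ch).

Definition segment z w : set C := [set z + ofR t * (w - z) | t in `[0, 1]%classic].

Lemma segment_cont (z w : C) : continuous (fun t : R => (z + ofR t * (w - z) : C)).
Proof.
move=> t A /nbhsCP[r r0 hA].
have h0 : 0 < cabs (w - z) + 1 by rewrite ltr_wpDl// cabs_ge0.
exists (r / (cabs (w - z) + 1)); first by rewrite /= divr_gt0.
move=> s /=; rewrite /ball /= distrC ltr_pdivlMr// => h; apply: hA.
have -> : z + ofR s * (w - z) - (z + ofR t * (w - z)) = ofR (s - t) * (w - z).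
  by rewrite ofRB; ring.
rewrite cabsM cabs_ofR; apply: le_lt_trans h.
by apply: ler_wpM2l => //; rewrite lerDl.
Qed.

Lemma csegment_connected z w : connected (segment z w).
Proof.
apply: connected_continuous_connected; first exact: segment_connected.
exact/continuous_subspaceT/segment_cont.
Qed.

Lemma segmentl z w : segment z w z.
Proof. by exists 0; rewrite ?mul0r ?addr0//= in_itv /= lexx ler01. Qed.
Lemma segmentr z w : segment z w w.
Proof.
exists 1; first by rewrite /= in_itv /= lexx ler01.
by rewrite [ofR 1]rmorph1 mul1r addrC subrK.
Qed.
Lemma segment_dist z w v : segment z w v -> cabs (v - z) <= cabs (w - z).
Proof.
move=> [t]; rewrite /= in_itv /= => /andP[t0 t1] <-.
by rewrite addrAC subrr add0r cabsM cabs_ofR ger0_norm// ler_piMl// cabs_ge0.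
Qed.

Lemma segment_boundary (V : set C) z w : open V -> V z -> ~ V w ->
  exists k, [/\ closure V k, ~ V k & cabs (k - z) <= cabs (w - z)].
Proof.
move=> oV Vz nVw; apply: contrapT => no; apply: nVw.
suff : segment z w `&` V = segment z w.
  by move=> e; have := segmentr z w; rewrite -{1}e => -[].
apply: (@csegment_connected z w).
- by exists z; split => //; exact: segmentl.
- by exists V.
- exists (closure V); first exact: closed_closure.
  rewrite eqEsubset; split=> v [sv Vv]; split => //; first exact: subset_closure.
  by apply: contrapT => nV; apply: no; exists v; split => //; exact: segment_dist.
Qed.

Lemma dist_pos (A L : set C) : compact A -> closed L -> A `&` L = set0 ->
  exists2 d : R, 0 < d & forall z w, A z -> L w -> d <= cabs (z - w).
Proof.
move=> cA cL AL.
move: cA => /compact_near_coveringP/(_ R (0 : R)^'+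
  (fun d z => forall w, L w -> d <= cabs (z - w))) H.
have [z Az|d [d0 /= hd]] := H _.
  have nL : ~ L z by move=> Lz; have : (A `&` L) z by []; rewrite AL.
  have [r r0 hr] := (openCP (~` L)).1 (closed_openC cL) z nL.
  exists (disc z (r / 2), [set d | d < r / 2]); first split => /=.
  - by apply: nbhs_disc; rewrite divr_gt0.
  - by apply: nbhs_right_lt; rewrite divr_gt0.
  move=> [v d]; rewrite /disc /= => -[vz dr] w Lw; rewrite leNgt; apply/negP => vw.
  by apply: (hr w) => //; have := cdist_tri v w z; rewrite [cabs (w - v)]cdistC; lra.
have {}d0 : 0 < d := d0.
exists (d / 2); first by rewrite divr_gt0.
move=> z w Az Lw; apply: (hd (d / 2)) => //; last by rewrite divr_gt0.
rewrite /ball /= sub0r normrN gtr0_norm ?divr_gt0//; lra.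
Qed.

(* Colour the points of [V] by 1 near [B] and 0 elsewhere, and those outside [V] by 2
   below the horizontal line through [y], and by 0 or 1 above it, to the right or to
   the left of [y]. The triangles of a fine grid never carry three colours. *)
Lemma planar_separation (V A B : set C) (y : C) : open V -> Cbounded V -> V y ->
  compact A -> compact B -> A `&` B = set0 ->
  (forall z, closure V z -> ~ V z -> A z \/ B z) ->
  (forall z, A z -> im z = im y -> re y < re z) ->
  (forall z, B z -> im z = im y -> re z < re y) -> False.
Proof.
move=> oV [N hN] Vy cA cB AB VAB hA hB.
pose L := [set z : C | im z = im y /\ re z <= re y].
pose Rt := [set z : C | im z = im y /\ re y <= re z].
have cl0 (x : R) : (forall e : R, 0 < e -> `|x| < e) -> x = 0.
  move=> h; apply/eqP; rewrite -normr_eq0 eq_le normr_ge0 andbT leNgt.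
  by apply/negP => /h; rewrite ltxx.
have clL : closed L.
  move=> z /closure_CP cz; split.
    apply/eqP; rewrite -subr_eq0; apply/eqP/cl0 => e /cz[w [w1 w2] wz].
    by rewrite -w1 -imB cdistC in wz *; apply: le_lt_trans (im_le _) wz.
  rewrite leNgt; apply/negP => h; have [|w [w1 w2]] := cz (re z - re y); first by lra.
  by have := re_le (w - z); rewrite reB ler_norml => /andP[? ?]; lra.
have clR : closed Rt.
  move=> z /closure_CP cz; split.
    apply/eqP; rewrite -subr_eq0; apply/eqP/cl0 => e /cz[w [w1 w2] wz].
    by rewrite -w1 -imB cdistC in wz *; apply: le_lt_trans (im_le _) wz.
  rewrite leNgt; apply/negP => h; have [|w [w1 w2]] := cz (re y - re z); first by lra.
  by have := re_le (w - z); rewrite reB ler_norml => /andP[? ?]; lra.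
have [d1 d10 h1] : exists2 d : R, 0 < d & forall z w, A z -> L w -> d <= cabs (z - w).
  apply: dist_pos => //; rewrite -subset0 => z [Az [e1 e2]].
  by have := hA z Az e1; rewrite ltNge e2.
have [d2 d20 h2] : exists2 d : R, 0 < d & forall z w, B z -> Rt w -> d <= cabs (z - w).
  apply: dist_pos => //; rewrite -subset0 => z [Bz [e1 e2]].
  by have := hB z Bz e1; rewrite ltNge e2.
have [d3 d30 h3] := dist_pos cA (compactCc cB) AB.
have [d4 d40 h4] := (openCP V).1 oV y Vy.
(* Half the clearance between [A] and [B]: points of [V] within [2 * ep] of [B] get colour 1, those
   within [2 * ep] of [A] get colour 0. *)
pose eta := d3 / 2.
(* Small against four clearances: [A] from the left ray [L], [B] from the right ray [Rt], [A] from
   [B], and [y] from the complement of [V]. *)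
pose ep := Num.min (Num.min d1 d2) (Num.min d3 d4) / 8.
have ep0 : 0 < ep by rewrite divr_gt0// !min_gt0.
have [ep1 ep2 ep3 ep4] : [/\ 8 * ep <= d1, 8 * ep <= d2, 8 * ep <= d3 & 8 * ep <= d4].
  have -> : 8 * ep = Num.min (Num.min d1 d2) (Num.min d3 d4) by rewrite /ep; field.
  by rewrite !ge_min !lexx ?orbT.
clearbody ep.
pose S z : nat := if im z < im y then 2%N else if re y <= re z then 0%N else 1%N.
have S0 z : S z = 0%N -> im y <= im z /\ re y <= re z.
  by rewrite /S; case: (ltP (im z) (im y)) => //; case: (leP (re y) (re z)).
have S1 z : S z = 1%N -> im y <= im z /\ re z < re y.
  by rewrite /S; case: (ltP (im z) (im y)) => //; case: (leP (re y) (re z)).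
have S2 z : S z = 2%N -> im z < im y.
  by rewrite /S; case: (ltP (im z) (im y)) => //; case: (leP (re y) (re z)).
have S2' z : S z != 2%N -> im y <= im z.
  by rewrite /S; case: (ltP (im z) (im y)).
pose col z : nat := if pselect (V z) then
   (if pselect (exists2 b, B b & cabs (z - b) < eta) then 1%N else 0%N) else S z.
have col2 z : (col z <= 2)%N.
  by rewrite /col /S; do 2 case: pselect => ? //; case: ifP => // _; case: ifP.
have colS z : ~ V z -> col z = S z by rewrite /col; case: pselect.
have small z1 z2 z3 : cabs (z1 - z2) <= ep -> cabs (z2 - z3) <= ep -> cabs (z1 - z3) <= ep ->
  flip (col z1) (col z2) + flip (col z2) (col z3) + flip (col z3) (col z1) = 0.
  move=> e12 e23 e13.
  pose T := [set z | z = z1 \/ z = z2 \/ z = z3].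
  have dT z w : T z -> T w -> cabs (z - w) <= ep.
    by move=> [->|[->|->]] [->|[->|->]]; rewrite ?subrr ?cabs0 ?(ltW ep0)// cdistC.
  suff [x x2 hx] : exists2 x, (x <= 2)%N & forall z, T z -> x != col z.
    apply: (@flip_tri _ _ _ x) => //; apply: hx; rewrite /T /=; tauto.
  have [[z Tz Vz]|nV] := pselect (exists2 z, T z & V z); last first.
    (* The three colours of [S] meet only near [y], and a disc about [y] lies in [V]. *)
    apply: contrapT => no.
    have ex x : (x <= 2)%N -> exists2 z, T z & S z = x.
      move=> x2; apply: contrapT => nx; apply: no; exists x => // z Tz.
      rewrite colS; last by move=> Vz; apply: nV; exists z.
      by apply/eqP => e; apply: nx; exists z.
    have [p0 T0 c0] := ex 0%N isT; have [p1 T1 c1] := ex 1%N isT.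
    have [p2 T2 c2] := ex 2%N isT.
    apply: nV; exists p0 => //; apply: h4.
    apply: le_lt_trans (cabs_le _) _; rewrite reB imB.
    have := dT _ _ T0 T1; have := dT _ _ T0 T2.
    have [i0 r0] := S0 _ c0; have [i1 r1] := S1 _ c1; have i2 := S2 _ c2.
    have := im_le (p0 - p2); have := re_le (p0 - p1); rewrite reB imB.
    rewrite !ger0_norm; lra.
  have [allV|nV] := pselect (forall w, T w -> V w).
    exists 2%N => // w /allV Vw; rewrite /col; case: pselect => // ?.
    by case: pselect.
  have [w Tw nVw] : exists2 w, T w & ~ V w.
    by apply: contrapT => no; apply: nV => w Tw; apply: contrapT => h; apply: no; exists w.
  (* A triangle with vertices on both sides is within [2 * ep] of a boundary point [k]. If [k] is in
     [A], its vertices in [V] have colour 0, and colours 1 and 2 outside [V] can only occur together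
     near the left ray, which is far from [A]; symmetrically for [B]. *)
  have [k [ck nVk kz]] := segment_boundary oV Vz nVw.
  have kT v : T v -> cabs (v - k) <= 2 * ep.
    move=> Tv; have := cdist_tri z v k; rewrite [cabs (z - k)]cdistC.
    by have := dT _ _ Tv Tz; have := dT _ _ Tw Tz; lra.
  have imT p q : T p -> T q -> S p != 2%N -> S q = 2%N ->
      [/\ cabs (p - ofRI (re p) (im y)) <= ep & im y <= im p].
    move=> Tp Tq /S2' ip /S2 iq.
    split => //; apply: le_trans (cabs_le _) _; rewrite reB imB /= subrr normr0 add0r.
    have := dT _ _ Tp Tq; have := im_le (p - q); rewrite imB !ger0_norm; lra.
  have [Ak|Bk] := VAB k ck nVk.
    have colV v : T v -> V v -> col v = 0%N.
      move=> Tv Vv; rewrite /col; case: pselect => // ?; case: pselect => // h.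
      exfalso; case: h => b Bb vb.
      have := h3 k b Ak Bb; have := cdist_tri v k b; have := kT v Tv.
      by rewrite [cabs (k - v)]cdistC; move: vb; rewrite /eta; lra.
    have [[q Tq q2]|no2] := pselect (exists2 q, T q & S q = 2%N); last first.
      exists 2%N => // v Tv; have [Vv|nVv] := pselect (V v); first by rewrite colV.
      by rewrite colS//; apply/eqP => e; apply: no2; exists v.
    exists 1%N => // v Tv; have [Vv|nVv] := pselect (V v); first by rewrite colV.
    rewrite colS//; apply/eqP => e.
    have [p1 p2] := imT v q Tv Tq ltac:(by rewrite -e) q2.
    have Lv : L (ofRI (re v) (im y)).
      by split => //=; have [_ /ltW] := S1 _ (esym e).
    have := h1 k _ Ak Lv; have := cdist_tri v k (ofRI (re v) (im y)).
    by have := kT v Tv; rewrite [cabs (k - v)]cdistC; lra.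
  have colV v : T v -> V v -> col v = 1%N.
    move=> Tv Vv; rewrite /col; case: pselect => // ?; case: pselect => // nb.
    exfalso; apply: nb; exists k => //; have := kT v Tv; rewrite /eta; lra.
  have [[q Tq q2]|no2] := pselect (exists2 q, T q & S q = 2%N); last first.
    exists 2%N => // v Tv; have [Vv|nVv] := pselect (V v); first by rewrite colV.
    by rewrite colS//; apply/eqP => e; apply: no2; exists v.
  exists 0%N => // v Tv; have [Vv|nVv] := pselect (V v); first by rewrite colV.
  rewrite colS//; apply/eqP => e.
  have [p1 p2] := imT v q Tv Tq ltac:(by rewrite -e) q2.
  have Rv : Rt (ofRI (re v) (im y)).
    by split => //=; have [] := S0 _ (esym e).
  have := h2 k _ Bk Rv; have := cdist_tri v k (ofRI (re v) (im y)).
  by have := kT v Tv; rewrite [cabs (k - v)]cdistC; lra.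
pose M := `|N| + cabs y + 1.
have M0 : 0 < M by rewrite ltr_wpDl// addr_ge0// cabs_ge0.
have far z : M <= cabs (z - y) -> ~ V z.
  move=> h /hN h'; have := cabsB z y; have := ler_norm N; rewrite /M in h; lra.
pose n := (Num.bound (2 * M / ep)).+1.
have hn : 2 * M / ep < n%:R.
  have := @archi_boundP R (2 * M / ep) ltac:(by rewrite divr_ge0 ?mulr_ge0 ?(ltW M0) ?(ltW ep0)).
  by rewrite /n -natr1; lra.
have n0 : 0 < n%:R :> R by rewrite ltr0n.
pose de := M / n%:R.
have de0 : 0 < de by rewrite divr_gt0.
have deep : 2 * de <= ep.
  by apply: ltW; rewrite /de mulrA ltr_pdivrMr// [ep * _]mulrC -ltr_pdivrMr//.
have den : n%:R * de = M by rewrite /de mulrC divfK// gt_eqF.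
(* The grid fills the square of half side [M] about [y]; its border lies outside [V], so that [S]
   alone colours it. *)
pose crd (i : nat) : R := (i%:R - n%:R) * de.
pose pt i j : C := ofRI (re y + crd i) (im y + crd j).
have crdS i : crd i.+1 = crd i + de by rewrite /crd -natr1; ring.
have crd0 : crd 0%N = - M by rewrite /crd sub0r mulNr den.
have crdn : crd (2 * n)%N = M by rewrite /crd natrM -den; ring.
have ptd i j i' j' : cabs (pt i j - pt i' j') <= `|crd i - crd i'| + `|crd j - crd j'|.
  apply: le_trans (cabs_le _) _; rewrite reB imB /=.
  have e (a b c : R) : a + b - (a + c) = b - c by ring.
  by rewrite !e.
have ptre i j : re (pt i j - y) = crd i by rewrite reB /= addrAC subrr add0r.
have ptim i j : im (pt i j - y) = crd j by rewrite imB /= addrAC subrr add0r.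
have Mn : `|M| = M by rewrite gtr0_norm.
apply: (@grid_coloring (2 * n)%N (fun i j => col (pt i j))).
- have e1 (a b : R) : a - (a + b) = - b by ring.
  have e2 (a b : R) : a + b - (a + b) = 0 by ring.
  by move=> i j _ _; apply: small; (apply: le_trans (ptd _ _ _ _) _);
    rewrite !crdS ?subrr ?e1 ?e2 ?normrN ?normr0 ?(gtr0_norm de0); lra.
- have e1 (a b : R) : a - (a + b) = - b by ring.
  have e2 (a b : R) : a + b - (a + b) = 0 by ring.
  have e3 (a b : R) : a + b - a = b by ring.
  by move=> i j _ _; apply: small; (apply: le_trans (ptd _ _ _ _) _);
    rewrite !crdS ?subrr ?e1 ?e2 ?e3 ?normrN ?normr0 ?(gtr0_norm de0); lra.
- move=> j; rewrite colS; last first.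
    by apply: far; apply: le_trans (re_le _); rewrite ptre crd0 normrN Mn.
  by apply/eqP => /S0[_] /=; rewrite crd0; lra.
- move=> j; rewrite colS; last first.
    by apply: far; apply: le_trans (re_le _); rewrite ptre crdn Mn.
  by apply/eqP => /S1[_] /=; rewrite crdn; lra.
- move=> i; rewrite colS; last first.
    by apply: far; apply: le_trans (im_le _); rewrite ptim crd0 normrN Mn.
  by apply/eqP; apply: contrapT => /negP/S2' /=; rewrite crd0; lra.
- move=> i _; rewrite colS; last first.
    by apply: far; apply: le_trans (im_le _); rewrite ptim crdn Mn.
  have : S (pt i (2 * n)%N) <> 2%N by move=> /S2 /=; rewrite crdn; lra.
  by rewrite /S; case: ifP => // _; case: ifP.
Qed.

End Separation.

(** * Totally disconnected subsets of the sphere *)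

Section TotallyDisconnected.
Variable R : realType.
Notation C := (Cplx R).
Notation Ch := (sphere R).
Implicit Types (z w v x y : C) (a b c : Ch).

Lemma some_open (V : set Ch) : open V -> open [set z : C | V (Some z)].
Proof.
move=> oV; apply/openCP => z Vz; have : nbhs (Some z : Ch) V by exact: open_nbhs_nbhs.
by move=> /nbhsCP.
Qed.

Lemma td_no_disc (J : set Ch) z (r : R) : totally_disconnected J -> 0 < r ->
  exists2 w, cabs (w - z) < r & ~ J (Some w).
Proof.
move=> tJ r0; apply: contrapT => no.
pose w := z + ofR (r / 2).
have wz : cabs (w - z) = r / 2.
  by rewrite /w addrAC subrr add0r cabs_ofR gtr0_norm// divr_gt0.
have sub : (Some : C -> Ch) @` segment z w `<=` J.
  move=> _ [v sv <-]; apply: contrapT => nJ; apply: no; exists v => //.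
  by apply: le_lt_trans (segment_dist sv) _; rewrite wz; lra.
have conn : connected ((Some : C -> Ch) @` segment z w).
  apply: connected_continuous_connected; first exact: csegment_connected.
  exact/continuous_subspaceT/one_point_compactification_some_continuous.
have Jz : J (Some z) by apply: sub; exists z => //; exact: segmentl.
have : connected_component J (Some z) (Some w).
  apply: (connected_component_max _ sub conn); first by exists z => //; exact: segmentl.
  by exists w => //; exact: segmentr.
rewrite (tJ _ Jz) => -[e]; move: wz; rewrite e subrr cabs0 => h; lra.
Qed.

(** The Moebius map that sends [x] to infinity. At [Some x] it takes the junk value [0], because
    [0^-1 = 0]; hence the hypotheses [<> Some x] below. *)
Definition mobius x a : C := if a is Some z then (z - x)^-1 else 0.

Lemma mobius_inj x a b : a <> Some x -> b <> Some x -> mobius x a = mobius x b -> a = b.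
Proof.
case: a b => [z|] [w|] //= zx wx.
- by move=> /invr_inj/addIr ->.
- move/eqP; rewrite invr_eq0 subr_eq0 => /eqP zx'; case: zx; by rewrite zx'.
- move/eqP; rewrite eq_sym invr_eq0 subr_eq0 => /eqP wx'; case: wx; by rewrite wx'.
Qed.

Lemma mobius_cont x a : a <> Some x -> forall e : R, 0 < e ->
  exists2 d : R, 0 < d & forall b, chord a b < d -> cabs (mobius x b - mobius x a) < e.
Proof.
case: a => [z|_] /=.
  move=> zx e e0; have zx0 : z - x != 0.
    by rewrite subr_eq0; apply/eqP => h; apply: zx; rewrite h.
  have [r r0 hr] : exists2 r : R, 0 < r & forall w, cabs (w - z) < r ->
      cabs ((w - x)^-1 - (z - x)^-1) < e.
    by have := @ccontV R (fun w => w - x) z zx0 (dif_cont (@dif_subc R 0 x z)) e e0.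
  have [d d0 hd] := chord_near z r0.
  by exists d => // b /hd[w -> /hr].
move=> e e0; have x0 := cabs_ge0 x.
have p0 : 0 < cabs x + e^-1 + 1 by rewrite ltr_wpDl// addr_ge0// invr_ge0 ltW.
exists (2 / (cabs x + e^-1 + 1)); first by rewrite divr_gt0.
case=> [w|_]; last by rewrite subr0 /mobius cabs0.
rewrite /chord /mobius.
rewrite ltr_pM2l// ltf_pV2 ?posrE ?hyp_gt0// subr0 => h.
have h2 : e^-1 < cabs (w - x) by have := hyp_le w; have := cabs_lB w x; lra.
rewrite cabsV -[ltRHS]invrK ltf_pV2 ?posrE ?invr_gt0//.
by apply: lt_trans h2; rewrite invr_gt0.
Qed.

Lemma mobius_compact x (A : set Ch) : closed A -> ~ A (Some x) -> compact (mobius x @` A).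
Proof.
move=> cA nA; apply: continuous_compact; last exact: closed_compactS.
apply/subspace_continuousP => a Aa.
have ax : a <> Some x by move=> h; apply: nA; rewrite -h.
move=> W /nbhsCP[r r0 hW]; have [d d0 hd] := mobius_cont ax r0.
by apply/nbhsSP; exists d => // b /hd /hW Wb _.
Qed.

(* If the complement splits as [V1] and [V2], send a point [x] of [V2] to infinity
   and cut [J] along the horizontal line through a point of [V1]. *)
Lemma td_complement_connected (J : set Ch) : closed J -> totally_disconnected J ->
  J None -> connected (~` J).
Proof.
move=> cJ tJ JN B [y0 By0] [ O1 oO1 BE1] [ O2 cO2 BE2].
apply: contrapT => BJ.
pose V1 := ~` J `&` O1; pose V2 := ~` J `&` ~` O2.
have oJ : open (~` J) by exact: closed_openC.
have oV1 : open V1 by exact: openI.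
have oV2 : open V2 by apply: openI => //; exact: closed_openC.
have V12 a : ~ J a -> V1 a \/ V2 a.
  move=> Ja; have [Ba|nBa] := pselect (B a).
    by left; rewrite /V1 -BE1.
  by right; split => // O2a; apply: nBa; rewrite BE2.
have V1V2 a : V1 a -> ~ V2 a.
  by rewrite /V1 -BE1 BE2 => -[_ O2a] [_].
have [x V2x] : exists x : C, V2 (Some x).
  apply: contrapT => no; apply: BJ; rewrite eqEsubset; split.
    by rewrite BE1 => a [].
  case=> [z|] nJ; last by [].
  have [|V2z] := V12 _ nJ; first by rewrite /V1 -BE1.
  by exfalso; apply: no; exists z.
have [y V1y] : exists y : C, V1 (Some y).
  by move: By0; rewrite BE1; case: y0 => [z|] [h1 h2]; [exists z|].
have nJx : ~ J (Some x) by case: V2x.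
pose m := mobius x.
have nx a : J a -> a <> Some x by move=> Ja h; apply: nJx; rewrite -h.
pose yy := m (Some y).
have yx : (Some y : Ch) <> Some x by move=> h; apply: (V1V2 _ V1y); rewrite h.
have closedm (L : set C) : closed L -> closed (J `&` [set a | L (m a)]).
  move=> cL a cla; have Ja : J a by apply: cJ => W /cla[b [[Jb _] Wb]]; exists b.
  split => //; apply: cL; apply/closure_CP => r /(mobius_cont (nx a Ja))[d d0 hd].
  have [b [[_ Lb] ab]] := cla [set b | chord a b < d] ltac:(by apply/nbhsSP; exists d).
  by exists (m b) => //; exact: hd.
have imcl (P : R -> Prop) : closed [set r : R | P r] ->
    closed [set v : C | im v = im yy /\ P (re v)].
  move=> cP v /closure_CP clv; split.
    apply/eqP; rewrite -subr_eq0 -normr_eq0 eq_le normr_ge0 andbT leNgt; apply/negP.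
    move=> /clv[w [w1 _]]; rewrite -w1 -imB cdistC => h.
    by have := im_le (v - w); rewrite leNgt h.
  apply: cP => W; rewrite nbhs_ballP => -[e /= e0 hW].
  have [w [_ Pw] wv] := clv e e0; exists (re w); split => //; apply: hW.
  by rewrite /ball /= -reB cdistC in wv *; apply: le_lt_trans (re_le _) wv.
(* The right and left halves of the horizontal line through [yy]: their common point [yy] is not the
   image of a point of [J]. *)
have clP := closedm _ (imcl (fun r => re yy <= r) (@closed_ge _ (re yy))).
have clQ := closedm _ (imcl (fun r => r <= re yy) (@closed_le _ (re yy))).
have [|A [B' [cA cB AB dAB [PA QB]]]] := @clopen_separation R Ch (@hausdorffS R) (@compactS R)
    J _ _ (closed_compactS cJ) tJ clP clQ.
  rewrite -subset0 => a [[Ja [_ /= [h1 h2]]] [_ /= [_ h3]]].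
  have e : m a = m (Some y).
    rewrite [m a]ofRIE [RHS]ofRIE h1; congr ofRI; apply/eqP.
    by rewrite eq_le h3.
  have := mobius_inj (nx a Ja) yx e => e2.
  by have := V1y; rewrite -e2 => -[].
have AJ a : A a -> J a by rewrite -AB; left.
have BJ' a : B' a -> J a by rewrite -AB; right.
(* The image of [V1] under [m], bounded because [V2] contains a disc about [x]. The point 0 is the
   image of infinity, which lies in [J]. *)
pose V := [set v : C | v != 0 /\ V1 (Some (x + v^-1))].
apply: (@planar_separation R V (m @` A) (m @` B') yy).
- apply/openCP => v [v0 V1v].
  have [r r0 hr] := (openCP _).1 (some_open oV1) _ V1v.
  have [d d0 hd] := @ccontV R id v v0 (@ccont_id R v) r r0.
  have [d' d'0 hd'] := @ccont_neq0 R id v (@ccont_id R v) v0.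
  exists (Num.min d d'); first exact: min_gt0.
  move=> w; rewrite lt_min => /andP[/hd h1 /hd' h2]; split => //; apply: hr.
  by have -> : x + w^-1 - (x + v^-1) = w^-1 - v^-1 by ring.
- have [r r0 hr] := (openCP _).1 (some_open oV2) _ V2x.
  exists r^-1 => v [v0 V1v]; rewrite leNgt; apply/negP => h.
  apply: (V1V2 _ V1v); apply: hr; rewrite addrAC subrr add0r cabsV.
  rewrite -[ltRHS]invrK ltf_pV2 ?posrE ?invr_gt0//.
  by rewrite (lt_trans _ h)// invr_gt0.
- have yx0 : y - x != 0.
    by rewrite subr_eq0; apply/eqP => h; apply: yx; rewrite h.
  split; first by rewrite invr_eq0.
  by rewrite /yy /m /= invrK addrC subrK.
- by apply: mobius_compact => // /AJ.
- by apply: mobius_compact => // /BJ'.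
- rewrite -subset0 => v [[a Aa <-] [b Bb e]].
  have ab := mobius_inj (nx b (BJ' b Bb)) (nx a (AJ a Aa)) e.
  have : (A `&` B') a by split => //; rewrite -ab.
  by rewrite dAB.
- move=> w clw nVw.
  suff [a Ja <-] : exists2 a, J a & m a = w.
    by move: Ja; rewrite -AB => -[?|?]; [left|right]; exists a.
  have [->|w0] := eqVneq w 0; first by exists None.
  exists (Some (x + w^-1)); last by rewrite /m /= addrAC subrr add0r invrK.
  apply: contrapT => /V12[V1w|V2w]; first by apply: nVw.
  have [r r0 hr] := (openCP _).1 (some_open oV2) _ V2w.
  have [d d0 hd] := @ccontV R id w w0 (@ccont_id R w) r r0.
  move/closure_CP : clw => /(_ d d0)[v [v0 V1v] /hd h].
  apply: (V1V2 _ V1v); apply: hr.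
  by have -> : x + v^-1 - (x + w^-1) = v^-1 - w^-1 by ring.
- move=> _ [a Aa <-] e; rewrite ltNge; apply/negP => h.
  have : (A `&` B') a by split => //; apply: QB; split; [exact: AJ|split => //; exact: AJ].
  by rewrite dAB.
- move=> _ [a Ba <-] e; rewrite ltNge; apply/negP => h.
  have : (A `&` B') a by split => //; apply: PA; split; [exact: BJ'|split => //; exact: BJ'].
  by rewrite dAB.
Qed.

(** A clopen splitting of [J] between [x] and infinity is thickened by normality to disjoint open
    sets; the boundary of the one around [x] meets neither piece of [J]. *)
Lemma td_bounded_nbhd (J : set Ch) x : closed J -> totally_disconnected J ->
  J (Some x) -> J None -> exists B : set C, [/\ open B, Cbounded B, B x &
    forall z, closure B z -> ~ B z -> ~ J (Some z)].
Proof.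
move=> cJ tJ Jx JN.
have cl1 a : closed [set a] by apply: compact_closedS; exact: compact_set1.
have [|A [A' [cA cA' AA dAA [h1 h2]]]] := @clopen_separation R Ch (@hausdorffS R) (@compactS R)
    J _ _ (closed_compactS cJ) tJ (cl1 (Some x)) (cl1 None).
  by rewrite -subset0 => a [[_ ->]].
have Ax : A (Some x) by apply: h1.
have AN : A' None by apply: h2.
have [ O1 [ O2 [oO1 oO2 AO1 AO2 O12]]] := (@normal_openP R Ch).1
  (compact_normal (@hausdorffS R) (@compactS R)) A A' cA cA' dAA.
exists [set z | O1 (Some z)]; split.
- exact: some_open.
- have : nbhs (None : Ch) O2 by apply: open_nbhs_nbhs; split => //; exact: AO2.
  move=> [K [cK _] KO]; have [M hM] := compactCb cK; exists M => z O1z.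
  apply: hM; apply: contrapT => nK.
  have : (O1 `&` O2) (Some z) by split => //; apply: KO; left; exists z.
  by rewrite O12.
- exact: AO1.
- move=> z clz nz; rewrite -AA => -[/AO1//|/AO2 O2z].
  have /clz[w [ O1w O2w]] : nbhs z [set w | O2 (Some w)].
    by apply: open_nbhs_nbhs; split => //; exact: some_open.
  have : (O1 `&` O2) (Some w) by [].
  by rewrite O12.
Qed.

End TotallyDisconnected.

(** * Limits of iterates along ultrafilters *)

Section UltraNat.

Definition ultra (U : set_system nat) :=
  ProperFilter U /\ forall A, U A \/ U (~` A).

Lemma ultra_ex (F : set_system nat) : ProperFilter F -> exists U, ultra U /\ F `<=` U.
Proof.
move=> /ultraFilterLemma[U [UU FU]]; exists U; split => //; split.
  exact: ultra_proper.
by move=> A; exact: in_ultra_setVsetC.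
Qed.

Lemma ultra_map (phi : nat -> nat) (U : set_system nat) : ultra U -> ultra (phi @ U).
Proof.
move=> [PU hU]; split; first exact: fmap_proper_filter.
by move=> A; exact: (hU (phi @^-1` A)).
Qed.

Lemma ultraI (U : set_system nat) A B : ultra U -> U A -> U B -> U (A `&` B).
Proof. by move=> [PU _]; exact: filterI. Qed.

Lemma ultraS (U : set_system nat) A B : ultra U -> A `<=` B -> U A -> U B.
Proof. by move=> [PU _]; exact: filterS. Qed.

Lemma ultra_nonempty (U : set_system nat) A : ultra U -> U A -> A !=set0.
Proof. by move=> [PU _]; exact: filter_ex. Qed.

Definition nonprincipal (U : set_system nat) := forall N, U [set n | (N <= n)%N].

Lemma ultra_cases (U : set_system nat) : ultra U -> nonprincipal U \/ exists n, U [set n].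
Proof.
move=> uU; have [|nf] := pselect (nonprincipal U); first by left.
right; move: nf => /existsNP[N nN].
have [//|UN] := uU.2 [set n | (N <= n)%N].
have {nN UN} : U [set n | (n < N)%N].
  by apply: ultraS UN => // n /= /negP; rewrite -ltnNge.
elim: N => [|N IH] UN; first by have [] := ultra_nonempty uU UN.
have [UN1|UN1] := uU.2 [set N]; first by exists N.
apply: IH; apply: ultraS (ultraI uU UN UN1) => // n /= [].
by rewrite ltnS leq_eqVlt => /orP[/eqP//|].
Qed.

End UltraNat.

Section Iteration.
Variable R : realType.
Notation C := (Cplx R).
Notation Ch := (sphere R).
Implicit Types (z w v : C) (b c : Ch).

Lemma ultra_lim (U : set_system nat) (s : nat -> Ch) : ultra U ->
  exists c, forall e : R, 0 < e -> U [set n | chord (s n) c < e].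
Proof.
move=> uU; have [PU hU] := uU.
have [|c [_ cc]] := @compactS R (s @ U) _; first exact: filterT.
exists c => e e0; have [//|Un] := hU [set n | chord (s n) c < e].
have [||b [[n nn <-] /= bc]] := cc (s @` [set n | ~ chord (s n) c < e]) [set b | chord c b < e].
- have K : U (s @^-1` (s @` [set n | ~ chord (s n) c < e])).
    by apply: filterS Un => n nn; exists n.
  exact: K.
- by apply/nbhsSP; exists e.
- by exfalso; apply: nn; rewrite chordC.
Qed.

Lemma ultra_lim_uniq (U : set_system nat) (s : nat -> Ch) b c : ultra U ->
  (forall e : R, 0 < e -> U [set n | chord (s n) b < e]) ->
  (forall e : R, 0 < e -> U [set n | chord (s n) c < e]) -> b = c.
Proof.
move=> uU hb hc; apply: chord0; apply/eqP; rewrite eq_le chord_ge0 andbT leNgt.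
apply/negP => h; have h2 : 0 < chord b c / 2 by rewrite divr_gt0.
have [n [/= h3 h4]] := ultra_nonempty uU (ultraI uU (hb _ h2) (hc _ h2)).
by have := chord_tri (s n) b c; rewrite [chord b (s n)]chordC; lra.
Qed.

Variables (f : C -> Ch) (a : C) (g : C -> C).
Hypothesis fE : forall z, f z = if g z == 0 then None else Some (a + (g z)^-1).
Hypothesis dg : forall z, dif 1 g z.

Local Notation it := (iterate f).
Local Notation F := (Fatou f).

Definition itC n z : C := finpart (it n (Some z)).

Lemma itS n b : it n.+1 b = extend f (it n b). Proof. by []. Qed.
Lemma itSr n b : it n.+1 b = it n (extend f b). Proof. exact: iterSr. Qed.
Lemma itD n m b : it (n + m)%N b = it n (it m b). Proof. exact: iterD. Qed.
Lemma it_none n : it n None = None. Proof. by elim: n => // n IH; rewrite itS IH. Qed.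

Lemma it_fin_le n k b : it n b <> None -> (k <= n)%N -> it k b <> None.
Proof. by move=> h kn e; apply: h; rewrite -(subnK kn) itD e it_none. Qed.

Lemma itC_fin n z : it n (Some z) <> None -> it n (Some z) = Some (itC n z).
Proof. by rewrite /itC; case: (it n (Some z)). Qed.

Lemma itC_S n z : it n (Some z) <> None -> it n.+1 (Some z) =
  if g (itC n z) == 0 then None else Some (a + (g (itC n z))^-1).
Proof. by move=> h; rewrite itS (itC_fin h) /= fE. Qed.

Lemma it_holo n z : it n (Some z) <> None -> dif 1 (itC n) z /\
  exists2 r : R, 0 < r & forall w, cabs (w - z) < r -> it n (Some w) <> None.
Proof.
elim: n => [|n IH] h; first by split; [exact: dif_id|exists 1].
have hn := it_fin_le h (leqnSn n); have [dn [r r0 hr]] := IH hn.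
have dgn : dif 1 (fun w => g (itC n w)) z by apply: dif_comp => //; exact: dg.
have gn0 : g (itC n z) != 0 by move: h; rewrite itC_S//; case: eqP.
have [s s0 hs] := ccont_neq0 (dif_cont dgn) gn0.
have fin w : cabs (w - z) < Num.min r s -> it n.+1 (Some w) = Some (a + (g (itC n w))^-1).
  by rewrite lt_min => /andP[/hr h1 /hs h2]; rewrite itC_S// (negbTE h2).
split; last by exists (Num.min r s); [exact: min_gt0|move=> w /fin ->].
apply: (@dif_near _ _ (fun w => a + (g (itC n w))^-1)).
  by exists (Num.min r s); [exact: min_gt0|move=> w /fin e; rewrite /itC e].
by apply: difD; [exact: dif_cst|exact: difV].
Qed.

Lemma it_cont n z : it n (Some z) <> None -> forall e : R, 0 < e ->
  exists2 d : R, 0 < d & forall w, cabs (w - z) < d -> chord (it n (Some w)) (it n (Some z)) < e.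
Proof.
move=> h e e0; have [dn [r r0 hr]] := it_holo h.
have [d d0 hd] := dif_cont dn (divr_gt0 e0 (ltr0n R 2)).
exists (Num.min r d); first exact: min_gt0.
move=> w; rewrite lt_min => /andP[/hr h1 /hd h2]; rewrite (itC_fin h1) (itC_fin h).
by apply: le_lt_trans (chord_le _ _) _; lra.
Qed.

Lemma fatou_fin n z : F (Some z) -> it n (Some z) <> None.
Proof. by move=> [U [[_ Uz] hU _]]; exact: (hU n.+1 (Some z) Uz n). Qed.

Lemma fatou_none : ~ F None.
Proof. by move=> [U [[_ Uz] hU _]]; exact: (hU 1%N None Uz 0%N). Qed.

Lemma fatou_open : open F.
Proof.
rewrite openE => b [U [[oU Ub] h1 h2]]; rewrite /interior nbhsE; exists U => //.
by move=> c Uc; exists U.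
Qed.

Lemma fatou_disc z : F (Some z) -> exists2 r : R, 0 < r &
  forall w, cabs (w - z) < r -> F (Some w).
Proof. exact: ((openCP _).1 (some_open fatou_open)). Qed.

(** Otherwise some iterates jump by [e] at points tending to [z]. Members of a uniformly convergent
    subsequence are close to each other on a disc, so the jump would pass to one fixed iterate,
    which is continuous. Five comparisons occur, whence [e / 6]. *)
Lemma fatou_equicontinuous z : F (Some z) -> forall e : R, 0 < e ->
  exists2 d : R, 0 < d & forall n w, cabs (w - z) < d ->
    chord (it n (Some w)) (it n (Some z)) < e.
Proof.
move=> Fz e e0; apply: contrapT => no.
have /choice[q hq] : forall j : nat, exists q : nat * C, cabs (q.2 - z) < j.+1%:R^-1 /\
    e <= chord (it q.1 (Some q.2)) (it q.1 (Some z)).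
  move=> j; apply: contrapT => nj; apply: no; exists j.+1%:R^-1.
    by rewrite invr_gt0 ltr0n.
  move=> n w wz; rewrite ltNge; apply/negP => h; apply: nj.
  by exists (n, w).
have [U [[oU Uz] _ nf]] := Fz.
have [|s [h [hs hcv]]] := nf (fun j => it (q j).1); first by move=> n; exists (q n).1.
have [r r0 hr] := (openCP _).1 (some_open oU) z Uz.
pose K := (Some : C -> Ch) @` cdisc z (r / 2).
have cK : compact K.
  apply: continuous_compact.
    exact/continuous_subspaceT/one_point_compactification_some_continuous.
  apply: compactC; last exact: cdisc_closed.
  exists (r / 2 + cabs z) => w; rewrite /cdisc /= => wz.
  by have := cabs_lB w z; lra.
have KU : K `<=` U by move=> _ [w wz <-]; apply: hr; move: wz; rewrite /cdisc /=; lra.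
have e6 : (0 : C) < ofR (e / 6) by rewrite -[0]/(ofR 0) ltCR divr_gt0.
have [N _ hN] := hcv K cK KU _ e6.
have {}hN n w : (N <= n)%N -> cabs (w - z) <= r / 2 ->
    chord (it (q (s n)).1 (Some w)) (h (Some w)) < e / 6.
  move=> Nn wz; have Kw : K (Some w) by exists w.
  by have := hN n Nn (Some w) Kw; rewrite chordalE ltCR.
have [d d0 hd] := it_cont (@fatou_fin (q (s N)).1 z Fz) (divr_gt0 e0 (ltr0n R 6)).
have sge n : (n <= s n)%N.
  by elim: n => // n IH; apply: leq_ltn_trans IH _; exact: hs.
pose m := Num.min d (r / 2).
have m0 : 0 < m by rewrite min_gt0// divr_gt0.
pose n := maxn N (Num.bound m^-1).
have small : cabs ((q (s n)).2 - z) < m.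
  apply: lt_trans (hq (s n)).1 _; rewrite -[ltRHS]invrK ltf_pV2 ?posrE ?invr_gt0//.
  apply: lt_le_trans (archi_boundP _) _; first by rewrite invr_ge0 ltW.
  rewrite ler_nat; apply: leq_trans (leqnSn _); apply: leq_trans (sge n).
  exact: leq_maxr.
move: small; rewrite lt_min => /andP[sd /ltW sr].
have zr : cabs (z - z) <= r / 2 by rewrite subrr cabs0 divr_ge0// ltW.
have := (hq (s n)).2; rewrite leNgt => /negP; apply.
set w := (q (s n)).2 in sd sr *; set k := (q (s n)).1.
have k1 := hN n w (leq_maxl _ _) sr; have k2 := hN n z (leq_maxl _ _) zr.
have k3 := hN N w (leqnn _) sr; have k4 := hN N z (leqnn _) zr.
have k5 := hd w sd; rewrite -/k in k1 k2; rewrite [chord _ (h (Some w))]chordC in k3.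
rewrite [chord _ (h (Some z))]chordC in k2.
have t1 := chord_tri (h (Some w)) (it k (Some w)) (it k (Some z)).
have t2 := chord_tri (it (q (s N)).1 (Some w)) (h (Some w)) (it k (Some z)).
have t3 := chord_tri (it (q (s N)).1 (Some z)) (it (q (s N)).1 (Some w)) (it k (Some z)).
have t4 := chord_tri (h (Some z)) (it (q (s N)).1 (Some z)) (it k (Some z)).
lra.
Qed.

(* The limit of the iterates along [U], which exists by compactness of the sphere
   when [U] is an ultrafilter; otherwise [None] may be a junk value. *)
Definition hl (U : set_system nat) b : Ch :=
  xget None [set c | forall e : R, 0 < e -> U [set n | chord (it n b) c < e]].

Lemma hlP U b : ultra U -> forall e : R, 0 < e -> U [set n | chord (it n b) (hl U b) < e].
Proof.
move=> uU; rewrite /hl; case: xgetP => [c _ //|no].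
by have [c hc] := ultra_lim (fun n => it n b) uU; case: (no c).
Qed.

Lemma hl_uniq U b c : ultra U -> (forall e : R, 0 < e -> U [set n | chord (it n b) c < e]) ->
  hl U b = c.
Proof. by move=> uU; apply: (@ultra_lim_uniq U (fun n => it n b)) => //; exact: hlP. Qed.

Lemma hl_cont U z : ultra U -> F (Some z) -> forall e : R, 0 < e ->
  exists2 d : R, 0 < d & forall w, cabs (w - z) < d -> chord (hl U (Some w)) (hl U (Some z)) < e.
Proof.
move=> uU Fz e e0; have e3 : 0 < e / 3 by rewrite divr_gt0.
have [d d0 hd] := fatou_equicontinuous Fz e3.
exists d => // w wz.
have [n [/= h1 h2]] := ultra_nonempty uU (ultraI uU (hlP (Some w) uU e3) (hlP (Some z) uU e3)).
have h3 := hd n w wz; rewrite chordC in h1.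
have := chord_tri (it n (Some w)) (hl U (Some w)) (hl U (Some z)).
have := chord_tri (it n (Some z)) (it n (Some w)) (hl U (Some z)); lra.
Qed.

Lemma hl_unif_local U z : ultra U -> F (Some z) -> forall e : R, 0 < e ->
  exists2 d : R, 0 < d & U [set n | forall w, cabs (w - z) < d ->
    chord (it n (Some w)) (hl U (Some w)) < e].
Proof.
move=> uU Fz e e0; have e3 : 0 < e / 3 by rewrite divr_gt0.
have [d d0 hd] := fatou_equicontinuous Fz e3; have [d' d'0 hd'] := hl_cont uU Fz e3.
exists (Num.min d d'); first exact: min_gt0.
apply: ultraS (hlP (Some z) uU e3) => // n /= h1 w; rewrite lt_min => /andP[wd wd'].
have h2 := hd n w wd; have h3 := hd' w wd'; rewrite chordC in h3.
have := chord_tri (it n (Some z)) (it n (Some w)) (hl U (Some w)).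
have := chord_tri (hl U (Some z)) (it n (Some z)) (hl U (Some w)); lra.
Qed.

(** Equicontinuity makes the pointwise limit locally uniform, and compactness makes it uniform on
    [K]. *)
Lemma hl_unif U (K : set C) : ultra U -> compact K -> (forall z, K z -> F (Some z)) ->
  forall e : R, 0 < e -> U [set n | forall w, K w -> chord (it n (Some w)) (hl U (Some w)) < e].
Proof.
move=> uU cK KF e e0; have [PU _] := uU.
move: cK => /compact_near_coveringP/(_ _ U
  (fun n w => chord (it n (Some w)) (hl U (Some w)) < e)) H.
apply: filterS (H _ _) => [n h w Kw|z Kz]; first exact: h.
have [d d0 hd] := hl_unif_local uU (KF z Kz) e0.
exists (disc z d, [set n | forall w, cabs (w - z) < d ->
    chord (it n (Some w)) (hl U (Some w)) < e]).
  by split => //=; exact: nbhs_disc.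
by move=> [w n] /= [wz h]; exact: h.
Qed.

(** For iterates with exponents [nu n], let [U] be an ultrafilter finer than the image under [nu] of
    the filter at infinity. Its members are met by [nu] at arbitrarily late places, so a subsequence
    can be chosen with errors below [1 / (j + 1)]. The exponents may be bounded, which is why
    principal [U] are included in the hypothesis. *)
Lemma to_fatou (V : set C) : open V -> (forall z n, V z -> it n (Some z) <> None) ->
  (forall U, ultra U -> forall e : R, 0 < e ->
    U [set n | forall w, V w -> chord (it n (Some w)) (hl U (Some w)) < e]) ->
  forall z, V z -> F (Some z).
Proof.
move=> oV Vfin VU z Vz; exists ((Some : C -> Ch) @` V); split.
- by split; [exact: one_point_compactification_open_some|exists z].
- by move=> n _ [w Vw <-] k _; exact: Vfin.
move=> G GG; have /choice[nu hnu] : forall n, exists k, it k = G n.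
  by move=> n; have [k _ hk] := GG n; exists k.
have [U [uU sU]] := @ultra_ex (nu @ \oo) _.
have inf E N : U E -> exists2 n, (N < n)%N & E (nu n).
  move=> UE; have UN : U (nu @` [set n | (N < n)%N]).
    by apply: sU; exists N.+1 => // n /= Nn; exists n.
  have [m [Em [n Nn e]]] := ultra_nonempty uU (ultraI uU UE UN).
  by exists n => //; rewrite e.
pose E (j : nat) := [set n | forall w, V w -> chord (it n (Some w)) (hl U (Some w)) < j.+1%:R^-1].
have UE j : U (E j) by apply: VU => //; rewrite invr_gt0 ltr0n.
pose nxt N j := projT1 (cid2 (inf (E j) N (UE j))).
have nxt1 N j : (N < nxt N j)%N by rewrite /nxt; case: (cid2 _).
have nxt2 N j : E j (nu (nxt N j)) by rewrite /nxt; case: (cid2 _).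
pose s := fix s j := if j is j'.+1 then nxt (s j') j else nxt 0%N 0%N.
have sE j : E j (nu (s j)) by case: j => [|j]; exact: nxt2.
exists s, (hl U); split.
  by apply: homo_ltn; [exact: ltn_trans|move=> i; exact: nxt1].
move=> K _ KV e /ltC0P[r r0 ->].
exists (Num.bound r^-1) => // j /= rj _ /KV[w Vw <-].
rewrite chordalE ltCR -hnu; apply: lt_le_trans (sE j w Vw) _.
rewrite -[leRHS]invrK lef_pV2 ?posrE ?invr_gt0 ?ltr0n//.
apply: ltW; apply: lt_le_trans (archi_boundP _) _; first by rewrite invr_ge0 ltW.
by rewrite ler_nat; exact: leq_trans (leqnSn _).
Qed.

End Iteration.

(** * Invariance of the Fatou set and failure of injectivity *)

Section Invariance.
Variable R : realType.
Notation C := (Cplx R).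
Notation Ch := (sphere R).
Implicit Types (z w v : C) (b c : Ch).
Variables (f : C -> Ch) (a : C) (g : C -> C).
Hypothesis fE : forall z, f z = if g z == 0 then None else Some (a + (g z)^-1).
Hypothesis dg : forall z, dif 1 g z.
Variables (p : C) (rp : R).
Hypothesis rp0 : 0 < rp.
Hypothesis gp : g p = 0.
Hypothesis gp' : forall w, cabs (w - p) < rp -> w != p -> g w != 0.

Local Notation it := (iterate f).
Local Notation F := (Fatou f).
Let hl_unif := @hl_unif R f a g fE dg.

(** Otherwise the identity theorem makes [g] constant, against its isolated zero [p]. *)
Lemma g_isolated z : exists2 r : R, 0 < r & forall w, cabs (w - z) < r -> w != z -> g w != g z.
Proof.
apply: contrapT => no.
have du w : dif 1 (fun w => g w - g z) w by apply: difB; [exact: dg|exact: dif_cst].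
have gz w : g w = g z.
  apply/eqP; rewrite -subr_eq0; apply/eqP.
  pose r := 2 * cabs (w - z) + 2.
  have r0 : 0 < r by rewrite /r; have := cabs_ge0 (w - z); lra.
  apply: (@isolated_zeros R (fun w => g w - g z) z r r0) => //; last by rewrite /r; lra.
  move=> e e0; apply: contrapT => ne; apply: no; exists e => // v ve vz.
  by apply/eqP => gv; apply: ne; exists v; split => //; rewrite gv subrr.
have [w] := avoid_seq [:: p] p rp0; rewrite inE => wp wr.
by have := gp' wr wp; rewrite gz -(gz p) gp eqxx.
Qed.

Lemma f_fin z : g z != 0 -> f z = Some (a + (g z)^-1).
Proof. by move=> h; rewrite fE (negbTE h). Qed.

Lemma it1 z : it 1 (Some z) = f z. Proof. by []. Qed.

Lemma fatou_g z : F (Some z) -> g z != 0.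
Proof. by move=> /(@fatou_fin R f 1); rewrite it1 fE; case: eqP. Qed.

(** By openness the points [c] near [f z] are of the form [f w] with [w] near [z], and the iterates
    of [c] along [U] are those of [w] along the shifted ultrafilter [S @ U]. *)
Lemma fatou_forward z : F (Some z) -> F (f z).
Proof.
move=> Fz; have gz := fatou_g Fz; rewrite f_fin//.
have [r1 r10 hr1] := fatou_disc Fz; have [r2 r20 hr2] := g_isolated z.
pose r := Num.min r1 r2 / 2.
have r0 : 0 < r by rewrite divr_gt0// min_gt0.
have rr : r < r1 /\ r < r2.
  have : Num.min r1 r2 <= r1 by rewrite ge_min lexx.
  have : Num.min r1 r2 <= r2 by rewrite ge_min lexx orbT.
  have : 0 < Num.min r1 r2 by rewrite min_gt0.
  by rewrite /r; split; lra.
have [d d0 hd] : exists2 d : R, 0 < d & forall v, cabs (v - g z) < d ->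
    exists2 w, cabs (w - z) < r & g w = v.
  by apply: open_at => // w wr; apply: hr2; lra.
pose z1 := a + (g z)^-1.
have z1a : z1 - a != 0 by rewrite /z1 addrAC subrr add0r invr_eq0.
have cV : ccont (fun w => (w - a)^-1) z1.
  by apply: (@ccontV R (fun w => w - a)) => //; exact: dif_cont (@dif_subc R 0 a z1).
have [d1 d10 hd1] := cV d d0.
have [d2 d20 hd2] := @ccont_neq0 R (fun w => w - a) z1 (dif_cont (@dif_subc R 0 a z1)) z1a.
pose V := disc z1 (Num.min d1 d2).
have lift (c : C) : V c -> exists2 w, cabs (w - z) < r & f w = Some c.
  rewrite /V /disc /= lt_min => /andP[/hd1 h1 /hd2 h2].
  have [|w wr gw] := hd ((c - a)^-1).
    by move: h1; rewrite /z1 addrAC subrr add0r invrK.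
  by exists w => //; rewrite f_fin gw ?invr_eq0// invrK addrC subrK.
apply: (@to_fatou R f V) => //.
- exact: disc_open.
- move=> c n /lift[w wr <-]; rewrite -[f w]/(extend f (Some w)) -itSr.
  by apply: fatou_fin; apply: hr1; lra.
- move=> U uU e e0.
  have uU' := ultra_map S uU.
  have cD : compact (cdisc z r).
    apply: compactC; last exact: cdisc_closed.
    exists (r + cabs z) => w; rewrite /cdisc /= => wz.
    by have := cabs_lB w z; lra.
  have DF w : cdisc z r w -> F (Some w) by rewrite /cdisc /= => wz; apply: hr1; lra.
  have H : U [set n | forall w, cdisc z r w ->
     chord (it n.+1 (Some w)) (hl f (S @ U) (Some w)) < e] := hl_unif uU' cD DF e0.
  apply: ultraS H => // n; rewrite /mkset => H c /lift[w wr fw].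
  have -> : it n (Some c) = it n.+1 (Some w) by rewrite itSr /= fw.
  suff <- : hl f (S @ U) (Some w) = hl f U (Some c) by apply: H; exact: ltW.
  apply: hl_uniq => // e' e'0.
  have H' : U [set n | chord (it n (Some c)) (hl f U (Some c)) < e'] := hlP f _ uU e'0.
  have H'' : U [set n | chord (it n.+1 (Some w)) (hl f U (Some c)) < e'].
    by apply: ultraS H' => // m; rewrite /mkset itSr /= fw.
  exact: H''.
by rewrite /V /disc /= subrr cabs0 min_gt0.
Qed.

Lemma fatou_backward z : F (f z) -> F (Some z).
Proof.
move=> Ffz.
have gz : g z != 0 by apply: contraPneq Ffz => e; rewrite fE e eqxx; exact: fatou_none.
have fz := f_fin gz; rewrite fz in Ffz.
have [r r0 hr] := fatou_disc Ffz.
have cf : ccont (fun w => a + (g w)^-1) z.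
  apply: ccontD; first exact: ccont_cst.
  by apply: ccontV => //; exact: dif_cont (dg z).
have r20 : 0 < r / 2 by rewrite divr_gt0.
have [d1 d10 hd1] := cf _ r20; have [d2 d20 hd2] := ccont_neq0 (dif_cont (dg z)) gz.
set z1 := a + (g z)^-1 in Ffz hr hd1.
pose V := disc z (Num.min d1 d2).
have Vf w : V w -> exists2 c : C, f w = Some c & cabs (c - z1) <= r / 2.
  rewrite /V /disc /= lt_min => /andP[/hd1 /ltW h1 /hd2 h2].
  by exists (a + (g w)^-1); [exact: f_fin|].
apply: (@to_fatou R f V) => //.
- exact: disc_open.
- move=> w [|n] /Vf[c fw cz]; first by [].
  by rewrite itSr /= fw; apply: fatou_fin; apply: hr; lra.
- move=> U uU e e0.
  (* Shifting back by [predn] is faithful only off the index 0; an ultrafilter concentrated there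
     has the identity as its limit. *)
  have [U0|U1] := uU.2 [set 0%N].
    have U00 := U0; apply: ultraS U0 => // n /= -> w _.
    suff -> : hl f U (Some w) = Some w by rewrite chordxx.
    by apply: hl_uniq => // e' e'0; apply: ultraS U00 => // m /= ->; rewrite chordxx.
  have uU' := ultra_map predn uU.
  have cD : compact (cdisc z1 (r / 2)).
    apply: compactC; last exact: cdisc_closed.
    exists (r / 2 + cabs z1) => w; rewrite /cdisc /= => wz.
    by have := cabs_lB w z1; lra.
  have DF w : cdisc z1 (r / 2) w -> F (Some w) by rewrite /cdisc /= => wz; apply: hr; lra.
  have H : U [set n | forall w, cdisc z1 (r / 2) w ->
     chord (it n.-1 (Some w)) (hl f (predn @ U) (Some w)) < e] := hl_unif uU' cD DF e0.
  have U11 := U1; apply: ultraS (ultraI uU H U1) => // -[|n] [];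
    rewrite /mkset => {}H n0 w /Vf[c fw cz]; first by case: n0.
  rewrite itSr /= fw.
  suff <- : hl f (predn @ U) (Some c) = hl f U (Some w) by apply: H.
  apply: hl_uniq => // e' e'0.
  have H' : U [set n | chord (it n (Some w)) (hl f U (Some w)) < e'] := hlP f _ uU e'0.
  have H'' : U [set n | chord (it n.-1 (Some c)) (hl f U (Some w)) < e'].
    apply: ultraS (ultraI uU H' U11) => // -[|m] []; rewrite /mkset => h m0; first by case: m0.
    by move: h; rewrite itSr /= fw.
  exact: H''.
by rewrite /V /disc /= subrr cabs0 min_gt0.
Qed.

Hypothesis tJ : totally_disconnected (Julia f).

Lemma fatou_dense z (r : R) : 0 < r -> exists2 w, cabs (w - z) < r & F (Some w).
Proof.
move=> r0; have [w wz nJ] := td_no_disc z tJ r0; exists w => //.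
by apply: contrapT => nF; exact: nJ.
Qed.

Lemma fatou_value_dense v (e : R) : 0 < e ->
  exists v', [/\ cabs (v' - v) < e, v' != 0 & F (Some (a + v'^-1))].
Proof.
move=> e0; have e20 : 0 < e / 2 by rewrite divr_gt0.
have [v0 v00 v0v] := avoid_seq [:: 0] v e20; rewrite inE in v00.
have i0 : v0^-1 != 0 by rewrite invr_eq0.
have [d d0 hd] := @ccontV R id v0^-1 i0 (@ccont_id R _) _ e20.
have [d' d'0 hd'] := @ccont_neq0 R id v0^-1 (@ccont_id R _) i0.
have [c cv Fc] := fatou_dense (a + v0^-1) (min_gt0 d0 d'0).
have e1 : c - a - v0^-1 = c - (a + v0^-1) by ring.
move: cv; rewrite -e1 lt_min => /andP[/hd h1 /hd' h2].
exists (c - a)^-1; split; last by rewrite invrK addrC subrK.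
- have := cdist_tri v0 (c - a)^-1 v; rewrite invrK in h1; lra.
- by rewrite invr_eq0.
Qed.

Hypothesis nrat : ~ Defs.rational f.

(* An injective [f] stays away from infinity outside a disc around its pole, so
   Liouville makes [1 / G] in [g = (z - p)^k G] a polynomial without zeros. *)
Lemma not_injective : exists z w, [/\ F (Some z), F (Some w), f z = f w & z <> w].
Proof.
apply: contrapT => no.
have inj z w : F (f z) -> f z = f w -> z = w.
  move=> Fz e; apply: contrapT => zw; apply: no; exists z, w.
  by split => //; apply: fatou_backward; rewrite -?e.
have rp1 := rp0; pose r := rp / 4.
have r0 : 0 < r by rewrite divr_gt0.
have [d d0 hd] : exists2 d : R, 0 < d & forall v, cabs (v - g p) < d ->
    exists2 w, cabs (w - p) < r & g w = v.
  by apply: open_at => // w wr wp; rewrite gp; apply: gp' => //; rewrite /r in wr; lra.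
(* Values of [g] of modulus below [d] are already taken near [p]. Taken again near a distant [z],
   one of them can be chosen, by density, with its value of [f] in [F], against [inj]. *)
have far z : 2 * r <= cabs (z - p) -> d <= cabs (g z).
  move=> zp; rewrite leNgt; apply/negP => gd.
  have [s1 s10 hs1] := g_isolated z.
  pose s := Num.min s1 r.
  have s0 : 0 < s by rewrite min_gt0.
  have [e e0 he] : exists2 e : R, 0 < e & forall v, cabs (v - g z) < e ->
      exists2 w, cabs (w - z) < s & g w = v.
    by apply: open_at => // w; rewrite lt_min => /andP[h _]; exact: hs1.
  have m0 : 0 < Num.min e (d - cabs (g z)) by rewrite min_gt0// subr_gt0.
  have [v [vz v0 Fv]] := fatou_value_dense (g z) m0.
  move: vz; rewrite lt_min => /andP[/he[w wz gw] vd].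
  have [|w' w'p gw'] := hd v.
    by rewrite gp subr0; have := cabs_lB v (g z); lra.
  have ww : w = w'.
    by apply: inj; rewrite ?f_fin ?gw ?gw'.
  move: wz; rewrite lt_min => /andP[_ wz].
  by have := cdist_tri w z p; rewrite -ww in w'p; rewrite cdistC in wz; lra.
have gn0 z : z != p -> g z != 0.
  move=> zp; have [/far h|h] := leP (2 * r) (cabs (z - p)).
    by rewrite -cabs_gt0; exact: lt_le_trans h.
  by apply: gp' => //; rewrite /r in h; lra.
have [[k [G [gG dG Gp]]]|z0] := zero_order rp0 (fun z (_ : cabs (z - p) < rp) => dg z); last first.
  have [w] := avoid_seq [:: p] p (divr_gt0 rp0 (ltr0n R 2)); rewrite inE => wp wr.
  by have := gn0 w wp; rewrite z0 ?eqxx.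
have Gn0 z : G z != 0.
  have [->//|zp] := eqVneq z p.
  by apply: contraNneq (gn0 z zp) => e; rewrite gG e mulr0.
have k0 : (0 < k)%N.
  by case: (k) gG => // /(_ p); rewrite gp expr0 mul1r => e; rewrite -e eqxx in Gp.
have [P hP] : exists P : {poly C}, forall z, (G z)^-1 = P.[z].
  apply: (@liouville_poly R _ p k d^-1 (2 * r)).
    by move=> z; apply: difV => //; exact: dG.
  move=> z zr; have zp : z != p by rewrite -subr_eq0 -cabs_gt0; lra.
  have zp0 : 0 < cabs (z - p) ^+ k by rewrite exprn_gt0// cabs_gt0 subr_eq0.
  have := far z zr; rewrite gG cabsM cabsX cabsV => h.
  have G0 : 0 < cabs (G z) by rewrite cabs_gt0.
  by rewrite mulrC ler_pdivlMr// mulrC ler_pdivrMr.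
have P1 : size P == 1%N.
  apply/negPn/negP => /closed_rootP[z]; rewrite /root -hP invr_eq0.
  by rewrite (negbTE (Gn0 z)).
have [c c0 Pc] := size_poly1P _ P1.
(* Here [1 / G] is the constant [c], so [f z = a + c / (z - p)^k]. *)
apply: nrat; exists (a *: ('X - p%:P) ^+ k + c%:P), (('X - p%:P) ^+ k); split.
  apply/Bezout_eq1_coprimepP; exists ((c^-1)%:P, (- (c^-1 * a))%:P) => /=.
  rewrite mulrDr -polyCM mulVf// -scalerAr -!mul_polyC mulrA -polyCM [a * _]mulrC polyCN.
  ring.
move=> z; rewrite !hornerE.
have e : (z - p) ^+ k == 0 = (g z == 0).
  by rewrite gG mulf_eq0 (negbTE (Gn0 z)) orbF.
rewrite fE e; case: eqVneq => // gz.
congr Some; rewrite gG invfM hP Pc hornerC.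
have zk : (z - p) ^+ k != 0 by rewrite e.
by field.
Qed.

End Invariance.

(** * Constancy of the limit functions *)

Section ConstantLimits.
Variable R : realType.
Notation C := (Cplx R).
Notation Ch := (sphere R).
Implicit Types (z w v : C) (b : Ch).
Variables (f : C -> Ch) (a : C) (g : C -> C).
Hypothesis fE : forall z, f z = if g z == 0 then None else Some (a + (g z)^-1).
Hypothesis dg : forall z, dif 1 g z.
Variables (p : C) (rp : R).
Hypothesis rp0 : 0 < rp.
Hypothesis gp : g p = 0.
Hypothesis gp' : forall w, cabs (w - p) < rp -> w != p -> g w != 0.
Hypothesis tJ : totally_disconnected (Julia f).
Hypothesis nrat : ~ Defs.rational f.

Local Notation it := (iterate f).
Local Notation F := (Fatou f).
Local Notation hl := (hl f).
Local Notation itC := (itC f).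
Let it_holo := @it_holo R f a g fE dg.
Let hl_cont := @hl_cont R f a g fE dg.
Let hl_unif := @hl_unif R f a g fE dg.
Let fatou_dense := @fatou_dense R f tJ.
Let MM := @maximum_modulus R.

Lemma cdisc_compact z (r : R) : compact (cdisc z r).
Proof.
apply: compactC; last exact: cdisc_closed.
exists (r + cabs z) => w; rewrite /cdisc /= => wz.
by have := cabs_lB w z; lra.
Qed.

(** By continuity the limit stays bounded near a point where it is finite; chordally close iterates
    are then finite and close in modulus, and [weierstrass] applies. *)
Lemma hl_dif (U : set_system nat) w (b : C) : ultra U -> F (Some w) ->
  hl U (Some w) = Some b -> exists2 r : R, 0 < r & forall z, cabs (z - w) < r ->
    hl U (Some z) = Some (finpart (hl U (Some z))) /\
    dif 1 (fun z => finpart (hl U (Some z))) z.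
Proof.
move=> uU Fw hw; set u := fun z => finpart (hl U (Some z)).
have [r1 r10 hr1] := fatou_disc Fw.
have [e1 e10 he1] := chord_near b (ltr01 : (0 : R) < 1).
have [r2 r20 hr2] := hl_cont uU Fw e10.
pose r := Num.min r1 r2 / 2.
have r0 : 0 < r by rewrite divr_gt0// min_gt0.
have rr : r < r1 /\ r < r2.
  have : Num.min r1 r2 <= r1 by rewrite ge_min lexx.
  have : Num.min r1 r2 <= r2 by rewrite ge_min lexx orbT.
  have : 0 < Num.min r1 r2 by rewrite min_gt0.
  by rewrite /r; split; lra.
have hu z : cabs (z - w) <= r -> hl U (Some z) = Some (u z) /\ cabs (u z - b) < 1.
  move=> zr; have [|v hv vb] := he1 (hl U (Some z)).
    by rewrite -hw chordC; apply: hr2; lra.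
  by rewrite /u hv.
exists r => // z zr; split; first by have [] := hu z (ltW zr).
have s0 : 0 < r - cabs (z - w) by rewrite subr_gt0.
have sub x : cabs (x - z) < r - cabs (z - w) -> cabs (x - w) <= r.
  by have := cdist_tri z x w; lra.
apply: (weierstrass MM s0) => e e0.
have h0 : 0 < 2 + cabs b by rewrite ltr_wpDr// cabs_ge0.
have [e2 e20 he2] := chord_near_unif h0 e0.
have KF x : cdisc w r x -> F (Some x) by rewrite /cdisc /= => xr; apply: hr1; lra.
have [n /= hn] := ultra_nonempty uU (hl_unif uU (@cdisc_compact w r) KF e20).
exists (itC n); split=> x /sub xr.
  by have [] := it_holo (@fatou_fin R f n x (KF x xr)).
have [ux ub] := hu x xr.
have [||y] := he2 (u x) (it n (Some x)).
- by have := hyp_le (u x); have := cabs_lB (u x) b; lra.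
- by rewrite -ux chordC; exact: hn.
by rewrite /(itC _) => -> /ltW.
Qed.

Hypothesis FC : connected F.

(** Serves to propagate both the identity theorem and local constancy over the connected set [F]. *)
Lemma fatou_clopen (P : C -> Prop) :
  (forall z, F (Some z) -> P z -> exists2 r : R, 0 < r & forall w, cabs (w - z) < r -> P w) ->
  (forall z, F (Some z) -> (forall r : R, 0 < r -> exists w, [/\ cabs (w - z) < r,
     F (Some w) & P w]) -> P z) ->
  (exists2 z, F (Some z) & P z) -> forall z, F (Some z) -> P z.
Proof.
move=> Po Pc [z0 Fz0 Pz0].
pose B : set Ch := [set b | F b /\ P (finpart b)].
suff BF : B = F by move=> z; rewrite -BF => -[].
apply: FC.
- by exists (Some z0).
- exists B; last by rewrite eqEsubset; split=> b []; [move=> ? ?; split|].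
  rewrite openE => -[z|] [Fz Pz]; last by have := fatou_none Fz.
  have [r1 r10 h1] := fatou_disc Fz; have [r2 r20 h2] := Po z Fz Pz.
  apply/nbhsCP; exists (Num.min r1 r2); first exact: min_gt0.
  by move=> w; rewrite lt_min => /andP[/h1 ? /h2 ?].
- exists (closure B); first exact: closed_closure.
  rewrite eqEsubset; split=> [b [Fb Pb]|[z|] [Fz clz]].
  + by split => //; exact: subset_closure.
  + split => //; apply: Pc => // r r0.
    have [|[w|] [[Fw Pw] wz]] := clz [set b | if b is Some w then cabs (w - z) < r else False].
    * by apply/nbhsCP; exists r.
    * by exists w.
    * by [].
  + by have := fatou_none Fz.
Qed.

Lemma chord_eq b b' : (forall e : R, 0 < e -> chord b b' < e) -> b = b'.
Proof.
move=> h; apply: chord0; apply/eqP; rewrite eq_le chord_ge0 andbT leNgt.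
by apply/negP => /h; rewrite ltxx.
Qed.

Lemma hl_fix_limit (V : set_system nat) z : ultra V -> F (Some z) ->
  (forall e : R, 0 < e -> exists c : C, cabs (c - z) < e /\ hl V (Some c) = Some c) ->
  hl V (Some z) = Some z.
Proof.
move=> uV Fz h; apply: chord_eq => e e0; have e2 : 0 < e / 2 by rewrite divr_gt0.
have [d d0 hd] := hl_cont uV Fz e2.
have [c [cz hc]] := h (Num.min d (e / 4)) ltac:(by rewrite min_gt0// divr_gt0).
move: cz; rewrite lt_min => /andP[/hd h1 h2]; rewrite hc chordC in h1.
have := chord_tri (Some c) (hl V (Some z)) (Some z); have := chord_le c z; lra.
Qed.

(* [V] refines the filter of the differences [n' - n], with [n] and [n'] both
   ranging over [U]. *)
Lemma returns (U : set_system nat) : ultra U -> nonprincipal U -> exists V, [/\ ultra V,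
  V [set m | (0 < m)%N] & forall z, F (Some z) -> F (hl U (Some z)) ->
    hl V (hl U (Some z)) = hl U (Some z)].
Proof.
move=> uU fU; have [PU _] := uU.
pose D : set_system nat := fun A => U [set n | U [set n' | A (n' - n)%N]].
have FD : Filter D.
  split.
  - by rewrite /D; apply: filterE => n; apply: filterE.
  - move=> A B; rewrite /D => DA DB; apply: filterS2 DA DB => n UA UB.
    by apply: filterS2 UA UB => n' An Bn.
  - by move=> A B AB; rewrite /D; apply: filterS => n; apply: filterS => n' /AB.
have PD : ProperFilter D.
  apply: Build_ProperFilter_ex => A; rewrite /D => DA.
  have [n UA] := ultra_nonempty uU DA; have [n' An] := ultra_nonempty uU UA.
  by exists (n' - n)%N.
have [V [uV DV]] := ultra_ex PD; exists V; split => //.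
  apply: DV; rewrite /D; apply: filterE => n; apply: (ultraS uU _ (fU n.+1)) => n'; rewrite /mkset.
  by rewrite subn_gt0.
move=> z Fz; case E : (hl U (Some z)) => [c|] Fc; last by have := fatou_none Fc.
apply: hl_uniq => // e e0; apply: DV.
have e2 : 0 < e / 2 by rewrite divr_gt0.
(* Once [f^n z] is near [c], equicontinuity at [c] compares [f^(n' - n) c] with
   [f^(n' - n) (f^n z) = f^n' z], which is again near [c]. *)
have [d d0 hd] := fatou_equicontinuous fE dg Fc e2.
have [e1 e10 he1] := chord_near c d0.
have h1 := hlP f (Some z) uU e10; rewrite E in h1.
apply: filterS h1 => n /=; rewrite chordC => /he1[w iw wc].
have h2 := hlP f (Some z) uU e2; rewrite E in h2.
apply: filterS2 h2 (fU n) => n' /= h2 nn'.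
have h3 := hd (n' - n)%N w wc; rewrite -iw -itD subnK// chordC in h3.
have := chord_tri (it n' (Some z)) (it (n' - n)%N (Some c)) (Some c); lra.
Qed.

(* Otherwise [returns] makes the iterates converge to the identity along some [V] on
   the open set of values of a nonconstant limit function, hence on all of [F] by the
   identity theorem, and [f] is injective on [F]. *)
Lemma hl_const (U : set_system nat) : ultra U -> nonprincipal U ->
  exists c, forall z, F (Some z) -> hl U (Some z) = c.
Proof.
move=> uU fU.
have [z0 _ Fz0] := fatou_dense 0 ltr01.
have [[z1 [Fz1 Fh nloc]]|loc] := pselect (exists z1, [/\ F (Some z1), F (hl U (Some z1)) &
    forall r : R, 0 < r -> exists2 w, cabs (w - z1) < r & hl U (Some w) <> hl U (Some z1)]).
  exfalso; have [V [uV V0 VU]] := returns uU fU.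
  case hz1 : (hl U (Some z1)) Fh => [c1|] Fh; last by have := fatou_none Fh.
  (* Accumulation of fixed points, rather than being a fixed point, is what the identity theorem
     propagates to a neighbourhood. *)
  pose P w := forall e : R, 0 < e -> exists c : C, [/\ c != w, cabs (c - w) < e &
    hl V (Some c) = Some c].
  have Pfix w : F (Some w) -> P w -> hl V (Some w) = Some w.
    move=> Fw Pw; apply: hl_fix_limit => // e /Pw[c [_ cw hc]]; by exists c.
  have PF : forall z, F (Some z) -> P z.
    apply: fatou_clopen.
    - move=> z Fz Pz; have [r r0 hr] := hl_dif uV Fz (Pfix z Fz Pz).
      have r40 : 0 < r / 4 by rewrite divr_gt0.
      have idr x : cabs (x - z) < r / 2 -> hl V (Some x) = Some x.
        move=> xz; have [-> _] := hr x ltac:(lra); congr Some; apply/eqP.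
        rewrite -subr_eq0; apply/eqP.
        apply: (@isolated_zeros R (fun x => finpart (hl V (Some x)) - x) z r r0) => //.
          by move=> y /hr[_ dy]; apply: difB => //; exact: dif_id.
        move=> e /Pz[c [cz ce hc]]; exists c; split => //.
        by rewrite hc /= subrr.
      exists (r / 4) => // w wz e e0.
      have [c cw cr] := avoid_seq [:: w] w (min_gt0 e0 r40).
      rewrite inE in cw; move: cr; rewrite lt_min => /andP[ce cr].
      exists c; split => //; apply: idr.
      by have := cdist_tri w c z; lra.
    - move=> z Fz h e e0; have e2 : 0 < e / 2 by rewrite divr_gt0.
      have [w [wz Fw Pw]] := h _ e2.
      have [wz'|wz'] := eqVneq w z; first by rewrite wz' in Pw; exact: Pw.
      have [c [cw ce hc]] := Pw (cabs (w - z) / 2) ltac:(by rewrite divr_gt0// cabs_gt0 subr_eq0).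
      have k := cdist_tri w c z; have k0 : 0 < cabs (w - z) by rewrite cabs_gt0 subr_eq0.
      exists c; split => //; last by lra.
      by apply: contraTneq ce => ->; rewrite cdistC -leNgt; lra.
    - exists c1 => // e e0.
      have [r1 r10 hr1] := fatou_disc Fh; have [r2 r20 hr2] := fatou_disc Fz1.
      have m0 : 0 < Num.min e r1 by rewrite min_gt0.
      have [e1 e10 he1] := chord_near c1 m0.
      have [d d0 hd] := hl_cont uU Fz1 e10.
      have [w wz nw] := nloc _ (min_gt0 d0 r20).
      move: wz; rewrite lt_min => /andP[/hd h1 /hr2 Fw].
      rewrite hz1 chordC in h1; have [c hc] := he1 _ h1.
      rewrite lt_min => /andP[ce /hr1 Fc].
      exists c; split => //; first by apply/eqP => cc; apply: nw; rewrite hc hz1 cc.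
      by have := VU w Fw; rewrite hc => /(_ Fc).
  have [z [w [Fz Fw fzw zw]]] := @not_injective R f a g fE dg p rp rp0 gp gp' tJ nrat.
  apply: zw; suff : Some z = Some w :> Ch by case.
  rewrite -(Pfix z Fz (PF z Fz)) -(Pfix w Fw (PF w Fw)).
  apply: hl_uniq => // e e0.
  (* [V] is concentrated on positive indices, where the iterates of [z] and [w] agree because
     [f z = f w]. *)
  apply: ultraS (ultraI uV V0 (hlP f (Some w) uV e0)) => // -[|m] [] //= _.
  by rewrite -!itS !itSr /= fzw.
have {}loc z : F (Some z) -> F (hl U (Some z)) ->
    exists2 r : R, 0 < r & forall w, cabs (w - z) < r -> hl U (Some w) = hl U (Some z).
  move=> Fz Fh; apply: contrapT => no; apply: loc; exists z; split => // r r0.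
  apply: contrapT => nr; apply: no; exists r => // w wz; apply: contrapT => nw.
  by apply: nr; exists w.
have [[z1 Fz1 Fh]|nF] := pselect (exists2 z, F (Some z) & F (hl U (Some z))).
  exists (hl U (Some z1)); apply: fatou_clopen.
  - move=> z Fz hz; have [|r r0 hr] := loc z Fz; first by rewrite hz.
    by exists r => // w /hr ->.
  - move=> z Fz h; apply: chord_eq => e e0; have [d d0 hd] := hl_cont uU Fz e0.
    have [w [wz Fw <-]] := h d d0; rewrite chordC; exact: hd.
  - by exists z1.
(* No limit value lies in [F] now, so a connected set is mapped into the totally disconnected Julia
   set. *)
have imJ : hl U @` F `<=` Julia f.
  by move=> _ [[z|] Fz <-] // Fh; [apply: nF; exists z|have := fatou_none Fz].
have cim : connected (hl U @` F).
  apply: connected_continuous_connected; first exact: FC.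
  apply/subspace_continuousP => -[z|] Fz; last by have := fatou_none Fz.
  move=> W /nbhsSP[e e0 hW]; have [d d0 hd] := hl_cont uU Fz e0.
  by apply/nbhsCP; exists d => // w /hd h _; apply: hW; rewrite chordC.
exists (hl U (Some z0)) => z Fz.
have J0 : Julia f (hl U (Some z0)) by apply: imJ; exists (Some z0).
have : connected_component (Julia f) (hl U (Some z0)) (hl U (Some z)).
  apply: (connected_component_max _ imJ cim); first by exists (Some z0).
  by exists (Some z).
by rewrite (tJ J0).
Qed.

End ConstantLimits.

(** * Sets surrounding the omitted value *)

Section Surrounding.
Variable R : realType.
Notation C := (Cplx R).
Notation Ch := (sphere R).
Implicit Types (z w v : C) (b : Ch).
Variables (f : C -> Ch) (a : C) (g : C -> C).
Hypothesis fE : forall z, f z = if g z == 0 then None else Some (a + (g z)^-1).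
Hypothesis dg : forall z, dif 1 g z.
Variables (p : C) (rp : R).
Hypothesis rp0 : 0 < rp.
Hypothesis gp : g p = 0.
Hypothesis gp' : forall w, cabs (w - p) < rp -> w != p -> g w != 0.
Hypothesis tJ : totally_disconnected (Julia f).
Hypothesis nrat : ~ Defs.rational f.

Local Notation it := (iterate f).
Local Notation F := (Fatou f).
Local Notation hl := (hl f).
Local Notation itC := (itC f).
Let it_holo := @it_holo R f a g fE dg.
Let itC_S := @itC_S R f a g fE.
Let hl_unif := @hl_unif R f a g fE dg.
Let fatou_forward := @fatou_forward R f a g fE dg p rp rp0 gp gp'.
Let fatou_dense := @fatou_dense R f tJ.
Let g_isolated := @g_isolated R g dg p rp rp0 gp gp'.
Let f_fin := @f_fin R f a g fE.
Let MM := @maximum_modulus R.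

Hypothesis FC : connected F.
Let hl_const := @hl_const R f a g fE dg p rp rp0 gp gp' tJ nrat FC.

Lemma far_chord (e : R) : 0 < e -> exists2 h : R, 0 < h &
  forall x, x != a -> cabs (x - a)^-1 <= h -> chord None (Some x : Ch) < e.
Proof.
move=> e0; have a0 := cabs_ge0 a; have e20 : 0 < 2 / e by rewrite divr_gt0.
have p0 : 0 < cabs a + 2 / e + 1 by lra.
exists (cabs a + 2 / e + 1)^-1; first by rewrite invr_gt0.
move=> x xa; rewrite cabsV lef_pV2 ?posrE ?cabs_gt0 ?subr_eq0// => h.
rewrite /chord ltr_pdivrMr ?hyp_gt0// -ltr_pdivrMl//.
by have := cabs_hyp x; have := cabsB x a; rewrite [e^-1 * 2]mulrC; lra.
Qed.

Lemma f_cont z (e : R) : 0 < e ->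
  exists2 d : R, 0 < d & forall w, cabs (w - z) < d -> chord (f w) (f z) < e.
Proof.
move=> e0; have [gz|gz] := eqVneq (g z) 0; last first.
  by apply: (@it_cont R f a g fE dg 1 z) => //; rewrite it1 f_fin.
have [h h0 hh] := far_chord e0; have [d d0 hd] := dif_cont (dg z) h0.
exists d => // w /hd; rewrite gz subr0 => gw.
have -> : f z = None by rewrite fE gz eqxx.
rewrite fE; case: eqVneq => [_|gw0]; first by rewrite chordxx.
have ne : a + (g w)^-1 - a = (g w)^-1 by rewrite addrAC subrr add0r.
rewrite chordC; apply: hh; last by rewrite ne invrK ltW.
by rewrite -subr_eq0 ne invr_eq0.
Qed.

Lemma itC_neq n z : it n.+1 (Some z) <> None -> itC n.+1 z - a != 0 /\
  g (itC n z) != 0.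
Proof.
move=> h; have h1 := it_fin_le h (leqnSn n); move: h; rewrite /(itC _) itC_S//.
case: eqVneq => // gz _; split=> //.
by rewrite addrAC subrr add0r invr_eq0.
Qed.

Lemma boundary_compact (B : set C) : open B -> Cbounded B -> compact (closure B `&` ~` B).
Proof.
move=> oB bB; apply: compactC.
  by have [M hM] := Cbounded_closure bB; exists M => z [/hM].
by apply: closedI; [exact: closed_closure|exact: open_closedC].
Qed.

(* On [B] the iterates are controlled by their values on the boundary, where
   they have constant limits. *)
Lemma no_escape_fatou (B : set C) : open B -> Cbounded B ->
  (forall z, closure B z -> ~ B z -> F (Some z)) ->
  (forall z n, B z -> it n (Some z) <> None) -> forall z, B z -> F (Some z).
Proof.
move=> oB bB bF Bfin.
have clfin z n : closure B z -> it n (Some z) <> None.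
  move=> clz; have [Bz|nB] := pselect (B z); first exact: Bfin.
  exact: (@fatou_fin R f n z (bF z clz nB)).
have icont n z : closure B z -> dif 1 (itC n) z.
  by move=> clz; have [] := it_holo (@clfin z n clz).
have KF z : (closure B `&` ~` B) z -> F (Some z) by case; exact: bF.
have cK := boundary_compact oB bB.
apply: (to_fatou oB Bfin) => U uU e e0.
have [fU|[n0 Un0]] := ultra_cases uU; last first.
  have hn0 b : hl U b = it n0 b.
    by apply: hl_uniq => // r r0; apply: ultraS Un0 => // n -> /=; rewrite chordxx.
  by apply: ultraS Un0 => // n -> w Bw; rewrite hn0 chordxx.
have [c hc] := hl_const uU fU.
suff H (r : R) : 0 < r -> U [set n | forall w, B w -> chord (it n (Some w)) c < r].
  apply: ultraS (H e e0) => // n hn w Bw.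
  rewrite (_ : hl U (Some w) = c); first exact: hn.
  by apply: hl_uniq => // r r0; apply: ultraS (H r r0) => // m; apply.
move=> r0; case: c hc => [b|] hc.
  have r4 : 0 < r / 4 by rewrite divr_gt0.
  have [d d0 hd] := chord_near b r4.
  apply: ultraS (hl_unif uU cK KF d0) => // n hn w Bw.
  suff : cabs (itC n w - b) <= r / 4.
    by rewrite (itC_fin (Bfin w n Bw)) => h; have := chord_le (itC n w) b; lra.
  apply: (@MM B (fun z => itC n z - b) _ oB bB (ltW r4) _ _ _ w Bw) => [z clz|z Bz|z clz nB].
  - by apply: (@dif_cont R 1); apply: difB; [exact: icont|exact: dif_cst].
  - by apply: difB; [apply: icont; exact: subset_closure|exact: dif_cst].
  - have := hn z (conj clz nB); rewrite hc; last exact: bF.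
    by rewrite chordC => /hd[x]; rewrite /(itC _) => -> /ltW.
(* For the limit infinity the principle is applied to [1 / (f^n - a)], which is holomorphic for
   [n >= 1] because [a] is omitted; index 0 is discarded by [fU 1]. *)
have [h h0 hh] := far_chord r0.
have [d d0 hd] := @mobius_cont R a None ltac:(by []) h h0.
apply: ultraS (ultraI uU (fU 1%N) (hl_unif uU cK KF d0)) => // -[|n] [n1 hn].
  by move: n1; rewrite /mkset.
move=> w Bw.
have [wa _] := itC_neq (Bfin w n.+1 Bw).
suff : cabs (itC n.+1 w - a)^-1 <= h.
  rewrite (itC_fin (Bfin w n.+1 Bw)) chordC => k; apply: hh => //.
  by rewrite -subr_eq0.
have dif1 z : closure B z -> dif 1 (fun z => (itC n.+1 z - a)^-1) z.
  move=> clz; apply: difV; first by have [] := itC_neq (clfin z n.+1 clz).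
  by apply: difB; [exact: icont|exact: dif_cst].
apply: (@MM B (fun z => (itC n.+1 z - a)^-1) _ oB bB (ltW h0)
  (fun z clz => dif_cont (dif1 z clz)) _ _ w Bw) => [z Bz|z clz nB].
  by apply: dif1; exact: subset_closure.
have := hn z (conj clz nB); rewrite hc; last exact: bF.
by rewrite chordC (itC_fin (clfin z n.+1 clz)) => /hd; rewrite /mobius subr0 => /ltW.
Qed.

Lemma fatou_iter n z : F (Some z) -> F (it n (Some z)).
Proof.
move=> Fz; elim: n => // n; rewrite itS (itC_fin (@fatou_fin R f n z Fz)).
exact: fatou_forward.
Qed.

Hypothesis Ja : ~ F (Some a).
Variable K0 : set C.
Hypothesis K0F : forall z, K0 z -> F (Some z).
Hypothesis cK0 : compact K0.

Definition surrounded n := exists B : set C, [/\ open B, Cbounded B, B a &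
  forall z, closure B z -> ~ B z -> exists2 z0, K0 z0 & it n (Some z0) = Some z].

(* If [f^m] is the first iterate with a pole in [B], the omitted value [a] lies in
   a bounded component of the complement of [f^m (closure B)], on the boundary of
   which only values of [f^m] on the boundary of [B] can be found. *)
Lemma surrounded_next n : surrounded n -> exists2 m, (n < m)%N & surrounded m.
Proof.
move=> [B [oB bB Ba bdB]].
have bF z : closure B z -> ~ B z -> F (Some z).
  by move=> clz nB; have [z0 /K0F Fz0 <-] := bdB z clz nB; exact: fatou_iter.
have ex : exists m, `[< exists2 z, B z & it m (Some z) = None >].
  apply: contrapT => no; apply: Ja; apply: (no_escape_fatou oB bB bF) => // z m Bz hz.
  by apply: no; exists m; apply/asboolP; exists z.
case: (ex_minnP ex) => -[|m] /asboolP[zp Bzp hzp] mmin; first by [].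
have clfin z : closure B z -> it m (Some z) <> None.
  move=> clz; have [Bz|nB] := pselect (B z); last exact: (@fatou_fin R f m z (bF z clz nB)).
  move=> hz; suff : (m.+1 <= m)%N by rewrite ltnn.
  by apply: mmin; apply/asboolP; exists z.
pose psi z := g (itC m z).
have dpsi z : closure B z -> dif 1 psi z.
  by move=> /clfin h; apply: dif_comp; [have [] := it_holo h|exact: dg].
have cpsi z : closure B z -> ccont psi z by move=> /dpsi/dif_cont.
have dpsiB z : B z -> dif 1 psi z by move=> Bz; apply: dpsi; exact: subset_closure.
have ccl := compact_closureC bB.
have psizp : psi zp = 0.
  move: hzp; rewrite itC_S; last by apply: clfin; exact: subset_closure.
  by case: eqP.
have psibd z : closure B z -> ~ B z -> psi z != 0 /\ it m.+1 (Some z) = Some (a + (psi z)^-1).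
  move=> clz nB; have h := @fatou_fin R f m.+1 z (bF z clz nB).
  have [_ gz] := itC_neq h; split => //.
  by rewrite itC_S ?(negbTE gz)//; exact: clfin.
(* The complement of [f^(m+1) (closure B)], expressed by [psi = 1 / (f^(m+1) - a)]. The point [a] is
   added by hand: since [0^-1 = 0] and [psi] vanishes at the pole [zp], the second condition fails
   there. *)
pose B' := [set w : C | w = a \/ forall z, closure B z -> psi z != (w - a)^-1].
have invc w : w != a -> forall r : R, 0 < r -> exists2 d : R, 0 < d & forall w' : C,
    cabs (w' - w) < d -> w' != a /\ cabs ((w' - a)^-1 - (w - a)^-1) < r.
  move=> wa r r0; rewrite -subr_eq0 in wa.
  have c1 : ccont (fun x => x - a) w by exact: dif_cont (@dif_subc R 0 a w).
  have [d d0 hd] := @ccontV R (fun x => x - a) w wa c1 r r0.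
  have [d' d'0 hd'] := @ccont_neq0 R (fun x => x - a) w c1 wa.
  exists (Num.min d d'); first exact: min_gt0.
  by move=> w'; rewrite lt_min => /andP[/hd ? /hd']; rewrite subr_eq0.
exists (m.+1 + n)%N; first by rewrite addSn ltnS leq_addl.
exists B'; split.
- apply/openCP => w; have [->|wa] := eqVneq w a => hw.
    have [M M0 hM] := cont_bounded ccl cpsi.
    have M1 : 0 < M + 1 by lra.
    exists (M + 1)^-1; first by rewrite invr_gt0.
    move=> w' h; have [->|w'a] := eqVneq w' a; first by left.
    right=> z clz; apply/eqP => e; have := hM z clz; rewrite e cabsV.
    apply/negP; rewrite -ltNge; apply: lt_trans (_ : M < M + 1) _; first by lra.
    by rewrite -[ltLHS]invrK ltf_pV2 ?posrE ?invr_gt0// cabs_gt0 subr_eq0.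
  have {}hw z : closure B z -> psi z - (w - a)^-1 != 0.
    by case: hw => [e|hw clz]; [rewrite e eqxx in wa|rewrite subr_eq0; exact: hw].
  have [r r0 hr] := cont_min ccl (fun z clz => dif_cont (difB (dpsi z clz) (dif_cst 1 _ _))) hw.
  have [d d0 hd] := invc w wa r r0; exists d => // w' /hd[_ h].
  right=> z clz; apply: contraTneq h => <-.
  by rewrite -leNgt; exact: hr.
(* [psi] takes all values near its zero at [zp], so the image of [B] under [f^(m+1)] contains a
   neighbourhood of infinity. *)
- have [d d0 hd] : exists2 d : R, 0 < d & forall v : C, cabs (v - psi zp) < d ->
      exists2 w, B w & psi w = v.
    apply: open_mapping => // w clw nB; rewrite psizp; apply/eqP.
    by have [] := psibd w clw nB.
  have a0 := cabs_ge0 a.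
  exists (cabs a + d^-1) => w [->|hw]; first by rewrite lerDl invr_ge0 ltW.
  rewrite leNgt; apply/negP => h.
  have h2 : d^-1 < cabs (w - a) by have := cabs_lB w a; lra.
  have [|x Bx px] := hd (w - a)^-1.
    rewrite psizp subr0 cabsV -[ltRHS]invrK ltf_pV2 ?posrE ?invr_gt0//.
    by apply: lt_trans h2; rewrite invr_gt0.
  by have := hw x (subset_closure Bx); rewrite px eqxx.
- by left.
- move=> w clw nw.
  have wa : w != a by apply/eqP => e; apply: nw; left.
  suff [z [clz nB pz]] : exists z, [/\ closure B z, ~ B z & psi z = (w - a)^-1].
    have [z0 K0z0 hz0] := bdB z clz nB; exists z0 => //.
    have [_ h] := psibd z clz nB; rewrite itD hz0 h pz invrK.
    by rewrite addrC subrK.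
  apply: contrapT => no; apply: nw; right => z clz; apply/eqP => pz.
  have Bz : B z by apply: contrapT => nB; apply: no; exists z.
  (* If [w] were attained only inside [B], openness of [psi] would put a neighbourhood of [w] into
     the image, away from [B']. *)
  have [d d0 hd] : exists2 d : R, 0 < d & forall v : C, cabs (v - psi z) < d ->
      exists2 x, B x & psi x = v.
    apply: open_mapping => // x clx nB px; apply: no; exists x; split => //.
    by rewrite px.
  have [r r0 hr] := invc w wa d d0.
  have [w' hw' /hr[w'a]] := (closure_CP _ _).1 clw r r0.
  rewrite -pz => /hd[x Bx px].
  case: hw' => [e|h]; first by rewrite e eqxx in w'a.
  by have := h x (subset_closure Bx); rewrite px eqxx.
Qed.

Lemma not_surrounded0 : ~ surrounded 0.
Proof.
move=> s0; have sN N : exists2 n, (N <= n)%N & surrounded n.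
  elim: N => [|N [n Nn /surrounded_next[m nm sm]]]; first by exists 0%N.
  by exists m => //; exact: leq_ltn_trans nm.
(* An ultrafilter finer than the tails of the surrounded indices is nonprincipal and contains the
   set of these indices. *)
pose D : set_system nat := fun A => exists N, forall n, (N <= n)%N -> surrounded n -> A n.
have PD : ProperFilter D.
  apply: Build_ProperFilter_ex.
    by move=> A [N hN]; have [n Nn sn] := sN N; exists n; exact: hN.
  split.
  - by exists 0%N.
  - move=> A A' [N hN] [N' hN']; exists (maxn N N') => n; rewrite geq_max => /andP[h h'] sn.
    by split; [exact: hN|exact: hN'].
  - by move=> A A' AA' [N hN]; exists N => n Nn sn; apply: AA'; exact: hN.
have [U [uU DU]] := ultra_ex PD.
have fU : nonprincipal U by move=> N; apply: DU; exists N.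
have US : U surrounded by apply: DU; exists 0%N.
have [c hc] := hl_const uU fU.
have [z1 _ Fz1] := fatou_dense 0 ltr01.
have fc z : F (Some z) -> hl U (f z) = c.
  move=> Fz; have := fatou_forward Fz; have gz := fatou_g fE Fz.
  by rewrite f_fin//; exact: hc.
case: c hc fc => [b|] hc fc.
  have fb : f b = Some b.
    rewrite -(fc z1 Fz1); apply: esym; apply: hl_uniq => // e e0.
    have [d d0 hd] := f_cont b e0; have [d' d'0 hd'] := chord_near b d0.
    apply: ultraS (hlP f (Some z1) uU d'0) => // n; rewrite /mkset hc// chordC => /hd'[x hx /hd].
    by rewrite -[f z1]/(extend f (Some z1)) -itSr itS hx.
  have ab : 0 < cabs (a - b).
    rewrite cabs_gt0 subr_eq0; apply/eqP => ab.
    move: fb; rewrite -ab fE; case: eqVneq => // ga [/eqP].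
    by rewrite -subr_eq0 addrAC subrr add0r invr_eq0 (negbTE ga).
  have ab2 : 0 < cabs (a - b) / 2 by rewrite divr_gt0.
  have [d d0 hd] := chord_near b ab2.
  have [n [[B [oB bB Ba bd]] hn]] := ultra_nonempty uU (ultraI uU US (hl_unif uU cK0 K0F d0)).
  suff : cabs (a - b) <= cabs (a - b) / 2 by lra.
  apply: (@MM B (fun z => z - b) _ oB bB (ltW ab2) (fun z _ => dif_cont (@dif_subc R 0 b z))
    (fun z _ => @dif_subc R 1 b z) _ a Ba) => z clz nB.
  have [z0 K0z0 hz0] := bd z clz nB.
  have := hn z0 K0z0; rewrite hc ?hz0; last exact: K0F.
  by rewrite chordC => /hd[x [->] /ltW].
(* The limit along the shifted ultrafilter is infinity too: on the surrounding boundaries both the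
   point and its image under [f] are then near infinity. *)
have fU' : nonprincipal (succn @ U).
  by move=> N; apply: (ultraS uU _ (fU N)) => n; exact: leqW.
have uU' := ultra_map succn uU.
have hc' z : F (Some z) -> hl (succn @ U) (Some z) = None.
  move=> Fz; apply: hl_uniq => // e e0.
  apply: (ultraS uU _ (hlP f (f z) uU e0)) => n; rewrite /mkset fc//.
  by rewrite /preimage /mkset itSr.
(* [g] may vanish at [a], so this zero is divided out. On a boundary with [|z - a| >= 1] one has
   [|G| <= |g|], and the maximum principle for [G] contradicts [G a != 0]. *)
have [[k [G [gG dG Ga]]]|g0] := zero_order ltr01 (fun z (_ : cabs (z - a) < 1) => dg z); last first.
  have [r r0 hr] := g_isolated a.
  have [w] := avoid_seq [:: a] a (min_gt0 r0 (divr_gt0 ltr01 (ltr0n R 2))).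
  rewrite inE lt_min => wa /andP[wr wh].
  by have := hr w wr wa; rewrite !g0 ?eqxx// subrr cabs0 divr_gt0.
have Ga2 : 0 < cabs (G a) / 2 by rewrite divr_gt0// cabs_gt0.
have [d d0 hd] := @mobius_cont R a None ltac:(by []) _ Ga2.
have [d' d'0 hd'] := @mobius_cont R a None ltac:(by []) _ (@ltr01 R).
have [n [[[B [oB bB Ba bd]] hn] hn']] := ultra_nonempty uU (ultraI uU
  (ultraI uU US (hl_unif uU cK0 K0F d'0)) (hl_unif uU' cK0 K0F d0)).
suff : cabs (G a) <= cabs (G a) / 2 by lra.
apply: (@MM B G _ oB bB (ltW Ga2) (fun z _ => dif_cont (dG z (dg z)))
  (fun z _ => dG z (dg z)) _ a Ba).
move=> z clz nB; have [z0 K0z0 hz0] := bd z clz nB.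
have za : z - a != 0 by rewrite subr_eq0; apply/eqP => e; apply: nB; rewrite e.
have z1' : 1 <= cabs (z - a).
  have := hn z0 K0z0; rewrite hc ?hz0; last exact: K0F.
  rewrite chordC => /hd'; rewrite /mobius subr0 cabsV => h.
  rewrite leNgt; apply/negP => h'; move: h.
  by rewrite invf_lt1 ?cabs_gt0// ltNge ltW.
have gz : cabs (g z) < cabs (G a) / 2.
  have := hn' z0 K0z0; rewrite hc'; last exact: K0F.
  rewrite itS hz0 chordC => /hd; rewrite /extend f_fin; last first.
    apply: (fatou_g fE); rewrite -hz0; apply: fatou_iter; exact: K0F.
  by rewrite /mobius subr0 addrAC subrr add0r invrK.
have G0 := cabs_ge0 (G z).
by apply: le_trans (ltW gz); rewrite gG cabsM cabsX ler_peMl// exprn_ege1.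
Qed.

End Surrounding.

(** * Passage to an entire function, and the conclusion *)

Section Reduction.
Variable R : realType.
Notation C := (Cplx R).
Notation Ch := (sphere R).
Implicit Types (z w v : C) (b : Ch).
Variable f : C -> Ch.
Hypothesis mf : meromorphic f.

Lemma julia_closed : closed (Julia f).
Proof. exact/open_closedC/fatou_open. Qed.

Lemma fatou_connected : totally_disconnected (Julia f) -> connected (Fatou f).
Proof.
move=> tJ; rewrite -[Fatou f]setCK; apply: td_complement_connected => //.
  exact: julia_closed.
exact: fatou_none.
Qed.

Lemma pole_near z : pole_at f z -> exists2 r : R, 0 < r &
  forall w, cabs (w - z) < r -> w != z -> f w <> None.
Proof.
move=> [_ /nbhsCP[r r0 hr] _]; exists r => // w wr wz.
by have [] := hr w wr wz.
Qed.

(** At a finite value [f - a] is nonzero because [a] is omitted; at a pole the reciprocal extends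
    continuously by 0 and [removable] applies. *)
Lemma recip_dif a z : ~ range f (Some a) -> dif 1 (fun z => mobius a (f z)) z.
Proof.
move=> oa.
have hol w : holomorphic_at f w -> dif 1 (fun z => mobius a (f z)) w.
  move=> /nbhsCP[r r0 hr].
  have E x : f x <> None -> mobius a (f x) = (finpart (f x) - a)^-1 by case: (f x).
  apply: (@dif_near _ _ (fun x => (finpart (f x) - a)^-1)).
    by exists r => // x /hr[/E ->].
  have [|fw dw] := hr w; first by rewrite subrr cabs0.
  apply: difV; last by apply: difB; [exact: derivable_dif|exact: dif_cst].
  rewrite subr_eq0; apply/eqP => e; apply: oa; exists w => //.
  by move: e fw; case: (f w) => // x /= ->.
have [/hol//|pz] := mf z.
have [r r0 hr] := pole_near pz; have [fz _ cz] := pz.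
apply: (@removable R 0 (@maximum_modulus R) _ z r r0).
  move=> e e0; have [d d0 hd] := @mobius_cont R a None ltac:(by []) e e0.
  have /cz/nbhsCP[s s0 hs] : nbhs (None : Ch) [set b | chord None b < d].
    by apply/nbhsSP; exists d.
  exists s => // w ws; rewrite fz; have [->|wz] := eqVneq w z.
    by rewrite fz subrr cabs0.
  by apply: hd; exact: hs.
move=> w wr wz; have [/hol//|[fw _ _]] := mf w.
by have := hr w wr wz.
Qed.

End Reduction.

Theorem corollary2p9 (R : realType) (f : Cplx R -> sphere R) :
  class_Mo f ->
  ~ (exists U : set (sphere R), Fatou_component f U /\ omitted_values f `<=` U) ->
  ~ totally_disconnected (Julia f).
Proof.
move=> [[[mf nrat] Mf] _] nU tJ.
have [p fp] : exists p, pole_at f p.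
  by case: Mf => [[p [_ [_ ? _]]]|[p [P _]]]; exists p => //; rewrite P.
have FC := fatou_connected tJ.
have [z0 _ Fz0] := fatou_dense tJ 0 (ltr01 : (0 : R) < 1).
have [a oa Ja] : exists2 a : Cplx R, ~ range f (Some a) & ~ Fatou f (Some a).
  apply: contrapT => no; apply: nU; exists (connected_component (Fatou f) (Some z0)).
  split; first by exists (Some z0).
  rewrite connected_component_id// => -[a|] ob.
    by apply: contrapT => nF; apply: no; exists a.
  by exfalso; apply: ob; have [fp0 _ _] := fp; exists p.
pose g z := mobius a (f z).
have fE z : f z = if g z == 0 then None else Some (a + (g z)^-1).
  rewrite /g; case E : (f z) => [w|] /=; last by rewrite eqxx.
  rewrite invr_eq0 subr_eq0; case: eqVneq => [wa|_]; last by rewrite invrK addrC subrK.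
  by exfalso; apply: oa; exists z => //; rewrite E wa.
have dg z : dif 1 g z by exact: recip_dif.
have [r r0 hr] := pole_near fp.
have gp : g p = 0 by rewrite /g; have [-> _ _] := fp.
have gp' w : cabs (w - p) < r -> w != p -> g w != 0.
  move=> wr wp; have := hr w wr wp; rewrite (fE w); by case: eqP.
have [B [oB bB Ba bF]] := td_bounded_nbhd (@julia_closed R f) tJ Ja (@fatou_none R f).
have KF z : (closure B `&` ~` B) z -> Fatou f (Some z).
  by case=> clz nB; apply: contrapT; exact: bF.
(* With the boundary of [B] as [K0], the set [B] itself surrounds [a] at index 0. *)
apply: (not_surrounded0 fE dg r0 gp gp' tJ nrat FC Ja KF (boundary_compact oB bB)).
by exists B; split => // z clz nB; exists z.
Qed.
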